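(* Let $\mathcal{T}$ be a positive linear form on $\mathcal{L}_{n,m}$. The following are equivalent. (1) (Bernstein–Szegő condition) There exists $p\in\mathbb{C}[z,w]$ with no zeros on $\mathbb{T}\times\overline{\mathbb{D}}$ and degree at most $(n,m)$ such that $$\mathcal{T}(z^jw^k)=\int_{\mathbb{T}^2} z^jw^k\,\frac{|dz||dw|}{(2\pi)^2|p(z,w)|^2}\qquad\text{for all } |j|\le n,\ |k|\le m.$$ (2) (Split-shift condition) $\mathcal{T}$ satisfies the split-shift orthogonality condition. (3) (Matrix condition) The invariant subspace of $T$ generated by the range of $B$ is contained in the kernel of $A$; more concretely, $AT^jB=0$ for $j=0,1,\dots,n-1$.
   Context: $\mathbb{D}=\{|z|<1\}$, $\mathbb{T}=\partial\mathbb{D}$, $\overline{\mathbb{D}}$ is the closed disk; $n,m$ are nonnegative integers. $\mathcal{L}_{j,k}$ is the complex span of the Laurent monomials $z^sw^t$, $-j\le s\le j$, $-k\le t\le k$, and $\mathcal{P}_{j,k}$ is the complex span of $z^sw^t$, $0\le s\le j$, $0\le t\le k$ (with $\mathcal{P}_{j,k}=\{0\}$ if $j<0$ or $k<0$). A polynomial has degree at most $(n,m)$ if it lies in $\mathcal{P}_{n,m}$. For a polynomial $g$, $\bar g(z,w)=\overline{g(\bar z,\bar w)}$. A linear form $\mathcal{T}:\mathcal{L}_{n,m}\to\mathbb{C}$ is positive if $\mathcal{T}(f(z,w)\bar f(1/z,1/w))>0$ for all nonzero $f\in\mathcal{P}_{n,m}$. Let $\mathcal{H}_{\mathcal T}$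 be the finite-dimensional Hilbert space $\mathcal{P}_{n,m}$ with inner product $\langle f,g\rangle_{\mathcal T}=\mathcal{T}(f(z,w)\bar g(1/z,1/w))$. All orthogonality, $\ominus$, $\oplus$ (orthogonal direct sum) and orthogonal projections $P_{\mathcal{M}}$ are in $\mathcal{H}_{\mathcal T}$. Put $\mathcal{E}^1_{k,l}=\mathcal{P}_{k,l}\ominus w\mathcal{P}_{k,l-1}$, $\mathcal{E}^2_{k,l}=\mathcal{P}_{k,l}\ominus z\mathcal{P}_{k-1,l}$, $\mathcal{F}^2_{k,l}=\mathcal{P}_{k,l}\ominus\mathcal{P}_{k-1,l}$. Split-shift orthogonality condition: there exist subspaces of polynomials $\mathcal{K}_1,\mathcal{K}_2\subset\mathcal{H}_{\mathcal T}$ with (i) $\mathcal{E}^1_{n-1,m}=\mathcal{K}_1\oplus\mathcal{K}_2$, (ii) $\mathcal{K}_1\perp z\mathcal{K}_2$, (iii) $\mathcal{K}_1,\ z\mathcal{K}_2\subset\mathcal{E}^1_{n,m}$. Operators ($M_z$ is multiplication by $z$): $A=P_{w\mathcal{E}^2_{n,m-1}}M_z:\mathcal{E}^1_{n-1,m}\to w\mathcal{E}^2_{n,m-1}$; $B=P_{\mathcal{E}^1_{n-1,m}}:w\mathcal{F}^2_{n,m-1}\to\mathcal{E}^1_{n-1,m}$; $T=P_{\mathcal{E}^1_{n-1,m}}M_z:\mathcal{E}^1_{n-1,m}\to\mathcal{E}^1_{n-1,m}$. *)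

(* Defs.v *)
From HB Require Import structures.
From mathcomp Require Import all_boot all_order all_algebra.
From mathcomp Require Import polyXY complex ring.
From mathcomp Require Import all_classical all_reals all_analysis.

Set Implicit Arguments.
Unset Strict Implicit.
Unset Printing Implicit Defensive.

Import Order.TTheory GRing.Theory Num.Theory.
Local Open Scope ring_scope.

Section LinearForms.
Variables (C : numClosedFieldType) (n m : nat).

(* P_{n,m}, by coefficients: the entry (i, j) of a matrix is the coefficient
   of z^i w^j. *)
Definition bipoly := 'M[C]_(n.+1, m.+1).
HB.instance Definition _ := Vector.on bipoly.

(* L_{n,m}, by coefficients: the entry (i, j) of a matrix is the coefficient
   of z^(i - n) w^(j - m). *)
Definition laurent := 'M[C]_((n + n).+1, (m + m).+1).
HB.instance Definition _ := Vector.on laurent.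

(* z^s w^t, for |s| <= n and |t| <= m. *)
Definition lmonom (s t : int) : laurent :=
  \matrix_(i, j) ((i%:Z - n%:Z == s) && (j%:Z - m%:Z == t))%:R.

(* f(z, w) \bar g(1/z, 1/w). *)
Definition mulbar (f g : bipoly) : laurent :=
  \sum_i \sum_j \sum_k \sum_l
    (f i j * (g k l)^*) *: lmonom (i%:Z - k%:Z) (j%:Z - l%:Z).

Definition positive_form (T : {scalar laurent}) :=
  forall f : bipoly, f != 0 -> 0 < T (mulbar f f).

Definition ip (T : {scalar laurent}) (hT : positive_form T) (f g : bipoly) : C :=
  T (mulbar f g).

Fact mulbar_linearl g : linear (mulbar ^~ g).
Proof.
move=> a f f'; rewrite /mulbar scaler_sumr -big_split; apply: eq_bigr => i _.
rewrite scaler_sumr -big_split; apply: eq_bigr => j _.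
rewrite scaler_sumr -big_split; apply: eq_bigr => k _.
rewrite scaler_sumr -big_split; apply: eq_bigr => l _ /=.
by rewrite !mxE mulrDl scalerDl scalerA mulrA.
Qed.

Fact mulbar_linearr a f g g' : mulbar f (a *: g + g') =
  a^* *: mulbar f g + mulbar f g'.
Proof.
rewrite /mulbar scaler_sumr -big_split; apply: eq_bigr => i _.
rewrite scaler_sumr -big_split; apply: eq_bigr => j _.
rewrite scaler_sumr -big_split; apply: eq_bigr => k _.
rewrite scaler_sumr -big_split; apply: eq_bigr => l _ /=.
by rewrite !mxE rmorphD rmorphM mulrDr scalerDl scalerA mulrCA.
Qed.

Section InnerProduct.
Variables (T : {scalar laurent}) (hT : positive_form T).

Fact ip_bilinear : bilinear_for *%R (Num.conj \; *%R) (ip hT).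
Proof.
split=> [g a f f'|f a g g']; rewrite /ip.
  by rewrite mulbar_linearl linearP.
by rewrite mulbar_linearr linearP.
Qed.

HB.instance Definition _ :=
  bilinear_isBilinear.Build C bipoly bipoly C *%R (Num.conj \; *%R) (ip hT)
    ip_bilinear.

Fact ip_hermitian f g : ip hT f g = (-1) ^+ false * (ip hT g f)^*.
Proof.
have real h : (ip hT h h)^* = ip hT h h.
  apply/CrealP/ger0_real; have [->|/hT/ltW//] := eqVneq h 0.
  by rewrite linear0l.
have E u v : ip hT u v + ip hT v u = (ip hT u v)^* + (ip hT v u)^*.
  have P : ip hT (u + v) (u + v) = ip hT u u + ip hT v v + (ip hT u v + ip hT v u).
    by rewrite linearDl /= !linearDr /=; ring.
  by have := real (u + v); rewrite P !rmorphD /= !real => /addrI.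
rewrite expr0 mul1r; apply/eqP; rewrite -subr_eq0.
set a := ip hT f g; set b := ip hT g f.
have E1 : a + b = a^* + b^* by exact: E.
have E2 : - a + b = a^* - b^*.
  have Zr : ip hT f ('i *: g) = - 'i * a by rewrite linearZr_LR /= conjCi.
  have Zl : ip hT ('i *: g) f = 'i * b by rewrite linearZl_LR.
  have := E f ('i *: g); rewrite Zr Zl mulNr (rmorphN Num.conj) !(rmorphM Num.conj) /=.
  rewrite conjCi => Ei; apply: (mulfI (neq0Ci C)).
  by rewrite mulrDr mulrN Ei; ring.
have : 2 * (a - b^*) = 0.
  have : (a + b) - (- a + b) = (a^* + b^*) - (a^* - b^*) by rewrite E1 E2.
  by move=> H; rewrite (_ : 2 * _ = ((a + b) - (- a + b)) - ((a^* + b^*) - (a^* - b^*))); [rewrite H subrr | ring].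
by move/eqP; rewrite mulf_eq0 pnatr_eq0.
Qed.

HB.instance Definition _ :=
  isHermitianSesquilinear.Build C bipoly false Num.conj (ip hT) ip_hermitian.

HB.instance Definition _ := isDotProduct.Build C bipoly (ip hT) hT.

End InnerProduct.

(* The matrix [f] as an element of C[z, w], with z = 'X and w = 'Y. *)
Definition to_polyXY (f : bipoly) : {poly {poly C}} :=
  \sum_i \sum_j (f i j)%:P%:P * 'X^i * 'Y^+j.

Definition of_polyXY (q : {poly {poly C}}) : bipoly := \matrix_(i, j) q`_i`_j.

Fact to_polyXYK : cancel to_polyXY of_polyXY.
Proof.
move=> f; apply/matrixP=> i j; rewrite mxE /to_polyXY.
have H k l : ((f k l)%:P%:P * 'X^k * 'Y^+l)`_i`_j =
    f k l * ((j == l)%:R * (i == k)%:R).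
  rewrite -polyC_exp mulrAC -polyCM coefCM coefXn.
  rewrite (_ : (i == k :> nat) = (i == k)) // mulr_natr coefMn coefCM coefXn.
  by rewrite -mulrnAr mulr_natr.
have G k : (\sum_l (f k l)%:P%:P * 'X^k * 'Y^+l)`_i`_j = f k j * (i == k)%:R.
  rewrite !coef_sum (eq_bigr _ (fun l _ => H k l)) (bigD1 j) //= eqxx mul1r.
  rewrite big1 ?addr0 // => l nlj.
  by rewrite [j == l]eq_sym (negbTE nlj) mul0r mulr0.
rewrite !coef_sum (eq_bigr _ (fun k _ => G k)) (bigD1 i) //= eqxx mulr1.
rewrite big1 ?addr0 // => k nki.
by rewrite [i == k]eq_sym (negbTE nki) mulr0.
Qed.

Definition mulXY (u : {poly {poly C}}) (f : bipoly) : bipoly :=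
  of_polyXY (u * to_polyXY f).

Fact mulXY_linear u : linear (mulXY u).
Proof.
move=> a f g; rewrite {1}/mulXY; have -> : to_polyXY (a *: f + g) =
    a%:P%:P * to_polyXY f + to_polyXY g.
  rewrite /to_polyXY mulr_sumr -big_split; apply: eq_bigr => i _.
  rewrite mulr_sumr -big_split; apply: eq_bigr => j _ /=.
  by rewrite !mxE !polyCD !polyCM; ring.
by apply/matrixP=> i j; rewrite !mxE mulrDr mulrCA !coefD !coefCM.
Qed.

HB.instance Definition _ u :=
  GRing.isLinear.Build C bipoly bipoly _ (mulXY u) (mulXY_linear u).

(* Multiplication by z and by w. Terms of degree above (n, m) are dropped, so
   these are only meant on P_{n-1,m} and P_{n,m-1} respectively. *)
Definition Mz : 'End(bipoly) := linfun (mulXY 'X).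
Definition Mw : 'End(bipoly) := linfun (mulXY 'Y).

(* P_{j,k} inside P_{n,m}; it is 0 if j < 0 or k < 0. *)
Definition polys (j k : int) : {vspace bipoly} :=
  (\sum_(s < n.+1 | (s%:Z <= j)%R) \sum_(t < m.+1 | (t%:Z <= k)%R)
     <[delta_mx s t : bipoly]>)%VS.

Section Hilbert.
Variables (T : {scalar laurent}) (hT : positive_form T).

Definition orth (U : {vspace bipoly}) := orthov (ip hT) U.

Definition ominus (U W : {vspace bipoly}) : {vspace bipoly} := (U :&: orth W)%VS.

Definition is_orth_sum (U V W : {vspace bipoly}) :=
  (V <= orth W)%VS /\ U = (V + W)%VS.

Definition orth_proj (U : {vspace bipoly}) : 'End(bipoly) :=
  daddv_pi U (orth U).

Definition E1 (k l : int) := ominus (polys k l) (Mw @: polys k (l - 1)).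
Definition E2 (k l : int) := ominus (polys k l) (Mz @: polys (k - 1) l).
Definition F2 (k l : int) := ominus (polys k l) (polys (k - 1) l).

Definition split_shift_orthogonality :=
  exists K1 K2 : {vspace bipoly},
    [/\ is_orth_sum (E1 (n%:Z - 1) m) K1 K2,
        (K1 <= orth (Mz @: K2))%VS,
        (K1 <= E1 n m)%VS &
        (Mz @: K2 <= E1 n m)%VS].

Definition domT := E1 (n%:Z - 1) m.
Definition codA := (Mw @: E2 n (m%:Z - 1))%VS.
Definition domB := (Mw @: F2 n (m%:Z - 1))%VS.

(* For an endomorphism [h] of P_{n,m}, the operator P_V h : U -> V. *)
Definition compress (U V : {vspace bipoly}) (h : 'End(bipoly)) :
    'Hom(subvs_of U, subvs_of V) :=
  (linfun (vsproj V) \o orth_proj V \o h \o linfun vsval)%VF.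

Definition opA : 'Hom(subvs_of domT, subvs_of codA) := compress domT codA Mz.
Definition opB : 'Hom(subvs_of domB, subvs_of domT) := compress domB domT \1%VF.
Definition opT : 'End(subvs_of domT) := compress domT domT Mz.

End Hilbert.
End LinearForms.

Arguments lmonom C {n m} s t.

(* The subspace invariant under [h] generated by [U], as a set: the
   intersection of all invariant subspaces containing [U]. *)
Definition invariant_hull (F : fieldType) (V : vectType F) (h : 'End(V))
    (U : {vspace V}) : set V :=
  [set x | forall W : {vspace V}, (U <= W)%VS -> (h @: W <= W)%VS -> x \in W].

Section Torus.
Variable R : realType.
Local Open Scope complex_scope.

Definition expi (t : R) : R[i] := cos t +i* sin t.

(* The integral of F over T^2 against |dz||dw|. *)
Definition torus_integral (F : R[i] -> R[i] -> R[i]) : R[i] :=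
  let mu := (@lebesgue_measure R \x @lebesgue_measure R)%E in
  let D := (`[0%R, (2 * pi)%R] `*` `[0%R, (2 * pi)%R])%classic in
  let G (t : measurableTypeR R * measurableTypeR R) := F (expi t.1) (expi t.2) in
  (\int[mu]_(t in D) complex.Re (G t)) +i* (\int[mu]_(t in D) complex.Im (G t)).

Definition bernstein_szego (n m : nat) (T : {scalar laurent R[i] n m}) :=
  exists p : {poly {poly R[i]}},
    [/\ (size p <= n.+1)%N /\ (sizeY p <= m.+1)%N,
        forall z w : R[i], `|z| = 1 -> `|w| <= 1 -> p.[z, w] != 0 &
        forall j k : int, `|j| <= n%:Z -> `|k| <= m%:Z ->
          T (lmonom _ j k) =
            torus_integral (fun z w =>
              z ^ j * w ^ k / (((2 * pi) ^+ 2)%:C * `|p.[z, w]| ^+ 2))].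

End Torus.

(* Main.v *)
(* Write [P = P_{n,m}], [P' = P_{n-1,m}], and let [F] be an orthonormal basis of
   the orthocomplement of [P'] in [P].

   (1) implies (3). For [|z| = 1] the Toeplitz matrix of the one-variable weight
   [1 / |p(z, w)|^2] has, by the Gohberg-Semencul formula, an inverse whose
   entries are trigonometric polynomials in [z] of degree at most [n]. A vector
   of [P] orthogonal to [P'] is therefore orthogonal to every [z^s w^t] with
   [s < n], negative [s] included. It follows that the vectors orthogonal to all
   [z^s w^t] with [s < n] and [1 <= t <= m] contain the range of [B], are stable
   under [T], and are killed by [A].

   (3) implies (2). Let [K_2] be the largest [T]-invariant subspace of [ker A] and
   [K_1] its orthocomplement.

   (2) implies (1). Let [p] be the unit vector of [E^1_{n,m}] orthogonal to [K_1]
   and [z K_2]. Restricted to equal [z] on the circle, the reproducing kernels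
   [G] of [F] and [G'] of its analogue for [P_{n,m-1}] satisfy
   [G = w v^* G' + p p^*], since two orthogonal decompositions of [P] have the same
   kernel; the reversal of coefficients turns this into [G = G' + q q^*], with [q]
   the reversal of [p] in [w]. These two identities make [p] zero-free and [G] the
   inverse of the Toeplitz matrix of [1 / |p|^2]. The coefficient matrix of [F] is
   invertible for [|z| >= 1], so the functional of [1 / |p|^2] has the same [F] as
   the given one, and [F] determines the moments. *)
Require Import Defs.
From HB Require Import structures.
From mathcomp Require Import all_boot all_order all_algebra.
From mathcomp Require Import polyXY complex ring zify.
From mathcomp Require Import all_classical all_reals all_analysis measurable_realfun.

Set Implicit Arguments.
Unset Strict Implicit.
Unset Printing Implicit Defensive.

Import Order.TTheory GRing.Theory Num.Theory.
Import numFieldNormedType.Exports.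
Local Open Scope ring_scope.

(** * Complex-valued integrals *)

(** The zeros of [p] are controlled only over the circle [|z| = 1], so nothing is analytic in [z]: a
    one-variable problem in [w] is solved for each [z], and integration over [z] leaves a
    convolution identity with a matrix polynomial in [z]. Boundedness takes the place of analytic
    continuation: a bounded sequence annihilated by a polynomial in the shift vanishes as soon as no
    root of that polynomial admits a bounded geometric sequence. For two-sided sequences the roots
    need only avoid the circle, which suits the inverse Toeplitz symbol, whose determinant is known
    to be nonzero only there. For one-sided sequences they must avoid the closed disk, and there the
    coefficient matrix of [F], reversed, is invertible. The same contraction [y_r = a y_{r+1}] gives
    the integrals of [w^k / q(w)]. That [F] determines the moments is seen on the operator
    representing the difference of the two forms: it kills [F] and its reversals and commutes with
    [z], so its range is divisible by every power of [z]. *)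

Section ComplexIntegral.
Context d (T : measurableType d) (R : realType).
Variables (mu : {measure set T -> \bar R}) (D : set T).
Hypotheses (mD : measurable D) (muD : (mu D < +oo)%E).
Implicit Types f g : T -> R[i].

Definition cintegral f : R[i] :=
  ((\int[mu]_(x in D) complex.Re (f x)) +i* (\int[mu]_(x in D) complex.Im (f x)))%C.

(** Every integrand is bounded on a set of finite measure, so this replaces integrability; unlike
    integrability it is stable under products. *)
Definition bounded_measurable f :=
  [/\ measurable_fun setT (fun x => complex.Re (f x)),
      measurable_fun setT (fun x => complex.Im (f x)) &
      exists M : R, forall x, D x ->
        `|complex.Re (f x)| <= M /\ `|complex.Im (f x)| <= M].

Lemma eq_bounded_measurable f g : f =1 g ->
  bounded_measurable g -> bounded_measurable f.
Proof. by move=> /funext ->. Qed.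

Lemma bounded_measurable_Re f : bounded_measurable f ->
  mu.-integrable D (EFin \o (fun x => complex.Re (f x))).
Proof.
move=> [mf _ [M fM]]; apply: measurable_bounded_integrable => //.
  exact: measurable_funTS.
by exists M; split=> [|y My x Dx]; [rewrite num_real|exact: le_trans (fM x Dx).1 (ltW My)].
Qed.

Lemma bounded_measurable_Im f : bounded_measurable f ->
  mu.-integrable D (EFin \o (fun x => complex.Im (f x))).
Proof.
move=> [_ mf [M fM]]; apply: measurable_bounded_integrable => //.
  exact: measurable_funTS.
by exists M; split=> [|y My x Dx]; [rewrite num_real|exact: le_trans (fM x Dx).2 (ltW My)].
Qed.

Lemma bounded_measurableD f g : bounded_measurable f -> bounded_measurable g ->
  bounded_measurable (fun x => f x + g x).
Proof.
move=> [f1 f2 [M fM]] [g1 g2 [N gN]]; split.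
- under eq_fun do rewrite raddfD; exact: measurable_funD.
- under eq_fun do rewrite raddfD; exact: measurable_funD.
- exists (M + N) => x Dx; have [a b] := fM x Dx; have [a' b'] := gN x Dx.
  by rewrite !raddfD /=; split; apply: le_trans (ler_normD _ _) _; apply: lerD.
Qed.

Lemma bounded_measurableM f g : bounded_measurable f -> bounded_measurable g ->
  bounded_measurable (fun x => f x * g x).
Proof.
have ReM (x y : R[i]) : complex.Re (x * y) =
    complex.Re x * complex.Re y - complex.Im x * complex.Im y.
  by case: x; case: y.
have ImM (x y : R[i]) : complex.Im (x * y) =
    complex.Re x * complex.Im y + complex.Im x * complex.Re y.
  by case: x; case: y.
move=> [f1 f2 [M fM]] [g1 g2 [N gN]]; split.
- under eq_fun do rewrite ReM.
  by apply: measurable_funB; apply: measurable_funM.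
- under eq_fun do rewrite ImM.
  by apply: measurable_funD; apply: measurable_funM.
- exists (M * N + M * N) => x Dx; have [a b] := fM x Dx; have [a' b'] := gN x Dx.
  rewrite ReM ImM; split.
    by apply: le_trans (ler_normB _ _) _; rewrite !normrM; apply: lerD; apply: ler_pM.
  by apply: le_trans (ler_normD _ _) _; rewrite !normrM; apply: lerD; apply: ler_pM.
Qed.

Lemma bounded_measurable_cst a : bounded_measurable (fun=> a).
Proof.
split; [exact: measurable_cst..|exists (`|complex.Re a| + `|complex.Im a|) => x _].
by rewrite lerDl lerDr !normr_ge0.
Qed.

Lemma bounded_measurable_conj f : bounded_measurable f ->
  bounded_measurable (fun x => (f x)^*).
Proof.
move=> [f1 f2 [M fM]]; split.
- by rewrite (_ : (fun x => _) = fun x => complex.Re (f x)) //; apply/funext => x; case: (f x).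
- rewrite (_ : (fun x => _) = fun x => - complex.Im (f x)); last first.
    by apply/funext => x; case: (f x).
  exact: measurable_funN.
- by exists M => x /fM; case: (f x) => a b /=; rewrite normrN.
Qed.

Lemma bounded_measurable_sum (I : Type) (r : seq I) (F : I -> T -> R[i]) :
  (forall i, bounded_measurable (F i)) ->
  bounded_measurable (fun x => \sum_(i <- r) F i x).
Proof.
move=> bF; elim: r => [|i r IH].
  under eq_fun do rewrite big_nil; exact: bounded_measurable_cst.
under eq_fun do rewrite big_cons; exact: bounded_measurableD.
Qed.

Lemma bounded_measurableX f k : bounded_measurable f ->
  bounded_measurable (fun x => f x ^+ k).
Proof.
move=> bf; elim: k => [|k IH].
  under eq_fun do rewrite expr0; exact: bounded_measurable_cst.
under eq_fun do rewrite exprS; exact: bounded_measurableM.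
Qed.

Lemma cintegralD f g : bounded_measurable f -> bounded_measurable g ->
  cintegral (fun x => f x + g x) = cintegral f + cintegral g.
Proof.
move=> bf bg; rewrite /cintegral.
under eq_Rintegral do rewrite raddfD.
under [X in (_ +i* X)%C]eq_Rintegral do rewrite raddfD.
by rewrite !RintegralD //; do ?[exact: bounded_measurable_Re|exact: bounded_measurable_Im].
Qed.

Lemma cintegralZ a f : bounded_measurable f ->
  cintegral (fun x => a * f x) = a * cintegral f.
Proof.
case: a => a b bf; rewrite /cintegral.
have iR := bounded_measurable_Re bf; have iI := bounded_measurable_Im bf.
have iZ (h : T -> R) c : mu.-integrable D (EFin \o h) ->
    mu.-integrable D (EFin \o (fun x => c * h x)).
  by move=> ih; apply: (integrableZl mD c ih).
transitivity ((\int[mu]_(x in D) (a * complex.Re (f x) - b * complex.Im (f x))) +i*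
    (\int[mu]_(x in D) (a * complex.Im (f x) + b * complex.Re (f x))))%C.
  by apply: (f_equal2 (@Complex R)); apply: eq_Rintegral => x _; case: (f x).
by rewrite RintegralB ?RintegralD // ?RintegralZl //; do ?exact: iZ.
Qed.

Lemma cintegral_conj f : bounded_measurable f ->
  cintegral (fun x => (f x)^*) = (cintegral f)^*.
Proof.
move=> bf.
rewrite [RHS](_ : _ = (complex.Re (cintegral f) +i* - complex.Im (cintegral f))%C) //.
rewrite /cintegral /=; apply: (f_equal2 (@Complex R)).
  by apply: eq_Rintegral => x _; case: (f x).
rewrite (@eq_Rintegral _ _ _ _ _ (fun x => (-1) * complex.Im (f x))); last first.
  by move=> x _; case: (f x) => a b; rewrite mulN1r.
by rewrite RintegralZl ?mulN1r //; exact: bounded_measurable_Im.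
Qed.

Lemma eq_cintegral f g : {in D, f =1 g} -> cintegral f = cintegral g.
Proof. by move=> fg; apply: (f_equal2 (@Complex R)); apply: eq_Rintegral => x xD; rewrite fg. Qed.

Lemma cintegral_sum (I : Type) (r : seq I) (F : I -> T -> R[i]) :
  (forall i, bounded_measurable (F i)) ->
  cintegral (fun x => \sum_(i <- r) F i x) = \sum_(i <- r) cintegral (F i).
Proof.
move=> bF; elim: r => [|i r IH].
  rewrite (_ : (fun x => _) = fun x => 0 * 1 :> R[i]).
    by rewrite big_nil (cintegralZ 0) ?mul0r //; exact: bounded_measurable_cst.
  by apply/funext => x; rewrite big_nil mul0r.
rewrite big_cons -IH -cintegralD //; last exact: bounded_measurable_sum.
by apply: eq_cintegral => x _; rewrite big_cons.
Qed.

(** The factor 2 comes from bounding the modulus by the sum of the absolute values of the two parts;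
    later only the existence of a bound uniform in the exponents matters. *)
Lemma cintegral_norm_le f (M : R) : bounded_measurable f ->
  (forall x, D x -> `|complex.Re (f x)| <= M /\ `|complex.Im (f x)| <= M) ->
  `|cintegral f| <= ((M * fine (mu D)) *+ 2)%:C%C.
Proof.
move=> bf fM.
have E (h : T -> R) : mu.-integrable D (EFin \o h) -> (forall x, D x -> `|h x| <= M) ->
    `|\int[mu]_(x in D) h x| <= M * fine (mu D).
  move=> ih hM; apply: le_trans (le_normr_Rintegral mD ih) _.
  rewrite -Rintegral_cst //; apply: le_Rintegral => //.
    exact: (integrable_norm ih).
  apply: (@measurable_bounded_integrable _ _ _ _ (fun=> M)) => //.
  by exists `|M|; split=> [|y My x _]; [rewrite num_real|exact: ltW].
have N (a b : R) : `|(a +i* b)%C| <= (`|a| + `|b|)%:C%C.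
  rewrite normc_def lecR -(@ler_pXn2r _ 2) ?nnegrE ?sqrtr_ge0 ?addr_ge0 //.
  rewrite sqr_sqrtr ?addr_ge0 ?sqr_ge0 //= sqrrD !real_normK ?num_real //.
  by rewrite lerD2r lerDl mulrn_wge0 ?mulr_ge0 ?normr_ge0.
apply: le_trans (N _ _) _; rewrite lecR mulr2n; apply: lerD; apply: E.
- exact: bounded_measurable_Re.
- by move=> x /fM[].
- exact: bounded_measurable_Im.
- by move=> x /fM[].
Qed.

End ComplexIntegral.

(** * The circle *)

Section BoundedRecurrence.
Variable R : realType.

(** Iteration gives [y r = a ^+ j * y (r + j)], of modulus at most [K * |a| ^+ j]. The later
    vanishing results for bounded sequences rest on this contraction. *)
Lemma bounded_geometric_eq0 (a K : R[i]) (y : nat -> R[i]) :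
  `|a| < 1 -> (forall r, `|y r| <= K) -> (forall r, y r = a * y r.+1) ->
  forall r, y r = 0.
Proof.
move=> a1 yK ya r; apply/eqP; rewrite -normr_eq0.
have E j : y r = a ^+ j * y (r + j)%N.
  elim: j => [|j IH]; first by rewrite addn0 mul1r.
  by rewrite IH exprSr -mulrA addnS -ya.
have K0 : 0 <= K := le_trans (normr_ge0 _) (yK 0%N).
have Rn (z : R[i]) : `|z| = (Num.sqrt (complex.Re z ^+ 2 + complex.Im z ^+ 2))%:C%C.
  by rewrite normc_def.
have KR : K = (complex.Re K)%:C%C by rewrite RRe_real // ger0_real.
set x := Num.sqrt (complex.Re (y r) ^+ 2 + complex.Im (y r) ^+ 2).
set c := Num.sqrt (complex.Re a ^+ 2 + complex.Im a ^+ 2).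
have c1 : `|c| < 1.
  by move: a1; rewrite Rn -/c ltcR => c1; rewrite ger0_norm ?sqrtr_ge0.
have H j : x <= complex.Re K * c ^+ j.
  have : `|y r| <= K * `|a| ^+ j.
    by rewrite (E j) normrM normrX mulrC ler_wpM2r ?exprn_ge0.
  by rewrite !Rn KR /= -rmorphXn -rmorphM lecR.
have : x <= 0.
  rewrite -(cvg_lim (@Rhausdorff R) (cvg_geometric (complex.Re K) c1)).
  apply: limr_ge; last by apply: nearW => j; exact: H.
  exact: cvgP (cvg_geometric (complex.Re K) c1).
by rewrite Rn -/x le_eqVlt ltNge sqrtr_ge0 orbF => /eqP ->.
Qed.

End BoundedRecurrence.

Section Circle.
Variable R : realType.
Notation mu := (@lebesgue_measure R).
Notation D := (`[0%R, (2 * pi)%R]%classic : set (measurableTypeR R)).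

Lemma lebesgue_circle : mu D = ((2 * pi)%R)%:E.
Proof.
by rewrite lebesgue_measure_itv /= lte_fin mulr_gt0 ?pi_gt0 // -EFinD subr0.
Qed.

Lemma expi_normE (t : R) : `|expi t| = 1.
Proof. by rewrite normc_def /= cos2Dsin2 sqrtr1. Qed.

Lemma expi_neq0 (t : R) : expi t != 0.
Proof. by rewrite -normr_eq0 expi_normE oner_eq0. Qed.

Lemma expiD (s t : R) : expi (s + t) = expi s * expi t.
Proof. by rewrite /expi cosD sinD; apply/eqP; rewrite eq_complex /= eqxx addrC eqxx. Qed.

Lemma expiX k (t : R) : expi t ^+ k = expi (k%:R * t).
Proof.
elim: k => [|k IH].
  by rewrite mul0r /expi cos0 sin0.
by rewrite exprSr IH -expiD -natr1 mulrDl mul1r.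
Qed.

Definition cint (F : R[i] -> R[i]) : R[i] := cintegral mu D (fun t => F (expi t)).

Definition circle_class (F : R[i] -> R[i]) :=
  bounded_measurable D (fun t : measurableTypeR R => F (expi t)).

Lemma bounded_measurable_expi d (T : measurableType d) (E : set T) (f : T -> R) :
  measurable_fun setT f -> bounded_measurable E (fun x => expi (f x)).
Proof.
move=> mf; split => /=.
- by apply: measurableT_comp => //; apply: continuous_measurable_fun; exact: continuous_cos.
- by apply: measurableT_comp => //; apply: continuous_measurable_fun; exact: continuous_sin.
- by exists 1 => x _; rewrite !ler_norml cos_geN1 cos_le1 sin_geN1 sin_le1.
Qed.

(** Since [1 / f] is [conj f / |f|^2], only a nonnegative real function has to be inverted; its
    inverse is measurable as the power [powR] with exponent [-1]. *)
Lemma bounded_measurableV d (T : measurableType d) (E : set T) (f : T -> R[i]) (e : R) :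
  0 < e -> (forall x, E x -> e%:C%C <= `|f x|) ->
  bounded_measurable E f -> bounded_measurable E (fun x => (f x)^-1).
Proof.
move=> e0 fe bf.
pose N x := complex.Re (f x) ^+ 2 + complex.Im (f x) ^+ 2.
have NE x : `|f x| ^+ 2 = (N x)%:C%C by rewrite add_Re2_Im2.
have VE x : (f x)^-1 = ((N x)^-1)%:C%C * (f x)^*.
  by rewrite invC_norm NE fmorphV.
rewrite (_ : (fun x => _) = fun x => ((N x)^-1)%:C%C * (f x)^*); last exact/funext.
apply: bounded_measurableM; last exact: bounded_measurable_conj.
have N0 x : 0 <= N x by rewrite addr_ge0 ?sqr_ge0.
have [f1 f2 _] := bf.
split=> /=; last 1 first.
- have e2 : 0 < e ^+ 2 by exact: exprn_gt0.
  exists (e ^- 2) => x Ex; rewrite normr0 invr_ge0 (ltW e2); split=> //.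
  rewrite ger0_norm ?invr_ge0 //; have /(lerXn2r 2) := fe x Ex.
  rewrite !nnegrE ler0c (ltW e0) normr_ge0 NE -rmorphXn lecR => /(_ isT isT) H.
  by rewrite lef_pV2 ?posrE // (lt_le_trans e2 H).
- rewrite (_ : (fun x => _) = fun x => (N x) `^ (-1)); last first.
    by apply/funext => x; rewrite powR_inv1.
  apply: (measurableT_comp (@measurable_powR R (-1))).
  by apply: measurable_funD; apply: measurable_funX.
- exact: measurable_cst.
Qed.

Lemma circle_id : circle_class id.
Proof. exact: bounded_measurable_expi. Qed.

Lemma cintX k : cint (fun w => w ^+ k) = if k == 0%N then (2 * pi)%:C%C else 0.
Proof.
case: k => [|k] /=.
  rewrite /cint /cintegral; under eq_Rintegral do rewrite expr0 /=.
  under [X in (_ +i* X)%C]eq_Rintegral do rewrite expr0 /=.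
  by rewrite !Rintegral_cst // mul0r mul1r; have /= -> := lebesgue_circle.
have p0 : 0 < 2 * pi :> R by rewrite mulr_gt0 ?pi_gt0.
have k0 : k.+1%:R != 0 :> R by rewrite pnatr_eq0.
have lin (x : R) : is_derive x 1 (fun t : R => k.+1%:R * t) k.+1%:R.
  by apply: is_derive_eq; rewrite /GRing.scale /= mulr1.
have dS (x : R) : is_derive x 1 (fun t : R => k.+1%:R^-1 * sin (k.+1%:R * t)) (cos (k.+1%:R * x)).
  apply: is_derive_eq.
  by rewrite /GRing.scale /= ?mulr0 ?addr0 ?mulr1 ?add0r; field.
have dC (x : R) : is_derive x 1 (fun t : R => - k.+1%:R^-1 * cos (k.+1%:R * t)) (sin (k.+1%:R * x)).
  apply: is_derive_eq.
  by rewrite /GRing.scale /= ?mulr0 ?addr0 ?mulr1 ?add0r; field.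
have FTC (f F : R -> R) : (forall x : R, is_derive x 1 F (f x)) -> continuous f ->
    \int[mu]_(x in D) f x = F (2 * pi) - F 0.
  move=> dF cf; rewrite /Rintegral (@continuous_FTC2 _ _ F) //.
  - exact: continuous_subspaceT.
  - have cF : continuous F.
      by move=> x; apply/differentiable_continuous/derivable1_diffP; exact: ex_derive.
    split.
    + by move=> x _; exact: ex_derive.
    + by apply: cvg_at_right_filter; exact: cF.
    + by apply: cvg_at_left_filter; exact: cF.
  - by move=> x _; rewrite derive1E; exact: derive_val.
have per : sin (k.+1%:R * (2 * pi)) = 0 :> R /\ cos (k.+1%:R * (2 * pi)) = 1 :> R.
  have : expi (2 * pi : R) = 1 by rewrite /expi mulrC mulr_natr cos2pi sin2pi.
  move=> E; have : expi (k.+1%:R * (2 * pi)) = 1 :> R[i] by rewrite -expiX E expr1n.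
  by case.
rewrite /cint /cintegral; under eq_Rintegral do rewrite expiX /=.
under [X in (_ +i* X)%C]eq_Rintegral do rewrite expiX /=.
rewrite (FTC _ _ dS) ?(FTC _ _ dC) ?per.1 ?per.2 ?mulr0 ?sin0 ?cos0 ?subrr ?mulr0 ?subrr //.
- move=> x; apply: continuous_comp; last exact: continuous_sin.
  by apply: cvgM; [exact: cvg_cst|exact: cvg_id].
- move=> x; apply: continuous_comp; last exact: continuous_cos.
  by apply: cvgM; [exact: cvg_cst|exact: cvg_id].
Qed.

End Circle.

Section MeanValue.
Variable R : realType.

Lemma lebesgue_circle_lty :
  (@lebesgue_measure R (`[0%R, (2 * pi)%R]%classic : set (measurableTypeR R)) < +oo)%E.
Proof. by have /= -> := lebesgue_circle R; rewrite ltry. Qed.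

(** With [u] a power of a unimodular number, this bounds an integrand independently of the
    exponent. *)
Lemma Re_Im_mul_le (u x : R[i]) (M : R) : `|u| <= 1 ->
  `|complex.Re x| <= M /\ `|complex.Im x| <= M ->
  `|complex.Re (u * x)| <= M + M /\ `|complex.Im (u * x)| <= M + M.
Proof.
move=> u1 [x1 y1].
have : `|complex.Re u| <= 1 /\ `|complex.Im u| <= 1.
  have := le_trans (normc_ge_Re u) u1; rewrite (lecR _ 1) => ->; split=> //.
  have := normc_ge_Re (u * 'i%C); rewrite ReiNIm normrN normrM.
  have -> : `|'i%C : R[i]| = 1 by rewrite normc_def /= expr0n /= add0r expr1n sqrtr1.
  by rewrite mulr1 => /le_trans /(_ u1); rewrite (lecR _ 1).
case: u x {u1} x1 y1 => [a b] [c d] /= c1 d1 [a1 b1]; split.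
  apply: le_trans (ler_normB _ _) _; rewrite !normrM; apply: lerD.
    by rewrite -[leRHS]mul1r ler_pM.
  by rewrite -[leRHS]mul1r ler_pM.
apply: le_trans (ler_normD _ _) _; rewrite !normrM; apply: lerD.
  by rewrite -[leRHS]mul1r ler_pM.
by rewrite -[leRHS]mul1r ler_pM.
Qed.

(** A mean value property, one linear factor at a time. Since [1 / (1 - a w) = 1 + a w / (1 - a w)],
    the integrals satisfy [I k = (value for the shorter product) + a * I (k + 1)]. For [k > 0] the
    first term is [0] and the bounded contraction forces [I k = 0]; then [I 0] is the value for the
    shorter product. *)
Lemma cint_prod_inv (r : seq R[i]) : {in r, forall a, `|a| < 1} ->
  (forall k, circle_class (fun w => w ^+ k * \prod_(a <- r) (1 - a * w)^-1)) /\
  (forall k, cint (fun w => w ^+ k * \prod_(a <- r) (1 - a * w)^-1) =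
    if k == 0%N then (2 * pi)%:C%C else 0).
Proof.
elim: r => [|a r IH] rP.
  split=> k.
    apply: eq_bounded_measurable (bounded_measurableX k (circle_id R)) => t.
    by rewrite big_nil mulr1.
  by rewrite -cintX; apply: eq_cintegral => t _ /=; rewrite big_nil mulr1.
have [|cl val] := IH; first by move=> b br; apply: rP; rewrite inE br orbT.
have a1 : `|a| < 1 by apply: rP; rewrite mem_head.
have aw (w : R[i]) : `|w| = 1 -> 1 - `|a| <= `|1 - a * w|.
  move=> w1; have := lerB_dist 1 (a * w); by rewrite normr1 normrM w1 mulr1.
have clV : circle_class (fun w => (1 - a * w)^-1).
  have ra : `|a| = (complex.Re `|a|)%:C%C by rewrite RRe_real // ger0_real.
  apply: (@bounded_measurableV _ _ _ _ _ (1 - complex.Re `|a|)).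
  - by rewrite subr_gt0 -ltcR -ra.
  - by move=> t _; rewrite rmorphB /= -ra; apply: aw; exact: expi_normE.
  - apply: bounded_measurableD; first exact: bounded_measurable_cst.
    apply: (eq_bounded_measurable (fun=> esym (mulNr _ _))).
    by apply: bounded_measurableM; [exact: bounded_measurable_cst|exact: circle_id].
have cl' k : circle_class (fun w => w ^+ k * \prod_(b <- a :: r) (1 - b * w)^-1).
  apply: eq_bounded_measurable (bounded_measurableM clV (cl k)) => t.
  by rewrite big_cons mulrCA.
split=> // k.
pose I k := cint (fun w => w ^+ k * \prod_(b <- a :: r) (1 - b * w)^-1).
have rec j : I j = (if j == 0%N then (2 * pi)%:C%C else 0) + a * I j.+1.
  rewrite -val /I /cint -cintegralZ //; try exact: cl'; last exact: lebesgue_circle_lty.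
  rewrite -cintegralD //; try exact: lebesgue_circle_lty; last first.
  - apply: bounded_measurableM; first exact: bounded_measurable_cst; exact: cl'.
  - exact: cl.
  apply: eq_cintegral => t _; rewrite big_cons.
  have : 1 - a * expi t != 0.
    rewrite -normr_gt0 (lt_le_trans _ (aw _ (expi_normE t))) // subr_gt0 //.
  move: (\prod_(_ <- r) _) => P h.
  by rewrite exprS; field.
have [M IM] : exists M, forall j, `|I j.+1| <= M.
  have [_ _ [B HB]] := cl' 0%N.
  pose D : set (measurableTypeR R) := `[0%R, (2 * pi)%R]%classic.
  exists (((B + B) * fine (@lebesgue_measure R D)) *+ 2)%:C%C => j.
  apply: cintegral_norm_le => //; [exact: lebesgue_circle_lty|exact: cl'|].
  move=> t /HB; rewrite expr0 mul1r; apply: Re_Im_mul_le.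
  by rewrite normrX expi_normE expr1n.
have I0 j : I j.+1 = 0.
  apply: (bounded_geometric_eq0 a1 IM (y := fun j => I j.+1)) => i.
  by rewrite rec add0r.
rewrite -/(I k); case: k => [|k]; last exact: I0.
by rewrite rec I0 mulr0 addr0.
Qed.

(** The roots [z] of [q] have modulus above [1], so [q(w) = q(0) * prod (1 - w / z)] and
    [cint_prod_inv] applies to the inverses of the roots. *)
Lemma cint_inv_poly (q : {poly R[i]}) : (forall w, `|w| <= 1 -> q.[w] != 0) ->
  (forall k, circle_class (fun w => w ^+ k / q.[w])) /\
  forall k, cint (fun w => w ^+ k / q.[w]) = if k == 0%N then (2 * pi)%:C%C / q.[0] else 0.
Proof.
move=> q0; have [r rE] := closed_field_poly_normal q.
have c0 : lead_coef q != 0.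
  by rewrite lead_coef_eq0; apply: contraNneq (q0 0 _) => [->|]; rewrite ?horner0 ?normr0.
have qE w : q.[w] = lead_coef q * \prod_(z <- r) (w - z).
  rewrite {1}rE hornerZ horner_prod; congr (_ * _).
  by apply: eq_bigr => z _; rewrite hornerXsubC.
have r1 z : z \in r -> 1 < `|z|.
  move=> zr; rewrite real_ltNge ?num_real ?normr_real //; apply/negP => /q0.
  by rewrite qE (big_rem z zr) /= subrr mul0r mulr0 eqxx.
have rn0 z : z \in r -> z != 0 by move=> /r1; rewrite -normr_gt0; exact: lt_trans.
have q0E : q.[0] = lead_coef q * \prod_(z <- r) (- z).
  by rewrite qE; congr (_ * _); apply: eq_bigr => z _; rewrite sub0r.
have E k w : w ^+ k / q.[w] = q.[0]^-1 * (w ^+ k * \prod_(a <- [seq z^-1 | z <- r]) (1 - a * w)^-1).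
  rewrite big_map mulrCA; congr (_ * _); rewrite qE q0E !invfM -mulrA; congr (_ * _).
  rewrite !prodfV -invfM; congr (_^-1).
  rewrite -big_split /=; apply: eq_big_seq => z /rn0 z0; by field.
have [|cl val] := @cint_prod_inv [seq z^-1 | z <- r].
  move=> _ /mapP[z zr ->]; rewrite normfV invf_lt1 ?r1 // normr_gt0; exact: rn0.
split=> k.
  apply: (eq_bounded_measurable (fun=> E _ _)).
  by apply: bounded_measurableM; [exact: bounded_measurable_cst|exact: cl].
rewrite /cint; under eq_cintegral do rewrite E.
rewrite cintegralZ //; [|exact: lebesgue_circle_lty|exact: cl].
by move: (val k); rewrite /cint => ->; case: eqP => _; rewrite ?mulr0 // mulrC.
Qed.

End MeanValue.

(** * The torus *)

Section Fubini.
Variable R : realType.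
Notation mu := (@lebesgue_measure R).
Notation D := (`[0%R, (2 * pi)%R]%classic : set (measurableTypeR R)).
Local Open Scope classical_set_scope.

Lemma measurable_circle : measurable D.
Proof. exact: measurable_itv. Qed.

Lemma measurable_torus : measurable (D `*` D).
Proof. by apply: measurableX; exact: measurable_itv. Qed.

Lemma lebesgue_torus_lty : ((mu \x mu) (D `*` D) < +oo)%E.
Proof.
rewrite product_measure1E; [|exact: measurable_circle..].
by have /= -> := lebesgue_circle R; rewrite -EFinM ltry.
Qed.

Lemma Rintegral_torus (g : measurableTypeR R * measurableTypeR R -> R) (M : R) :
  measurable_fun setT g -> (forall t, (D `*` D) t -> `|g t| <= M) ->
  \int[(mu \x mu)%E]_(t in D `*` D) g t = \int[mu]_(x in D) \int[mu]_(y in D) g (x, y).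
Proof.
move=> mg gM.
have ig : (mu \x mu)%E.-integrable (D `*` D) (EFin \o g).
  apply: measurable_bounded_integrable.
  - exact: measurable_torus.
  - exact: lebesgue_torus_lty.
  - exact: measurable_funTS.
  - by exists M; split=> [|y My x Dx]; [rewrite num_real|exact: le_trans (gM x Dx) (ltW My)].
have igx x : D x -> mu.-integrable D (fun y => (g (x, y))%:E).
  move=> Dx; apply: measurable_bounded_integrable.
  - exact: measurable_circle.
  - exact: lebesgue_circle_lty.
  - exact/measurable_funTS/(measurableT_comp mg)/pair1_measurable.
  - by exists M; split=> [|r Mr y Dy]; [rewrite num_real|exact: le_trans (gM (x, y) (conj Dx Dy)) (ltW Mr)].
rewrite /Rintegral; congr fine.
(* Fubini is applied on the whole plane, so both sides are extended by [0] outside the square. *)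
have ig' := (integrable_mkcond (EFin \o g) measurable_torus).1 ig.
rewrite integral_mkcond -(integral12_prod_meas1 ig') [RHS]integral_mkcond.
apply: eq_integral => x _; rewrite /fubini_F patchE.
case: ifPn => [/set_mem Dx|/negP xD].
  rewrite fineK; last exact: integrable_fin_num (igx x Dx).
  rewrite [RHS]integral_mkcond; apply: eq_integral => y _; rewrite !patchE /=.
  congr (if _ then _ else _); apply/idP/idP => /set_mem; last by move=> Dy; apply/mem_set.
  by case=> _ Dy; apply/mem_set.
apply: integral0_eq => y _; rewrite patchE ifF //; apply/negP => /set_mem [Dx _].
by apply: xD; apply/mem_set.
Qed.

Lemma torus_integralE (F : R[i] -> R[i] -> R[i]) :
  bounded_measurable (D `*` D) (fun t : measurableTypeR R * measurableTypeR R =>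
    F (expi t.1) (expi t.2)) ->
  torus_integral F = cint (fun z => cint (F z)).
Proof.
move=> [m1 m2 [M FM]]; rewrite /torus_integral /cint /cintegral /=.
by apply: (f_equal2 (@Complex R)); apply: (@Rintegral_torus _ M) => // t /FM[].
Qed.

End Fubini.

Section ComplexContinuity.
Variables (T : topologicalType) (R : realType).
Implicit Types f g : T -> R[i].

Definition ccontinuous f :=
  continuous (fun x => complex.Re (f x)) /\ continuous (fun x => complex.Im (f x)).

Lemma eq_ccontinuous f g : f =1 g -> ccontinuous g -> ccontinuous f.
Proof. by move=> /funext ->. Qed.

Lemma ccontinuousD f g : ccontinuous f -> ccontinuous g ->
  ccontinuous (fun x => f x + g x).
Proof.
move=> [f1 f2] [g1 g2]; split.
  rewrite (_ : (fun x => _) = fun x => complex.Re (f x) + complex.Re (g x)).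
    by move=> x; apply: continuousD; [exact: f1|exact: g1].
  by apply/funext => x; rewrite raddfD.
rewrite (_ : (fun x => _) = fun x => complex.Im (f x) + complex.Im (g x)).
  by move=> x; apply: continuousD; [exact: f2|exact: g2].
by apply/funext => x; rewrite raddfD.
Qed.

Lemma ccontinuousM f g : ccontinuous f -> ccontinuous g ->
  ccontinuous (fun x => f x * g x).
Proof.
move=> [f1 f2] [g1 g2]; split.
  rewrite (_ : (fun x => _) = fun x => complex.Re (f x) * complex.Re (g x)
      - complex.Im (f x) * complex.Im (g x)).
    by move=> x; apply: cvgB; apply: cvgM; [exact: f1|exact: g1|exact: f2|exact: g2].
  by apply/funext => x; case: (f x); case: (g x).
rewrite (_ : (fun x => _) = fun x => complex.Re (f x) * complex.Im (g x)
      + complex.Im (f x) * complex.Re (g x)).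
  by move=> x; apply: cvgD; apply: cvgM; [exact: f1|exact: g2|exact: f2|exact: g1].
by apply/funext => x; case: (f x); case: (g x).
Qed.

Lemma ccontinuous_cst a : ccontinuous (fun=> a).
Proof. by split=> x; exact: cst_continuous. Qed.

Lemma ccontinuousX f k : ccontinuous f -> ccontinuous (fun x => f x ^+ k).
Proof.
move=> cf; elim: k => [|k IH]; first exact: ccontinuous_cst.
by apply: (eq_ccontinuous (fun=> exprS _ _)); exact: ccontinuousM.
Qed.

Lemma ccontinuous_sum (I : Type) (r : seq I) (F : I -> T -> R[i]) :
  (forall i, ccontinuous (F i)) -> ccontinuous (fun x => \sum_(i <- r) F i x).
Proof.
move=> cF; elim: r => [|i r IH].
  by apply: (eq_ccontinuous (g := fun=> 0)); [move=> x; rewrite big_nil|exact: ccontinuous_cst].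
apply: eq_ccontinuous (ccontinuousD (cF i) IH) => x.
by rewrite big_cons.
Qed.

Lemma ccontinuous_expi (f : T -> R) : continuous f -> ccontinuous (fun x => expi (f x)).
Proof.
move=> cf; split=> x /=; apply: continuous_comp; try exact: cf.
- exact: continuous_cos.
- exact: continuous_sin.
Qed.

End ComplexContinuity.

(** * Moments of [1 / |p|^2] *)

Section Moments.
Variables (R : realType) (p : {poly {poly R[i]}}).
Hypothesis p_neq0 : forall z w : R[i], `|z| = 1 -> `|w| <= 1 -> p.[z, w] != 0.
Notation mu := (@lebesgue_measure R).
Notation D := (`[0%R, (2 * pi)%R]%classic : set (measurableTypeR R)).
Notation D2 := (D `*` D)%classic.

(** Defined for all exponents, although the Bernstein-Szego condition concerns only [|s| <= n] and
    [|t| <= m]: the extra orthogonality lives at the other values of [s]. *)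
Definition torus_moment (s t : int) : R[i] :=
  torus_integral (fun z w =>
    z ^ s * w ^ t / (((2 * pi) ^+ 2)%:C%C * `|p.[z, w]| ^+ 2)).

(** The mean over [z] of [z ^ s * slice_moment z t] is [torus_moment s t]; [torus_moment_sum] uses
    this to pass from slices to the torus. *)
Definition slice_moment (z : R[i]) (t : int) : R[i] :=
  ((2 * pi)%:C%C)^-1 * cint (fun w => w ^ t / `|p.[z, w]| ^+ 2).

Let pi2C_neq0 : (2 * pi : R)%:C%C != 0.
Proof. by rewrite fmorph_eq0 mulf_neq0 ?pnatr_eq0 // gt_eqF ?pi_gt0. Qed.

Lemma horner2_sum (z w : R[i]) :
  p.[z, w] = \sum_(i < size p) (p`_i).[w] * z ^+ i.
Proof.
rewrite (horner_coef p) horner_sum; apply: eq_bigr => i _.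
by rewrite hornerM -polyC_exp hornerC.
Qed.

Lemma expz_expi (s : int) (x : R) :
  expi x ^ s = if s is Posz k then expi x ^+ k else (expi x)^* ^+ `|s|%N.
Proof.
case: s => k //=; rewrite NegzE /= -exprz_inv -exprnP; congr (_ ^+ _).
by rewrite invC_norm expi_normE expr1n invr1 mul1r.
Qed.

Lemma conj_expz (z : R[i]) (s : int) : `|z| = 1 -> (z ^ s)^* = z ^ (- s).
Proof. by move=> z1; rewrite fmorphXz /= -exprz_inv invC_norm z1 expr1n invr1 mul1r. Qed.

Lemma bounded_measurable_expz d (T : measurableType d) (E : set T) (f : T -> R) (s : int) :
  measurable_fun setT f -> bounded_measurable E (fun x => expi (f x) ^ s).
Proof.
move=> mf; apply: (eq_bounded_measurable (fun=> expz_expi _ _)).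
case: s => k; apply: bounded_measurableX; first exact: bounded_measurable_expi.
by apply: bounded_measurable_conj; exact: bounded_measurable_expi.
Qed.

Let mfst : measurable_fun [set: measurableTypeR R * measurableTypeR R] fst.
Proof. exact: measurable_fst. Qed.

Let msnd : measurable_fun [set: measurableTypeR R * measurableTypeR R] snd.
Proof. exact: measurable_snd. Qed.

Let bmp : bounded_measurable D2
  (fun t : measurableTypeR R * measurableTypeR R => p.[expi t.1, expi t.2]).
Proof.
apply: (eq_bounded_measurable (fun=> horner2_sum _ _)).
apply: bounded_measurable_sum => i; apply: bounded_measurableM; last first.
  by apply: bounded_measurableX; exact: bounded_measurable_expi.
apply: (eq_bounded_measurable (fun=> horner_coef _ _)).
apply: bounded_measurable_sum => j.
apply: bounded_measurableM; first exact: bounded_measurable_cst.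
by apply: bounded_measurableX; exact: bounded_measurable_expi.
Qed.

Let ctp : ccontinuous (fun t : R * R => p.[expi t.1, expi t.2]).
Proof.
apply: (eq_ccontinuous (fun=> horner2_sum _ _)).
apply: ccontinuous_sum => i; apply: ccontinuousM; last first.
  by apply/ccontinuousX/ccontinuous_expi => t; exact: cvg_fst.
apply: (eq_ccontinuous (fun=> horner_coef _ _)).
apply: ccontinuous_sum => j; apply: ccontinuousM; first exact: ccontinuous_cst.
by apply/ccontinuousX/ccontinuous_expi => t; exact: cvg_snd.
Qed.

(** [|p|^2] is continuous and positive on a compact square, so it has a positive minimum; this makes
    [1 / |p|^2] bounded. *)
Lemma torus_lower_bound : exists2 e : R, 0 < e &
  forall t : R * R, D2 t -> e%:C%C <= `|p.[expi t.1, expi t.2]|.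
Proof.
pose N (t : R * R) := complex.Re p.[expi t.1, expi t.2] ^+ 2 + complex.Im p.[expi t.1, expi t.2] ^+ 2.
have cN : continuous N.
  by case: ctp => c1 c2 t; apply: cvgD; rewrite expr2; apply: cvgM; do ?[exact: c1|exact: c2].
have pN t : `|p.[expi t.1, expi t.2]| = (Num.sqrt (N t))%:C%C by rewrite normc_def.
have cD : compact (D2 : set (R * R)).
  by apply: compact_setX; exact: segment_compact.
have D0 : ((D2 : set (R * R)) !=set0)%classic.
  by exists (0, 0); split; rewrite /= in_itv /= lexx /= mulr_ge0 // pi_ge0.
have [c _ cmin] := compact_EVT_min D0 cD (continuous_subspaceT cN).
exists (Num.sqrt (N c)).
  by rewrite -ltcR -pN normr_gt0 p_neq0 ?expi_normE.
by move=> t Dt; rewrite pN lecR ler_wsqrtr //; apply/cmin/mem_set.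
Qed.

Let bmV : bounded_measurable D2 (fun t : measurableTypeR R * measurableTypeR R =>
  (((2 * pi) ^+ 2)%:C%C * `|p.[expi t.1, expi t.2]| ^+ 2)^-1).
Proof.
have [e e0 eP] := torus_lower_bound.
have b : bounded_measurable D2 (fun t : measurableTypeR R * measurableTypeR R =>
    (p.[expi t.1, expi t.2])^-1) by exact: bounded_measurableV e0 eP bmp.
have E (t : measurableTypeR R * measurableTypeR R) :
    (((2 * pi) ^+ 2)%:C%C * `|p.[expi t.1, expi t.2]| ^+ 2)^-1 =
    (((2 * pi) ^+ 2)%:C%C)^-1 * ((p.[expi t.1, expi t.2])^-1 * ((p.[expi t.1, expi t.2])^-1)^*).
  by rewrite -normCK normfV invfM exprVn.
apply: (eq_bounded_measurable E).
apply: bounded_measurableM; first exact: bounded_measurable_cst.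
by apply: bounded_measurableM => //; exact: bounded_measurable_conj.
Qed.

Let bmG s t : bounded_measurable D2 (fun x : measurableTypeR R * measurableTypeR R =>
  expi x.1 ^ s * expi x.2 ^ t / (((2 * pi) ^+ 2)%:C%C * `|p.[expi x.1, expi x.2]| ^+ 2)).
Proof.
apply: bounded_measurableM; last exact: bmV.
by apply: bounded_measurableM; apply: bounded_measurable_expz.
Qed.

Lemma torus_moment_bounded : exists K, forall s t, `|torus_moment s t| <= K.
Proof.
have [_ _ [B HB]] := bmV.
exists (((B + B) * fine ((mu \x mu)%E D2)) *+ 2)%:C%C => s t.
apply: cintegral_norm_le; [exact: measurable_torus|exact: lebesgue_torus_lty|exact: bmG|].
move=> x /HB; apply: Re_Im_mul_le.
by rewrite normrM !expz_expi; case: s; case: t => k l; rewrite !normrX ?norm_conjC !expi_normE !expr1n mulr1.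
Qed.

Lemma torus_moment_conj s t : torus_moment (- s) (- t) = (torus_moment s t)^*.
Proof.
rewrite /torus_moment /torus_integral.
rewrite -[RHS](cintegral_conj (@measurable_torus R) (@lebesgue_torus_lty R) (bmG s t)).
apply: eq_cintegral => x _; rewrite [RHS](rmorphM Num.conj); congr (_ * _).
  by rewrite (rmorphM Num.conj) /= !conj_expz ?expi_normE.
apply/esym/CrealP; rewrite realV ger0_real // mulr_ge0 ?exprn_ge0 ?normr_ge0 //.
by rewrite ler0c exprn_ge0 // mulr_ge0 ?pi_ge0.
Qed.

Let pz_neq0 z : `|z| = 1 -> forall w, `|w| <= 1 -> (p.[z%:P]).[w] != 0.
Proof. by move=> z1 w w1; exact: p_neq0. Qed.

Let slice_class z t : `|z| = 1 -> circle_class (fun w => w ^ t / `|p.[z, w]| ^+ 2).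
Proof.
move=> z1; apply: bounded_measurableM; first exact: bounded_measurable_expz.
have := (cint_inv_poly (pz_neq0 z1)).1 0%N; rewrite /circle_class => b.
have E w : (`|p.[z, w]| ^+ 2)^-1 = (w ^+ 0 / (p.[z%:P]).[w]) * ((w ^+ 0 / (p.[z%:P]).[w]))^*.
  by rewrite -normCK expr0 mul1r normfV exprVn.
apply: (eq_bounded_measurable (fun=> E _)).
by apply: bounded_measurableM => //; exact: bounded_measurable_conj.
Qed.

Lemma slice_moment_conj z t : `|z| = 1 -> slice_moment z (- t) = (slice_moment z t)^*.
Proof.
move=> z1; rewrite /slice_moment (rmorphM Num.conj) (fmorphV Num.conj) /=.
have -> : (((2 * pi : R)%:C%C)^*)%R = (2 * pi)%:C%C.
  by apply/CrealP; rewrite ger0_real // ler0c mulr_ge0 ?pi_ge0.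
rewrite -[in RHS](cintegral_conj (@measurable_circle R) (@lebesgue_circle_lty R) (slice_class t z1)).
congr (_ * _); apply: eq_cintegral => x _; rewrite [RHS](rmorphM Num.conj); congr (_ * _).
  by rewrite /= conj_expz ?expi_normE.
by apply/esym/CrealP; rewrite realV ger0_real // exprn_ge0 ?normr_ge0.
Qed.

Lemma slice_moment_sum (I : Type) (r : seq I) (a : I -> R[i]) (t : I -> int) z :
  `|z| = 1 -> \sum_(i <- r) a i * slice_moment z (t i) =
  ((2 * pi)%:C%C)^-1 * cint (fun w => (\sum_(i <- r) a i * w ^ t i) / `|p.[z, w]| ^+ 2).
Proof.
move=> z1; transitivity (((2 * pi)%:C%C)^-1 *
    \sum_(i <- r) cint (fun w => a i * (w ^ t i / `|p.[z, w]| ^+ 2))).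
  rewrite mulr_sumr; apply: eq_bigr => i _; rewrite mulrCA; congr (_ * _).
  by rewrite /cint cintegralZ //; [exact: lebesgue_circle_lty|exact: slice_class].
congr (_ * _); rewrite /cint -cintegral_sum //; last 2 first.
- exact: lebesgue_circle_lty.
- move=> i; apply: bounded_measurableM; first exact: bounded_measurable_cst.
  exact: slice_class.
by apply: eq_cintegral => x _; rewrite mulr_suml; apply: eq_bigr => i _; rewrite mulrA.
Qed.

(** On the circle [w^l * conj(p) / |p|^2 = w^l / p], and [p(z, .)] has no zero in the closed disk,
    so [cint_inv_poly] evaluates the integral. Up to scaling, [p(z, .)] is the first column of the
    inverse of a Toeplitz matrix. *)
Lemma slice_moment_orth M z (l : nat) : `|z| = 1 -> (size p.[z%:P]%R <= M)%N ->
  \sum_(j < M) ((p.[z%:P])`_j)^* * slice_moment z (l%:Z - j%:Z) =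
  (l == 0%N)%:R / (p.[z%:P])`_0.
Proof.
move=> z1 sz; rewrite slice_moment_sum //.
rewrite (_ : cint _ = cint (fun w => w ^+ l / (p.[z%:P]).[w])).
  rewrite (cint_inv_poly (pz_neq0 z1)).2 horner_coef0.
  by case: eqP => _; rewrite ?mulr0 ?mul0r // mul1r mulKf.
apply: eq_cintegral => x _ /=; set w := expi x.
have w1 : `|w| = 1 by exact: expi_normE.
have w0 : w != 0 by exact: expi_neq0.
have q0 : (p.[z%:P]).[w] != 0 by rewrite pz_neq0 ?w1.
rewrite (_ : \sum_(j < M) _ = w ^+ l * ((p.[z%:P]).[w])^*).
  rewrite normCK; have qc0 : ((p.[z%:P]).[w])^* != 0 by rewrite conjC_eq0.
  by move: q0 qc0; move: (_^*) => b a0 b0; field; rewrite a0 b0.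
rewrite (horner_coef_wide _ sz) rmorph_sum mulr_sumr; apply: eq_bigr => j _.
rewrite (rmorphM Num.conj) mulrCA; congr (_ * _).
rewrite /=; have -> : (w ^+ j)^* = w ^ (- j%:Z) by rewrite -conj_expz.
by rewrite expfzDr.
Qed.

Lemma slice_moment_orth_conj M z (l : nat) : `|z| = 1 -> (size p.[z%:P]%R <= M)%N ->
  \sum_(j < M) (p.[z%:P])`_j * slice_moment z (j%:Z - l%:Z) =
  (l == 0%N)%:R / ((p.[z%:P])`_0)^*.
Proof.
move=> z1 sz; have := congr1 Num.conj (slice_moment_orth l z1 sz).
rewrite (rmorphM Num.conj) (fmorphV Num.conj) (rmorph_nat Num.conj) => <-.
rewrite rmorph_sum; apply: eq_bigr => j _.
by rewrite (rmorphM Num.conj) /= conjCK -slice_moment_conj // opprB.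
Qed.

Lemma cint_expz (s : int) : cint (fun z : R[i] => z ^ s) = (s == 0)%:R * (2 * pi)%:C%C.
Proof.
case: s => k.
  by rewrite [LHS](cintX R k); case: k => [|k]; rewrite ?mul1r ?mul0r.
rewrite mul0r -[RHS]conjC0; have /= <- := cintX R k.+1.
rewrite -[RHS](cintegral_conj (@measurable_circle R) (@lebesgue_circle_lty R)
  (bounded_measurableX k.+1 (circle_id R))).
by apply: eq_cintegral => x _; rewrite expz_expi /= (rmorphXn Num.conj).
Qed.

(** The transfer principle from slices to the torus: of a slicewise identity with a single monomial
    on the right, integration over [z] keeps the constant term. *)
Lemma torus_moment_sum (I : Type) (r : seq I) (a : I -> R[i]) (s t : I -> int)
    (b : R[i]) (u : int) :
  (forall z, `|z| = 1 ->
    \sum_(i <- r) a i * z ^ s i * slice_moment z (t i) = b * z ^ u) ->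
  \sum_(i <- r) a i * torus_moment (s i) (t i) = b * (u == 0)%:R.
Proof.
move=> H; pose F i z w := a i * (z ^ s i * w ^ t i / (((2 * pi) ^+ 2)%:C%C * `|p.[z, w]| ^+ 2)).
have bF i : bounded_measurable D2 (fun x : measurableTypeR R * measurableTypeR R =>
    F i (expi x.1) (expi x.2)).
  by apply: bounded_measurableM; first exact: bounded_measurable_cst.
transitivity (torus_integral (fun z w => \sum_(i <- r) F i z w)).
  rewrite /torus_integral.
  rewrite -[RHS]/(cintegral _ _ (fun x : measurableTypeR R * measurableTypeR R =>
    \sum_(i <- r) F i (expi x.1) (expi x.2))).
  rewrite (cintegral_sum (@measurable_torus R) (@lebesgue_torus_lty R)) //.
  apply: eq_bigr => i _.
  by rewrite -(cintegralZ (@measurable_torus R) (@lebesgue_torus_lty R)).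
rewrite torus_integralE; last exact: bounded_measurable_sum.
transitivity (cint (fun z : R[i] => (b / (2 * pi)%:C%C) * z ^ u)).
  apply: eq_cintegral => x _; set z := expi x.
  have z1 : `|z| = 1 by exact: expi_normE.
  rewrite mulrAC -H // slice_moment_sum // mulrAC /cint.
  rewrite -(cintegralZ (@measurable_circle R) (@lebesgue_circle_lty R)); last first.
    apply: (eq_bounded_measurable (fun=> mulr_suml _ _ _ _)).
    apply: bounded_measurable_sum => i; apply: (eq_bounded_measurable (fun=> esym (mulrA _ _ _))).
    by apply: bounded_measurableM; [exact: bounded_measurable_cst|exact: slice_class].
  apply: eq_cintegral => y _ /=; rewrite mulr_suml mulr_sumr; apply: eq_bigr => i _.
  have P0 : `|p.[z, expi y]| != 0 by rewrite normr_eq0 p_neq0 ?expi_normE.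
  rewrite /F rmorphXn /=; move: pi2C_neq0 P0.
  by move: (2 * pi : R)%:C%C `|_| => e d e0 d0; field; rewrite d0.
rewrite /cint cintegralZ; [|exact: measurable_circle|exact: lebesgue_circle_lty|].
  by have := cint_expz u; rewrite /cint => ->; rewrite [(u == 0)%:R * _]mulrC mulrA divfK.
exact: bounded_measurable_expz.
Qed.

End Moments.

(** * Inverses of Toeplitz matrices *)

Section GohbergSemencul.

Section Inverse.
Variables (C : numClosedFieldType) (m : nat) (p : nat -> C) (c : int -> C).
Variables G G' : nat -> nat -> C.
Hypothesis p0 : p 0%N != 0.
Hypothesis orthl : forall l, (l <= m)%N ->
  \sum_(j < m.+1) (p j)^* * c (l%:Z - j%:Z) = (l == 0%N)%:R / p 0%N.
Hypothesis orthr : forall l, (l <= m)%N ->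
  \sum_(j < m.+1) p j * c (j%:Z - l%:Z) = (l == 0%N)%:R / (p 0%N)^*.
Hypothesis G_lower : forall i j, (i <= m)%N -> (j <= m)%N ->
  G i j = (if (0 < i)%N && (0 < j)%N then G' i.-1 j.-1 else 0) + p i * (p j)^*.
Hypothesis G_upper : forall i j, (i <= m)%N -> (j <= m)%N ->
  G i j = (if (i < m)%N && (j < m)%N then G' i j else 0)
          + (p (m - i)%N)^* * p (m - j)%N.

Let Y i l := \sum_(j < m.+1) G i j * c (l%:Z - j%:Z).
Let Y' i l := \sum_(j < m) G' i j * c (l%:Z - j%:Z).

(** By [orthl] the rank-one term in [G_lower] contributes only to the column [l = 0]. *)
Let Y_lower i l : (i <= m)%N -> (l <= m)%N -> (0 < l)%N ->
  Y i l = if (0 < i)%N then Y' i.-1 l.-1 else 0.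
Proof.
move=> im lm l0; rewrite /Y.
under eq_bigr => j _ do rewrite G_lower ?leq_ord // mulrDl -mulrA.
rewrite big_split /= -mulr_sumr orthl // gtn_eqF // mul0r mulr0 addr0 big_ord_recl /=.
rewrite andbF mul0r add0r /Y'; case: (0 < i)%N.
  apply: eq_bigr => j _ /=; congr (_ * c _); case: l l0 {lm} => // l _ /=.
  by rewrite /bump /=; lia.
by rewrite big1 // => j _; rewrite mul0r.
Qed.

(** By [orthr], after reversing the summation index, the rank-one term in [G_upper] contributes only
    to the column [l = m]. *)
Let Y_upper i l : (i <= m)%N -> (l < m)%N -> Y i l = if (i < m)%N then Y' i l else 0.
Proof.
move=> im lm; rewrite /Y.
under eq_bigr => j _ do rewrite G_upper ?leq_ord // mulrDl -mulrA.
rewrite big_split /= -mulr_sumr big_ord_recr /= ltnn andbF mul0r addr0.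
rewrite (_ : \sum_(j < m.+1) _ = 0) ?mulr0 ?addr0; last first.
  rewrite (reindex_inj rev_ord_inj) /=.
  rewrite -[RHS](mul0r (p 0%N)^*^-1) -[X in X / _](_ : (m - l == 0)%N%:R = 0).
    rewrite -orthr ?leq_subr //; apply: eq_bigr => j _.
    rewrite subSS subKn ?leq_ord //; congr (_ * c _).
    by have := ltn_ord j; lia.
  by rewrite subn_eq0 leqNgt lm.
rewrite /Y'; case: (i < m)%N.
  by apply: eq_bigr => j _ /=; rewrite ltn_ord.
by rewrite big1 // => j _; rewrite mul0r.
Qed.

Let Y_shift i l : (i < m)%N -> (l < m)%N -> Y i.+1 l.+1 = Y i l.
Proof. by move=> im lm; rewrite Y_lower // Y_upper ?im // ltnW. Qed.

(* The two displacement formulas make the product [Y] a Toeplitz matrix whose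
   first and last rows vanish off the diagonal. *)
Lemma gohberg_semencul_inverse :
  (forall i l, (i <= m)%N -> (l <= m)%N ->
     \sum_(j < m.+1) G i j * c (l%:Z - j%:Z) = (i == l)%:R) /\
  (forall i l, (i < m)%N -> (l < m)%N ->
     \sum_(j < m) G' i j * c (l%:Z - j%:Z) = (i == l)%:R).
Proof.
(* Entries above the diagonal are moved along their diagonal to row [0], entries below it to row
   [m]. *)
have up d i : (0 < d)%N -> (i + d <= m)%N -> Y i (i + d)%N = 0.
  move=> d0; elim: i => [|i IH] h; first by rewrite Y_lower.
  by rewrite addSn Y_shift ?IH //; lia.
have low k i l : (i + k = m)%N -> (l < i)%N -> Y i l = 0.
  elim: k i l => [|k IH] i l ik li.
    by rewrite addn0 in ik; subst i; rewrite Y_upper // ltnn.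
  by rewrite -Y_shift; [apply: IH|..]; lia.
have diag i : (i <= m)%N -> Y i i = Y 0%N 0%N.
  by elim: i => // i IH h; rewrite Y_shift // IH // ltnW.
(* Row [0] of [Y] is applied to [p] in two ways. The off-diagonal entries vanish, which leaves
   [Y 0 0 * p 0]; by [orthr] the result is also [G 0 0 / (p 0)^*], that is [p 0]. *)
have Y00 : Y 0%N 0%N = 1.
  have E : \sum_(l < m.+1) Y 0%N l * p l = p 0%N.
    rewrite /Y; under eq_bigr => l _ do rewrite mulr_suml.
    rewrite exchange_big /=.
    under eq_bigr => j _.
      under eq_bigr => l _ do rewrite -mulrA [c _ * _]mulrC.
      rewrite -mulr_sumr orthr ?leq_ord //; over.
    rewrite big_ord_recl /= G_lower //= add0r mul1r mulfK ?conjC_eq0 //.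
    by rewrite big1 ?addr0 // => j _; rewrite mul0r mulr0.
  move: E; rewrite big_ord_recl big1 ?addr0 => [|j _].
    by move/(canRL (mulfK p0)); rewrite mulfV.
  by have -> := up j.+1 0%N isT (ltn_ord j); rewrite mul0r.
have YE i l : (i <= m)%N -> (l <= m)%N -> Y i l = (i == l)%:R.
  move=> im lm; have [il|li|<-] := ltngtP i l.
  - by have := up (l - i)%N i; rewrite subn_gt0 subnKC ?(ltnW il) // => ->.
  - by apply: (low (m - i)%N) => //; lia.
  - by rewrite diag.
split=> // i l im lm; rewrite -/(Y' i l) -(YE _ _ (ltnW im) (ltnW lm)).
by rewrite Y_upper ?im // ltnW.
Qed.

End Inverse.

Section Kernel.
Variables (A : comPzRingType) (m : nat) (P Q : nat -> A).

(* Gohberg-Semencul: for [P] the coefficients of [q] and [Q] their conjugates,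
   [gs_inner] and [gs_outer] are the inverses of the Toeplitz matrices of the
   weight [1 / |q|^2], of size [m] and [m.+1]. *)
Definition gs_inner i j := \sum_(l < (minn i j).+1)
  (P (i - l)%N * Q (j - l)%N - Q (m - (i - l))%N * P (m - (j - l))%N).

Definition gs_outer i j :=
  (if (0 < i)%N && (0 < j)%N then gs_inner i.-1 j.-1 else 0) + P i * Q j.

(** [gs_outer] has the lower displacement formula by definition. The upper one follows from the
    recursion [step] along diagonals, once [gs_inner] vanishes on row and column [m], where
    reversing the summation index makes the two halves of the sum cancel. *)
Lemma gs_outer_upper i j : (i <= m)%N -> (j <= m)%N ->
  gs_outer i j = (if (i < m)%N && (j < m)%N then gs_inner i j else 0)
    + Q (m - i)%N * P (m - j)%N.
Proof.
have last1 k : (k <= m)%N -> gs_inner m k = 0.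
  move=> km; rewrite /gs_inner (minn_idPr km) big_split sumrN /=.
  rewrite [X in _ - X](reindex_inj rev_ord_inj) /=; apply/eqP; rewrite subr_eq0; apply/eqP.
  apply: eq_bigr => l _; have := ltn_ord l; rewrite ltnS => lk; rewrite mulrC.
  by congr (Q _ * P _); lia.
have last2 k : (k <= m)%N -> gs_inner k m = 0.
  move=> km; rewrite /gs_inner (minn_idPl km) big_split sumrN /=.
  rewrite [X in _ - X](reindex_inj rev_ord_inj) /=; apply/eqP; rewrite subr_eq0; apply/eqP.
  apply: eq_bigr => l _; have := ltn_ord l; rewrite ltnS => lk; rewrite mulrC.
  by congr (Q _ * P _); lia.
have step a b : gs_inner a.+1 b.+1 = gs_inner a b + P a.+1 * Q b.+1
    - Q (m - a.+1)%N * P (m - b.+1)%N.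
  by rewrite /gs_inner minnSS big_ord_recl !subn0 /= addrC addrA.
move=> im jm.
have -> : (if (i < m)%N && (j < m)%N then gs_inner i j else 0) = gs_inner i j.
  case: ifP => // /negbT; rewrite negb_and -!leqNgt => /orP[mi|mj].
    by rewrite (_ : i = m) ?last1 //; lia.
  by rewrite (_ : j = m) ?last2 //; lia.
rewrite /gs_outer; case: i im => [|i] im.
  by rewrite /gs_inner min0n big_ord1 !subn0 add0r subrK.
case: j jm => [|j] jm /=; last by rewrite step subrK.
by rewrite /gs_inner minn0 big_ord1 !subn0 add0r subrK.
Qed.

End Kernel.

End GohbergSemencul.

(** * Bounded solutions of linear recurrences *)

Section PolyAction.
Variables (C : closedFieldType) (I : Type) (sg : I -> I).
Implicit Types (q : {poly C}) (y : I -> C).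

(** The operator [q(shift)] applied to the sequence [y]. The shift is abstract because the successor
    on naturals and the predecessor on integers both occur. *)
Definition poly_act q y r := \sum_(k < size q) q`_k * y (iter k sg r).

Lemma poly_act_wide N q y r : (size q <= N)%N ->
  poly_act q y r = \sum_(k < N) q`_k * y (iter k sg r).
Proof.
move=> qN; rewrite /poly_act (big_ord_widen N (fun k => q`_k * y (iter k sg r))) //.
rewrite big_mkcond; apply: eq_bigr => k _; case: ltnP => // sk.
by rewrite nth_default ?mul0r.
Qed.

Lemma poly_actD q1 q2 y r : poly_act (q1 + q2) y r = poly_act q1 y r + poly_act q2 y r.
Proof.
rewrite !(@poly_act_wide (maxn (size q1) (size q2))) ?leq_maxl ?leq_maxr ?size_polyD //.
by rewrite -big_split; apply: eq_bigr => k _; rewrite coefD mulrDl.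
Qed.

Lemma poly_actZ a q y r : poly_act (a *: q) y r = a * poly_act q y r.
Proof.
rewrite (poly_act_wide _ _ (size_scale_leq a q)) mulr_sumr.
by apply: eq_bigr => k _; rewrite coefZ mulrA.
Qed.

Lemma poly_act0 y r : poly_act 0 y r = 0.
Proof. by rewrite /poly_act size_poly0 big_ord0. Qed.

Lemma poly_act_sum (J : Type) (s : seq J) (F : J -> {poly C}) y r :
  poly_act (\sum_(j <- s) F j) y r = \sum_(j <- s) poly_act (F j) y r.
Proof.
elim: s => [|j s IH]; first by rewrite !big_nil poly_act0.
by rewrite !big_cons poly_actD IH.
Qed.

Lemma poly_actX q y r : poly_act (q * 'X) y r = poly_act q y (sg r).
Proof.
have [->|q0] := eqVneq q 0; first by rewrite mul0r !poly_act0.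
rewrite {1}/poly_act size_mulX // big_ord_recl coefMX eqxx mul0r add0r.
by apply: eq_bigr => k _; rewrite coefMX /= -iterSr.
Qed.

Lemma poly_actXsubC a y r : poly_act ('X - a%:P) y r = y (sg r) - a * y r.
Proof.
rewrite -['X]mul1r poly_actD poly_actX -polyCN -[(- a)%:P]mulr1 mul_polyC poly_actZ.
by rewrite /poly_act !size_poly1 !big_ord1 coef1 !mul1r mulNr.
Qed.

Lemma poly_actM q1 q2 y r : poly_act (q1 * q2) y r = poly_act q1 (poly_act q2 y) r.
Proof.
elim/poly_ind: q1 r => [|q1 a IH] r; first by rewrite mul0r !poly_act0.
rewrite mulrDl mulrAC poly_actD poly_actX IH mul_polyC poly_actZ.
rewrite poly_actD poly_actX -[a%:P]mulr1 mul_polyC poly_actZ; congr (_ + _ * _).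
by rewrite /poly_act size_poly1 big_ord1 coef1 mul1r.
Qed.

Lemma poly_act_sumr (J : Type) (s : seq J) q (Y : J -> I -> C) r :
  poly_act q (fun r => \sum_(j <- s) Y j r) r = \sum_(j <- s) poly_act q (Y j) r.
Proof.
rewrite /poly_act; under eq_bigr => k _ do rewrite mulr_sumr.
by rewrite exchange_big.
Qed.

End PolyAction.

Section BoundedKernel.
Variables (C : numClosedFieldType) (I : Type) (sg : I -> I).
Implicit Types (q : {poly C}) (y : I -> C).

Definition bounded_seq y := exists K, forall r, `|y r| <= K.

Lemma bounded_seq_act q y : bounded_seq y -> bounded_seq (poly_act sg q y).
Proof.
move=> [K yK]; exists (\sum_(k < size q) `|q`_k| * K) => r.
apply: le_trans (ler_norm_sum _ _ _) _; apply: ler_sum => k _.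
by rewrite normrM ler_wpM2l.
Qed.

(** In operator terms, [a] is not an eigenvalue of the shift on bounded sequences. *)
Definition regular_root a := forall y, bounded_seq y ->
  (forall r, y (sg r) = a * y r) -> forall r, y r = 0.

(** [q(shift)] is a product of factors [shift - z] over the roots [z]; each preserves boundedness
    and is injective on bounded sequences, so they are removed one by one. *)
Lemma poly_act_bounded_inj q y : q != 0 -> (forall a, root q a -> regular_root a) ->
  bounded_seq y -> (forall r, poly_act sg q y r = 0) -> forall r, y r = 0.
Proof.
move=> q0; have [s ->] := closed_field_poly_normal q.
have c0 : lead_coef q != 0 by rewrite lead_coef_eq0.
move=> reg by_ H.
have {}H r : poly_act sg (\prod_(z <- s) ('X - z%:P)) y r = 0.
  by have /eqP := H r; rewrite poly_actZ mulf_eq0 (negbTE c0) => /eqP.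
have {}reg z : z \in s -> regular_root z.
  move=> zs; apply: reg; rewrite rootZ // root_prod_XsubC //.
elim: s y by_ H reg => [|z s IH] y by_ H reg.
  move=> r; move: (H r); rewrite big_nil /poly_act size_poly1 big_ord1 coef1 mul1r //.
apply: IH => // [r|a ar]; last by apply: reg; rewrite inE ar orbT.
apply: (reg z (mem_head _ _)); first exact: bounded_seq_act.
move=> {}r; apply/eqP; rewrite -subr_eq0 -poly_actXsubC -poly_actM.
by have := H r; rewrite big_cons => ->.
Qed.

(** The adjugate decouples the system: every component is annihilated by [\det M] acting as a scalar
    operator. *)
Lemma poly_act_matrix_inj L (M : 'M[{poly C}]_L) (y : 'I_L -> I -> C) :
  \det M != 0 -> (forall a, root (\det M) a -> regular_root a) ->
  (forall j, bounded_seq (y j)) ->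
  (forall i r, \sum_j poly_act sg (M i j) (y j) r = 0) -> forall j r, y j r = 0.
Proof.
move=> M0 reg by_ H j; apply: (poly_act_bounded_inj M0 reg (by_ j)) => r.
transitivity (\sum_l poly_act sg ((\adj M *m M) j l) (y l) r).
  rewrite mul_adj_mx (bigD1 j) //= mxE eqxx mulr1n big1 ?addr0 // => l lj.
  by rewrite mxE eq_sym (negbTE lj) mulr0n poly_act0.
under eq_bigr => l _.
  rewrite mxE poly_act_sum; under eq_bigr => i _ do rewrite poly_actM.
  over.
rewrite exchange_big big1 // => i _ /=.
rewrite -poly_act_sumr -[RHS](_ : poly_act sg (\adj M j i) (fun=> 0) r = 0).
  by rewrite /poly_act; apply: eq_bigr => k _; rewrite H.
by rewrite /poly_act big1 // => k _; rewrite mulr0.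
Qed.

End BoundedKernel.

Section RegularRoots.
Variable R : realType.

(** On the naturals [a ^+ r] is bounded whenever [|a| <= 1], so the condition is sharp. *)
Lemma regular_root_succ (a : R[i]) : 1 < `|a| -> regular_root succn a.
Proof.
move=> a1 y [K yK] ya; apply: (bounded_geometric_eq0 (a := a^-1) _ yK).
  by rewrite normfV invf_lt1 // (lt_trans _ a1).
by move=> r; rewrite ya mulKf // -normr_gt0 (lt_trans _ a1).
Qed.

(** On the integers the contraction can be run towards either end, whichever makes the ratio smaller
    than [1]. *)
Lemma regular_root_pred (a : R[i]) : `|a| != 1 -> regular_root (fun s : int => s - 1) a.
Proof.
move=> a1 y [K yK] ya s.
case: (real_ltgtP (normr_real a) (real1 _)) a1 => // a1 _; last first.
  have a0 : a != 0 by rewrite -normr_gt0 (lt_trans _ a1).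
  have -> : y s = y (s - 0%N%:Z) by rewrite subr0.
  apply: (bounded_geometric_eq0 (a := a^-1) (K := K) (y := fun r : nat => y (s - r%:Z))) => //.
    by rewrite normfV invf_lt1 // (lt_trans _ a1).
  move=> r; rewrite -addn1 PoszD opprD addrA ya mulKf //.
have -> : y s = y (s + 0%N%:Z) by rewrite addr0.
apply: (bounded_geometric_eq0 (a := a) (K := K) (y := fun r : nat => y (s + r%:Z))) => // r.
by rewrite -addn1 PoszD addrA -ya addrK.
Qed.

End RegularRoots.

(** * Coefficients and pairings *)

Section Coefficients.
Variables (C : numClosedFieldType) (n m : nat).
Notation H := (bipoly C n m).
Implicit Types (f g : H) (P : nat -> nat -> bool).

(* Coefficients of [f] indexed by naturals, [0] outside the matrix. *)
Definition co f (i j : nat) : C :=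
  if (i <= n)%N && (j <= m)%N then f (inord i) (inord j) else 0.

Lemma coE f (i : 'I_n.+1) (j : 'I_m.+1) : co f i j = f i j.
Proof. by rewrite /co !leq_ord !inord_val. Qed.

Lemma co_inj f g : (forall i j, co f i j = co g i j) -> f = g.
Proof. by move=> fg; apply/matrixP => i j; rewrite -!coE fg. Qed.

Lemma co_out f i j : ~~ ((i <= n)%N && (j <= m)%N) -> co f i j = 0.
Proof. by rewrite /co => /negbTE ->. Qed.

Lemma coD f g i j : co (f + g) i j = co f i j + co g i j.
Proof. by rewrite /co; case: ifP => _; rewrite ?addr0 // mxE. Qed.

Lemma coZ a f i j : co (a *: f) i j = a * co f i j.
Proof. by rewrite /co; case: ifP => _; rewrite ?mulr0 // mxE. Qed.

Lemma co_sum (I : Type) (r : seq I) (Q : pred I) (F : I -> H) i j :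
  co (\sum_(k <- r | Q k) F k) i j = \sum_(k <- r | Q k) co (F k) i j.
Proof.
by rewrite /co; case: ifP => _; [rewrite summxE|rewrite big1].
Qed.

Lemma co_delta (a : 'I_n.+1) (b : 'I_m.+1) i j :
  co (delta_mx a b) i j = ((i == a :> nat) && (j == b :> nat))%:R.
Proof.
rewrite /co; case: ifP => [/andP[ni mj]|/negbT].
  by rewrite mxE -!val_eqE /= !inordK.
rewrite negb_and -!ltnNge => /orP[h|h].
  by rewrite (gtn_eqF (leq_ltn_trans (leq_ord a) h)).
by rewrite (gtn_eqF (leq_ltn_trans (leq_ord b) h)) andbF.
Qed.

Lemma co_Mz f i j : co (Mz C n m f) i j = if (0 < i <= n)%N then co f i.-1 j else 0.
Proof.
rewrite lfunE /mulXY; case: (boolP ((i <= n)%N && (j <= m)%N)) => [/andP[ni mj]|h].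
  rewrite ni andbT /co ni mj mxE !inordK // coefXM; case: i ni => [|i] ni /=; first by rewrite coef0.
  rewrite ltnW //= -[in RHS](to_polyXYK f) mxE !inordK //; exact: ltnW.
rewrite co_out //; case: ifP => // /andP[i0 ni]; rewrite co_out // negb_and.
by move: h; rewrite ni /= => ->; rewrite orbT.
Qed.

Lemma co_Mw f i j : co (Mw C n m f) i j = if (0 < j <= m)%N then co f i j.-1 else 0.
Proof.
rewrite lfunE /mulXY; case: (boolP ((i <= n)%N && (j <= m)%N)) => [/andP[ni mj]|h].
  rewrite mj andbT /co ni mj mxE !inordK // coefCM coefXM; case: j mj => [|j] mj //=.
  rewrite ltnW //= -[in RHS](to_polyXYK f) mxE !inordK //; exact: ltnW.
rewrite co_out //; case: ifP => // /andP[j0 mj]; rewrite co_out // negb_and.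
by move: h; rewrite mj andbT /= => ->.
Qed.

Definition supported_on (U : {vspace H}) P :=
  forall g, g \in U <-> forall i j, ~~ P i j -> co g i j = 0.

Lemma supported_polys (j k : int) :
  supported_on (polys C n m j k) (fun s t => (s%:Z <= j) && (t%:Z <= k)).
Proof.
move=> g; split=> [gU s t Pst|gP].
  have [/andP[ns mt]|] := boolP ((s <= n)%N && (t <= m)%N); last exact: co_out.
  move: gU => /memv_sumP[u uP ->]; rewrite co_sum big1 // => a ja.
  have /memv_sumP[v vP ->] := uP a ja.
  rewrite co_sum big1 // => b kb; have /vlineP[x ->] := vP b kb.
  rewrite coZ co_delta; case: eqP => [sa|]; last by rewrite mulr0.
  case: eqP => [tb|]; last by rewrite mulr0.
  by move: Pst; rewrite sa tb ja kb.
rewrite [g]matrix_sum_delta; apply: memv_suml => s _; apply: memv_suml => t _.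
have [/andP[sj tk]|] := boolP ((s%:Z <= j) && (t%:Z <= k)); last first.
  by move/gP; rewrite coE => ->; rewrite scale0r mem0v.
apply: memvZ; rewrite /polys (bigD1 s) //=; apply: (subvP (addvSl _ _)).
by rewrite (bigD1 t) //=; apply: (subvP (addvSl _ _)); exact: memv_line.
Qed.

Lemma supported_img_Mw U P : supported_on U P -> (forall i j, P i j -> (j < m)%N) ->
  supported_on (Mw C n m @: U) (fun i j => (0 < j)%N && P i j.-1).
Proof.
move=> UP Pm g; split=> [/memv_imgP[u uU ->] i j|gP].
  rewrite co_Mw negb_and; case: ifP => // /andP[-> mj] /=.
  by move/(UP u).1: uU; apply.
pose u : H := \matrix_(i, j) co g i j.+1.
have cu i j : (i <= n)%N -> (j <= m)%N -> co u i j = co g i j.+1.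
  by move=> ni mj; rewrite {1}/co ni mj mxE !inordK.
apply/memv_imgP; exists u; [apply/UP => i j Pij|apply: co_inj => i j].
  have [/andP[ni mj]|] := boolP ((i <= n)%N && (j <= m)%N); last exact: co_out.
  by rewrite cu // gP.
rewrite co_Mw; case: ifP => [/andP[j0 mj]|].
  have [ni|ni] := leqP i n; last by rewrite !co_out // [(i <= n)%N]leqNgt ni.
  by rewrite cu ?prednK //; lia.
move/negbT; rewrite negb_and -leqNgt leqn0 -ltnNge => /orP[/eqP ->|mj]; first by rewrite gP.
by rewrite co_out // negb_and -!ltnNge mj orbT.
Qed.

Lemma eq_supported U P Q : (forall i j, (i <= n)%N -> (j <= m)%N -> P i j = Q i j) ->
  supported_on U P -> supported_on U Q.
Proof.
move=> PQ UP g; split=> [/UP gP i j|gQ].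
  have [/andP[ni mj]|] := boolP ((i <= n)%N && (j <= m)%N); last by move/co_out.
  by rewrite -PQ //; exact: gP.
apply/UP => i j; have [/andP[ni mj]|] := boolP ((i <= n)%N && (j <= m)%N); last by move/co_out.
by rewrite PQ //; exact: gQ.
Qed.

Section Pairing.
Variable tau : int -> int -> C.

(* [<f, z^s w^t>] for the functional with moments [tau]. *)
Definition pairing f (s t : int) : C :=
  \sum_(i < n.+1) \sum_(j < m.+1) co f i j * tau (i%:Z - s) (j%:Z - t).

Definition toeplitz_form f g : C :=
  \sum_(k < n.+1) \sum_(l < m.+1) (co g k l)^* * pairing f k l.

Lemma pairingD f g s t : pairing (f + g) s t = pairing f s t + pairing g s t.
Proof.
rewrite -big_split; apply: eq_bigr => i _; rewrite -big_split; apply: eq_bigr => j _.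
by rewrite coD mulrDl.
Qed.

Lemma pairingZ a f s t : pairing (a *: f) s t = a * pairing f s t.
Proof.
rewrite mulr_sumr; apply: eq_bigr => i _; rewrite mulr_sumr; apply: eq_bigr => j _.
by rewrite coZ mulrA.
Qed.

Lemma pairingB f g s t : pairing (f - g) s t = pairing f s t - pairing g s t.
Proof. by rewrite pairingD -scaleN1r pairingZ mulN1r. Qed.

(** [Mz] truncates at degree [n]; the vanishing top row makes it a genuine shift. *)
Lemma pairing_Mz f s t : (forall j, co f n j = 0) ->
  pairing (Mz C n m f) s t = pairing f (s - 1) t.
Proof.
move=> f0; rewrite /pairing big_ord_recl /= big1 ?add0r; last first.
  by move=> j _; rewrite co_Mz mul0r.
rewrite [RHS]big_ord_recr /= [X in _ = _ + X]big1 ?addr0; last by move=> j _; rewrite f0 mul0r.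
apply: eq_bigr => i _; apply: eq_bigr => j _; rewrite co_Mz /= ltn_ord.
by congr (_ * tau _ _); rewrite /bump /=; lia.
Qed.

Lemma pairing_Mw f s t : (forall i, co f i m = 0) ->
  pairing (Mw C n m f) s t = pairing f s (t - 1).
Proof.
move=> f0; apply: eq_bigr => i _.
rewrite big_ord_recl /= co_Mw /= mul0r add0r.
rewrite [RHS]big_ord_recr /= f0 mul0r addr0.
apply: eq_bigr => j _; rewrite co_Mw /= ltn_ord.
by congr (_ * tau _ _); rewrite /bump /=; lia.
Qed.

End Pairing.

End Coefficients.

Section ToeplitzForm.
Variables (C : numClosedFieldType) (n m : nat) (tau : int -> int -> C).
Notation H := (bipoly C n m).
Implicit Types (f g : H).

Lemma toeplitz_delta f (s : 'I_n.+1) (t : 'I_m.+1) :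
  toeplitz_form tau f (delta_mx s t) = pairing tau f s t.
Proof.
rewrite /toeplitz_form (bigD1 s) //= [X in _ + X]big1 ?addr0 => [|k ks].
  rewrite (bigD1 t) //= big1 ?addr0 => [|l lt]; first by rewrite coE mxE !eqxx conjC1 mul1r.
  by rewrite coE mxE (negbTE lt) andbF conjC0 mul0r.
by rewrite big1 // => l _; rewrite coE mxE (negbTE ks) conjC0 mul0r.
Qed.

Lemma pairing_delta (a : 'I_n.+1) (b : 'I_m.+1) s t :
  pairing tau (delta_mx a b : H) s t = tau (a%:Z - s) (b%:Z - t).
Proof.
rewrite /pairing (bigD1 a) //= [X in _ + X]big1 ?addr0 => [|k ka].
  rewrite (bigD1 b) //= big1 ?addr0 => [|l lb]; first by rewrite coE mxE !eqxx mul1r.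
  by rewrite coE mxE (negbTE lb) andbF mul0r.
by rewrite big1 // => l _; rewrite coE mxE (negbTE ka) mul0r.
Qed.

Lemma toeplitz_linear a f g h :
  toeplitz_form tau (a *: f + g) h = a * toeplitz_form tau f h + toeplitz_form tau g h.
Proof.
rewrite mulr_sumr -big_split; apply: eq_bigr => k _ /=.
rewrite mulr_sumr -big_split; apply: eq_bigr => l _ /=.
by rewrite pairingD pairingZ mulrDr mulrCA.
Qed.

Lemma toeplitz_conj f g : (forall s t, tau (- s) (- t) = (tau s t)^*) ->
  toeplitz_form tau f g = (toeplitz_form tau g f)^*.
Proof.
move=> tau_conj.
pose S f g := \sum_(k < n.+1) \sum_(l < m.+1) \sum_(i < n.+1) \sum_(j < m.+1)
  (co g k l)^* * (co f i j * tau (i%:Z - k%:Z) (j%:Z - l%:Z)).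
have SE u v : toeplitz_form tau u v = S u v.
  apply: eq_bigr => k _; apply: eq_bigr => l _; rewrite mulr_sumr; apply: eq_bigr => i _.
  by rewrite mulr_sumr.
rewrite !SE /S rmorph_sum.
under eq_bigr => k _ do rewrite exchange_big /=.
rewrite exchange_big; apply: eq_bigr => i _ /=; rewrite rmorph_sum.
under eq_bigr => k _ do rewrite exchange_big /=.
rewrite exchange_big; apply: eq_bigr => j _ /=; rewrite rmorph_sum.
apply: eq_bigr => k _; rewrite rmorph_sum; apply: eq_bigr => l _ /=.
rewrite !(rmorphM Num.conj) /= conjCK -tau_conj !opprB; ring.
Qed.

End ToeplitzForm.

(** * Orthonormal families *)

Section Orthonormal.
Variables (C : numClosedFieldType) (V : vectType C) (dot : V -> V -> C).
Hypothesis dot_linear : forall a x y z, dot (a *: x + y) z = a * dot x z + dot y z.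
Hypothesis dot_conj : forall x y, dot x y = (dot y x)^*.
Hypothesis dot_gt0 : forall x, x != 0 -> 0 < dot x x.
Implicit Types (x y : V) (e : seq V) (U : {vspace V}).

(** [dot] is abstract so that the rules resting on linearity and conjugate symmetry also apply later
    to the Hermitian form [d], which has no sign. *)
Lemma dot0l y : dot 0 y = 0.
Proof. by have := dot_linear (-1) 0 0 y; rewrite scaler0 addr0 mulN1r addNr. Qed.

Lemma dotZl a x y : dot (a *: x) y = a * dot x y.
Proof. by rewrite -[a *: x]addr0 dot_linear dot0l addr0. Qed.

Lemma dotDl x y z : dot (x + y) z = dot x z + dot y z.
Proof. by rewrite -[x]scale1r dot_linear mul1r scale1r. Qed.

Lemma dotBl x y z : dot (x - y) z = dot x z - dot y z.
Proof. by rewrite dotDl -scaleN1r dotZl mulN1r. Qed.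

Lemma dot_suml (I : Type) (r : seq I) (F : I -> V) y :
  dot (\sum_(i <- r) F i) y = \sum_(i <- r) dot (F i) y.
Proof. by elim: r => [|i r IH]; rewrite ?big_nil ?dot0l // !big_cons dotDl IH. Qed.

Lemma dot0r x : dot x 0 = 0.
Proof. by rewrite dot_conj dot0l conjC0. Qed.

Lemma dotZr a x y : dot x (a *: y) = a^* * dot x y.
Proof. by rewrite dot_conj dotZl (rmorphM Num.conj) /= -dot_conj. Qed.

Lemma dotDr x y z : dot x (y + z) = dot x y + dot x z.
Proof. by rewrite dot_conj dotDl (rmorphD Num.conj) /= -!dot_conj. Qed.

Lemma dotBr x y z : dot x (y - z) = dot x y - dot x z.
Proof. by rewrite dot_conj dotBl (rmorphB Num.conj) /= -!dot_conj. Qed.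

Lemma dot_sumr (I : Type) (r : seq I) (F : I -> V) x :
  dot x (\sum_(i <- r) F i) = \sum_(i <- r) dot x (F i).
Proof. by elim: r => [|i r IH]; rewrite ?big_nil ?dot0r // !big_cons dotDr IH. Qed.

Lemma dot_eq0 x : dot x x = 0 -> x = 0.
Proof. by move=> xx; apply/eqP/negPn/negP => /dot_gt0; rewrite xx ltxx. Qed.

Fixpoint orthonormal e : Prop :=
  if e is x :: s then [/\ dot x x = 1, {in s, forall y, dot x y = 0} & orthonormal s]
  else True.

Lemma orthonormal_cat e1 e2 : orthonormal (e1 ++ e2) <->
  [/\ orthonormal e1, orthonormal e2 & {in e1 & e2, forall x y, dot x y = 0}].
Proof.
elim: e1 => [|x e1 IH] /=; first by split=> [|[]].
split=> [[xx xs /IH [ne1 ne2 ne12] ] | [ [xx xs ne1] ne2 ne12] ].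
  split=> //; first by split=> // y ye; apply: xs; rewrite mem_cat ye.
  move=> y z; rewrite inE => /orP[/eqP -> ze|]; last exact: ne12.
  by apply: xs; rewrite mem_cat ze orbT.
split=> //; last first.
  by apply/IH; split=> // y z ye ze; apply: ne12; rewrite // inE ye orbT.
move=> y; rewrite mem_cat => /orP[/xs //|ye].
by apply: ne12; rewrite // mem_head.
Qed.

Lemma orthonormal_map h e : {in e &, forall x y, dot (h x) (h y) = dot x y} ->
  orthonormal e -> orthonormal (map h e).
Proof.
elim: e => //= x e IH H [xx xs oe]; split.
- by rewrite H ?mem_head.
- move=> _ /mapP[y ye ->]; rewrite H ?xs ?mem_head // inE ye orbT //.
- by apply: IH => // y z ye ze; apply: H; rewrite inE ?ye ?ze orbT.
Qed.

Lemma orthonormal_expansion e u : orthonormal e -> u \in <<e>>%VS ->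
  u = \sum_(x <- e) dot u x *: x.
Proof.
elim: e u => [|x e IH] u /=; first by rewrite span_nil memv0 big_nil => _ /eqP.
move=> [xx xs oe]; rewrite span_cons => /memv_addP[_ /vlineP[a ->] [v ve ->]].
have vx : dot v x = 0.
  rewrite (IH v oe ve) dot_suml big_seq big1 // => y /xs xy.
  by rewrite dotZl [dot y x]dot_conj xy conjC0 mulr0.
rewrite big_cons dotDl dotZl xx mulr1 vx addr0; congr (_ + _).
rewrite {1}(IH v oe ve) big_seq [RHS]big_seq; apply: eq_bigr => y ye.
by rewrite dotDl dotZl (xs y ye) mulr0 add0r.
Qed.

Lemma orthonormal_free e : orthonormal e -> free e.
Proof.
elim: e => [|x e IH] /=; first by rewrite /free span_nil dimv0.
move=> [xx xs oe]; rewrite free_cons IH // andbT; apply/negP => xe.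
have : dot x x = 0.
  rewrite {1}(orthonormal_expansion oe xe) dot_suml big_seq big1 // => y /xs xy.
  by rewrite xy scale0r dot0l.
by move/eqP; rewrite xx oner_eq0.
Qed.

Lemma orthonormal_basis U e : orthonormal e -> {subset e <= U} -> size e = \dim U ->
  <<e>>%VS = U.
Proof.
move=> oe eU se; apply/eqP; rewrite eqEdim; apply/andP; split; first exact/span_subvP.
by have /eqP -> := orthonormal_free oe; rewrite se.
Qed.

Lemma orthonormal_size U e : orthonormal e -> {subset e <= U} -> (size e <= \dim U)%N.
Proof.
move=> oe eU; have /eqP <- := orthonormal_free oe.
by apply: dimvS; exact/span_subvP.
Qed.

(** Gram-Schmidt, by induction on the number of missing vectors. *)
Lemma orthonormal_extend U e : orthonormal e -> {subset e <= U} ->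
  exists e', [/\ orthonormal (e ++ e'), {subset e' <= U} & size (e ++ e') = \dim U].
Proof.
move=> oe eU; have [k] := ubnP (\dim U - size e)%N.
elim: k e oe eU => // k IH e oe eU le_k.
have [size_e|lt_e] := eqVneq (size e) (\dim U).
  by exists [::]; rewrite cats0.
have {}lt_e : (size e < \dim U)%N.
  by rewrite ltn_neqAle lt_e orthonormal_size.
have /subvPn[u uU ue] : ~~ (U <= <<e>>)%VS.
  apply/negP => /dimvS; have /eqP -> := orthonormal_free oe.
  by rewrite leqNgt lt_e.
pose v := u - \sum_(x <- e) dot u x *: x.
have vU : v \in U.
  rewrite memvB // big_seq memv_suml // => x /eU xU; exact: memvZ.
have v0 : v != 0.
  apply: contraNneq ue => /eqP; rewrite subr_eq0 => /eqP ->.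
  by rewrite big_seq memv_suml // => x xe; apply/memvZ/memv_span.
have ve x : x \in e -> dot v x = 0.
  move=> xe; have : x = \sum_(y <- e) dot x y *: y.
    exact: orthonormal_expansion oe (memv_span xe).
  move=> xE; rewrite dotBl dot_suml {1}xE dot_sumr.
  apply/eqP; rewrite subr_eq0; apply/eqP; apply: eq_bigr => y _.
  by rewrite dotZl dotZr -dot_conj mulrC.
pose w := (sqrtC (dot v v))^-1 *: v.
have s0 : 0 < sqrtC (dot v v) by rewrite sqrtC_gt0 dot_gt0.
have ww : dot w w = 1.
  rewrite dotZl dotZr (CrealP _) ?realV ?gtr0_real // mulrA -invfM -expr2 sqrtCK.
  by rewrite mulVf // gt_eqF // dot_gt0.
have [|||e' [ oe' e'U se']] := IH (e ++ [:: w]).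
- apply/orthonormal_cat; split=> // x y xe; rewrite inE => /eqP ->.
  by rewrite dotZr [dot x v]dot_conj (ve x xe) conjC0 mulr0.
- by move=> x; rewrite mem_cat inE => /orP[/eU //|/eqP ->]; exact: memvZ.
- by rewrite size_cat /=; move: le_k lt_e; lia.
exists (w :: e'); rewrite -cat1s catA; split=> // x; rewrite mem_cat inE.
by move=> /orP[/eqP ->|/e'U //]; exact: memvZ.
Qed.

(** The reproducing kernel of [U] seen through two functionals: each vector of one basis is expanded
    in the other and the sums are exchanged. The kernel identities below compare two orthonormal
    bases of one space. *)
Lemma orthonormal_kernel U e e' (la mu : V -> C) :
  (forall a x y, la (a *: x + y) = a * la x + la y) ->
  (forall a x y, mu (a *: x + y) = a * mu x + mu y) ->
  orthonormal e -> {subset e <= U} -> size e = \dim U ->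
  orthonormal e' -> {subset e' <= U} -> size e' = \dim U ->
  \sum_(x <- e) la x * (mu x)^* = \sum_(x <- e') la x * (mu x)^*.
Proof.
have expand (ga : V -> C) : (forall a x y, ga (a *: x + y) = a * ga x + ga y) ->
    forall (r : seq V) (a : V -> C), ga (\sum_(y <- r) a y *: y) = \sum_(y <- r) a y * ga y.
  move=> lin r a; elim: r => [|y r IH]; last by rewrite !big_cons lin IH.
  by rewrite !big_nil; have := lin (-1) 0 0; rewrite scaler0 addr0 mulN1r addNr.
move=> la_lin mu_lin oe eU se oe' e'U se'.
have sp := orthonormal_basis oe eU se; have sp' := orthonormal_basis oe' e'U se'.
transitivity (\sum_(x <- e) \sum_(y <- e') dot x y * la y * (mu x)^*).
  rewrite big_seq [RHS]big_seq; apply: eq_bigr => x /eU; rewrite -sp' => xe'.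
  by rewrite -mulr_suml {1}(orthonormal_expansion oe' xe') expand.
rewrite exchange_big /= big_seq [RHS]big_seq; apply: eq_bigr => y /e'U; rewrite -sp => ye.
rewrite [in RHS](orthonormal_expansion oe ye) (expand mu) // rmorph_sum mulr_sumr.
rewrite -[in RHS](orthonormal_expansion oe ye); apply: eq_bigr => x _.
by rewrite (rmorphM Num.conj) /= -dot_conj mulrA [la y * _]mulrC.
Qed.

End Orthonormal.

(** * Orthogonality beyond the box *)

Section FarOrthogonality.
Variables (R : realType) (n m : nat).
Notation C := R[i].
Notation H := (bipoly C n m).
Variables (c : int -> int -> C) (L : nat) (Gh : 'M[{poly C}]_L).
Hypothesis L_le : (L <= m.+1)%N.
Hypothesis c_bounded : exists K : C, forall s t, `|c s t| <= K.
Hypothesis Gh_size : forall i j, (size (Gh i j) <= (n + n).+1)%N.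
Hypothesis Gh_inverse : forall (i l : 'I_L) (s : int), \sum_j \sum_(k < (n + n).+1)
  (Gh i j)`_k * c (k%:Z - n%:Z - s) (l%:Z - j%:Z) = ((s == 0) && (i == l))%:R.
Hypothesis Gh_det : forall a : C, `|a| = 1 -> (\det Gh).[a] != 0.
Hypothesis nondegenerate : forall g : H,
  (forall i j, ~~ ((i < n)%N && (j < L)%N) -> co g i j = 0) ->
  (forall s t, (s < n)%N -> (t < L)%N -> pairing c g s t = 0) -> g = 0.

Let pred (s : int) : int := s - 1.

Let iter_pred k s : iter k pred s = s - k%:Z.
Proof. by elim: k => [|k IH] /=; rewrite ?subr0 // IH /pred; lia. Qed.

Let actE (q : {poly C}) (y : int -> C) (s : int) : (size q <= (n + n).+1)%N ->
  poly_act pred q y s = \sum_(k < (n + n).+1) q`_k * y (s - k%:Z).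
Proof. by move=> sq; rewrite (poly_act_wide _ _ _ sq); under eq_bigr do rewrite iter_pred. Qed.

(** Coefficients continued by [0] to negative powers of [z], for comparison with two-sided
    sequences. *)
Definition coz (f : H) (s : int) (j : nat) : C := if s is Posz i then co f i j else 0.

Lemma pairing_bounded (f : H) t : bounded_seq (fun s => pairing c f s t).
Proof.
have [K cK] := c_bounded.
exists (\sum_(i < n.+1) \sum_(j < m.+1) `|co f i j| * K) => s.
apply: le_trans (ler_norm_sum _ _ _) _; apply: ler_sum => i _.
apply: le_trans (ler_norm_sum _ _ _) _; apply: ler_sum => j _.
by rewrite normrM ler_wpM2l.
Qed.

(** [Gh] is [z^n] times the inverse of the Toeplitz symbol, so it turns pairings back into
    coefficients; the factor [z^n] causes the shift by [n]. *)
Lemma act_pairing (f : H) (i : 'I_L) s : (forall a b, (L <= b)%N -> co f a b = 0) ->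
  \sum_j poly_act pred (Gh i j) (fun s => pairing c f s j) s = coz f (s - n%:Z) i.
Proof.
move=> fL.
transitivity (\sum_(a < n.+1) \sum_(b < m.+1) co f a b *
    \sum_j \sum_(k < (n + n).+1)
      (Gh i j)`_k * c (k%:Z - n%:Z - (s - n%:Z - a%:Z)) (b%:Z - j%:Z)).
  under eq_bigr => j _ do rewrite (actE _ _ (Gh_size i j)).
  rewrite /pairing.
  under [RHS]eq_bigr => a _.
    under eq_bigr => b _.
      rewrite mulr_sumr; under eq_bigr => j _ do rewrite mulr_sumr.
      over.
    rewrite exchange_big /=; under eq_bigr => j _ do rewrite exchange_big /=.
    over.
  rewrite [RHS]exchange_big /=; apply: eq_bigr => j _.
  rewrite [RHS]exchange_big /=; apply: eq_bigr => k _.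
  rewrite mulr_sumr; apply: eq_bigr => a _; rewrite mulr_sumr; apply: eq_bigr => b _.
  by rewrite mulrCA; congr (_ * (_ * c _ _)); lia.
have E (a b : nat) : co f a b * \sum_j \sum_(k < (n + n).+1)
      (Gh i j)`_k * c (k%:Z - n%:Z - (s - n%:Z - a%:Z)) (b%:Z - j%:Z) =
    co f a b * ((s - n%:Z == a%:Z) && (i == b :> nat))%:R.
  have [bL|/fL ->] := ltnP b L; last by rewrite !mul0r.
  by have -> := Gh_inverse i (Ordinal bL) (s - n%:Z - a%:Z); rewrite subr_eq0 -val_eqE.
under eq_bigr => a _ do under eq_bigr => b _ do rewrite E.
have iL : (i < m.+1)%N := leq_trans (ltn_ord i) L_le.
under eq_bigr => a _.
  rewrite (bigD1 (Ordinal iL)) //= eqxx andbT big1 ?addr0; last first.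
    move=> b; rewrite -val_eqE /= eq_sym => /negbTE ->.
    by rewrite andbF mulr0.
  over.
rewrite /coz; case: (s - n%:Z) => k; last by rewrite big1 // => a _; rewrite mulr0.
have [kn|nk] := ltnP k n.+1; last first.
  rewrite co_out ?negb_and -?ltnNge ?nk // big1 // => a _.
  by rewrite eqz_nat gtn_eqF ?mulr0 // (leq_trans (ltn_ord a)).
rewrite (bigD1 (Ordinal kn)) //= eqxx mulr1 big1 ?addr0 // => a.
by rewrite -val_eqE /= eqz_nat eq_sym => /negbTE ->; rewrite mulr0.
Qed.

Lemma act_inj (y : 'I_L -> int -> C) : (forall j, bounded_seq (y j)) ->
  (forall i s, \sum_j poly_act pred (Gh i j) (y j) s = 0) -> forall j s, y j s = 0.
Proof.
apply: poly_act_matrix_inj => [|a ra].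
  by apply: contraNneq (Gh_det (normr1 _)) => ->; rewrite horner0.
by apply: regular_root_pred; apply: contraTneq ra; rewrite /root; exact: Gh_det.
Qed.

(* Cutting the sequence of pairings at index [0] and applying the banded
   operator [Gh] gives a polynomial of [z]-degree below [n], whose pairings are
   the cut sequence; positivity then kills it. *)
Lemma pairing_vanish (f : H) : (forall a b, (L <= b)%N -> co f a b = 0) ->
  (forall s t : nat, (s < n)%N -> (t < L)%N -> pairing c f s t = 0) ->
  forall (s : int) (t : nat), s < n%:Z -> (t < L)%N -> pairing c f s t = 0.
Proof.
move=> fL f0.
pose ym (j : 'I_L) (s : int) := if s < 0 then pairing c f s j else 0.
pose g : H := \matrix_(i, t) if (insub (t : nat) : option 'I_L) is Some t' then
  if (i < n)%N then \sum_j poly_act pred (Gh t' j) (ym j) (i%:Z + n%:Z) else 0 else 0.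
have coG a (t : 'I_L) : co g a t =
    if (a < n)%N then \sum_j poly_act pred (Gh t j) (ym j) (a%:Z + n%:Z) else 0.
  have tm : (t <= m)%N by rewrite -ltnS (leq_trans (ltn_ord t)).
  have [an|na] := leqP a n; last by rewrite co_out ?negb_and -?ltnNge ?na // ltnNge (ltnW na).
  by rewrite /co an tm mxE !inordK // valK.
have gL a b : (L <= b)%N -> co g a b = 0.
  move=> Lb; have [/andP[an bm]|] := boolP ((a <= n)%N && (b <= m)%N); last exact: co_out.
  by rewrite /co an bm mxE !inordK // insubF // ltnNge Lb.
have gn i j : ~~ ((i < n)%N && (j < L)%N) -> co g i j = 0.
  have [jL|Lj] := ltnP j L; last by rewrite gL.
  by rewrite andbT => /negbTE ni; have := coG i (Ordinal jL); rewrite ni.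
(* The operator at [s] reads the indices from [s - 2n] to [s]. For [s < n] those that are
   nonnegative lie in [[0, n)], where the pairings of [f] vanish, so the cut changes nothing and the
   value is a coefficient of negative index. For [s >= 2n] all of them are nonnegative, where [ym]
   is [0]; this is why [g] has [z]-degree below [n]. *)
have ym_act i s : \sum_j poly_act pred (Gh i j) (ym j) s = coz g (s - n%:Z) i.
  have [sn|ns] := ltP s n%:Z.
    have -> : coz g (s - n%:Z) i = coz f (s - n%:Z) i.
      by have : s - n%:Z < 0; [lia|case: (s - n%:Z)].
    rewrite -act_pairing //; apply: eq_bigr => j _; rewrite !actE //.
    apply: eq_bigr => k _; congr (_ * _); rewrite /ym; case: ltP => // k0.
    have -> : s - k%:Z = `|s - k%:Z|%N%:Z by lia.
    by rewrite f0 //; move: sn k0; lia.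
  have -> : s - n%:Z = `|s - n%:Z|%N%:Z by lia.
  rewrite /coz coG; case: ltnP => [|big]; last first.
    rewrite big1 // => j _; rewrite actE // big1 // => k _.
    by rewrite /ym ltNge (_ : 0 <= _) ?mulr0 //; have := ltn_ord k; lia.
  by have <- : s = `|s - n%:Z|%N%:Z + n%:Z by lia.
have ymE (j : 'I_L) (s : int) : pairing c g s j - ym j s = 0.
  apply: (act_inj (y := fun j s => pairing c g s j - ym j s)) => [{}j|i {}s].
    have [K1 gK] := pairing_bounded g j; have [K2 fK] := pairing_bounded f j.
    exists (K1 + K2) => r; apply: le_trans (ler_normB _ _) _; apply: lerD => //.
    by rewrite /ym; case: ifP => // _; rewrite normr0 (le_trans _ (fK 0)).
  transitivity (\sum_j poly_act pred (Gh i j) (fun s => pairing c g s j) s -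
      \sum_j poly_act pred (Gh i j) (ym j) s).
    rewrite -sumrB; apply: eq_bigr => l _; rewrite !actE // -sumrB.
    by apply: eq_bigr => k _; rewrite mulrBr.
  by rewrite act_pairing // ym_act subrr.
(* The cut sequence is [0] on [[0, n)], so [g] pairs to [0] with every monomial of its own box. *)
have g0 : g = 0.
  apply: nondegenerate => // s t sn tL.
  by have := ymE (Ordinal tL) s; rewrite /ym /= subr0.
move=> s t sn tL; have [s0|s0] := ltP s 0.
  have := ymE (Ordinal tL) s; rewrite /ym s0 g0 /= => /eqP.
  rewrite subr_eq0 => /eqP <-; rewrite /pairing big1 // => i _; rewrite big1 // => j _.
  by rewrite /co mxE if_same mul0r.
have -> : s = `|s|%N%:Z by lia.
by rewrite f0 //; lia.
Qed.

End FarOrthogonality.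

(** * The Hilbert space of a positive form *)

Section SupportDimension.
Variables (C : numClosedFieldType) (n m : nat).
Notation H := (bipoly C n m).

Lemma dim_supported (U : {vspace H}) a b : (a <= n.+1)%N -> (b <= m.+1)%N ->
  supported_on U (fun i j => (i < a)%N && (j < b)%N) -> \dim U = (a * b)%N.
Proof.
move=> an bm UP.
pose emb (A : 'M[C]_(a, b)) : H := \matrix_(i, j)
  if (insub (i : nat) : option 'I_a, insub (j : nat) : option 'I_b) is (Some i', Some j')
  then A i' j' else 0.
have emb_lin : linear emb.
  move=> x A B; apply/matrixP => i j; rewrite !mxE.
  case: insub => [i'|]; last by rewrite mulr0 addr0.
  by case: insub => [j'|]; rewrite ?mxE // mulr0 addr0.
have insub_out (A : 'M[C]_(a, b)) (i j : nat) : ~~ ((i < a)%N && (j < b)%N) ->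
    (if (insub i : option 'I_a, insub j : option 'I_b) is (Some i', Some j')
     then A i' j' else 0) = 0.
  rewrite negb_and => /orP[h|h].
    by have -> : insub i = None :> option 'I_a by apply: insubF; exact: negbTE.
  have -> : insub j = None :> option 'I_b by apply: insubF; exact: negbTE.
  by case: insub.
have co_emb A (i : 'I_a) (j : 'I_b) : co (emb A) i j = A i j.
  rewrite /co -ltnS (leq_trans (ltn_ord i) an) -ltnS (leq_trans (ltn_ord j) bm) mxE.
  by rewrite !inordK ?(leq_trans (ltn_ord _)) // !valK.
pose lemb := GRing.isLinear.Build C 'M[C]_(a, b) H _ emb emb_lin.
pose F : {linear 'M[C]_(a, b) -> H} := HB.pack emb lemb.
pose f := linfun F.
have fE A : f A = emb A by rewrite lfunE.
have UE : U = limg f.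
  apply/vspaceP => g; apply/idP/idP => [/UP gP|/memv_imgP[A _ ->]].
    apply/memv_imgP; exists (\matrix_(i, j) co g i j); rewrite ?memvf //.
    apply: co_inj => i j; rewrite fE.
    have [/andP[ia jb]|h] := boolP ((i < a)%N && (j < b)%N).
      by have := co_emb (\matrix_(i, j) co g i j) (Ordinal ia) (Ordinal jb); rewrite /= mxE => ->.
    rewrite gP // /co; case: ifP => // /andP[ni mj]; rewrite mxE !inordK //.
    exact/esym/insub_out.
  apply/UP => i j h; rewrite fE /co; case: ifP => // /andP[ni mj]; rewrite mxE !inordK //.
  exact: insub_out.
rewrite UE limg_dim_eq ?dimvf //.
apply/eqP; rewrite capfv -subv0; apply/subvP => A; rewrite memv_ker memv0 fE => /eqP A0.
by apply/eqP/matrixP => i j; rewrite -co_emb A0 /co !mxE if_same.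
Qed.

End SupportDimension.

Section HilbertSpace.
Variables (C : numClosedFieldType) (n m : nat).
Notation H := (bipoly C n m).
Variables (T : {scalar laurent C n m}) (hT : positive_form T).
Implicit Types (f g : H) (U : {vspace H}) (P : nat -> nat -> bool).

Definition form_moment (s t : int) : C := T (lmonom C s t).

Lemma ip_linear a f g h : ip hT (a *: f + g) h = a * ip hT f h + ip hT g h.
Proof. by rewrite /ip mulbar_linearl linearP. Qed.

Lemma ip_conj f g : ip hT f g = (ip hT g f)^*.
Proof. by rewrite ip_hermitian expr0 mul1r. Qed.

Lemma ip_gt0 f : f != 0 -> 0 < ip hT f f.
Proof. exact: hT. Qed.

Lemma ip_pairing f g : ip hT f g = toeplitz_form form_moment f g.
Proof.
rewrite /ip /mulbar linear_sum /toeplitz_form.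
under [RHS]eq_bigr => k _ do rewrite (eq_bigr _ (fun l _ => mulr_sumr _ _ _ _)) exchange_big.
rewrite [RHS]exchange_big; apply: eq_bigr => i _ /=.
under [RHS]eq_bigr => k _ do rewrite (eq_bigr _ (fun l _ => mulr_sumr _ _ _ _)) exchange_big.
rewrite [RHS]exchange_big linear_sum; apply: eq_bigr => j _ /=.
rewrite linear_sum; apply: eq_bigr => k _ /=.
rewrite linear_sum; apply: eq_bigr => l _ /=.
by rewrite linearZ_LR /= !coE mulrA [(g k l)^* * _]mulrC.
Qed.

Lemma ip_delta f (s : 'I_n.+1) (t : 'I_m.+1) :
  ip hT f (delta_mx s t) = pairing form_moment f s t.
Proof. by rewrite ip_pairing toeplitz_delta. Qed.

Lemma orth_ip U f : (f \in orth hT U) <-> {in U, forall g, ip hT f g = 0}.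
Proof. by split=> [/mem_orthovP|?]; [|apply/mem_orthovP]. Qed.

Lemma orth_supported U P f : supported_on U P ->
  (f \in orth hT U) <->
  forall i j, (i <= n)%N -> (j <= m)%N -> P i j -> pairing form_moment f i j = 0.
Proof.
move=> UP; split=> [/orth_ip fU i j ni mj Pij|fP].
  have := fU (delta_mx (Ordinal (ni : i < n.+1)%N) (Ordinal (mj : j < m.+1)%N)).
  rewrite ip_delta; apply.
  by apply/UP => a b; rewrite co_delta /=; case: eqP => // ->; case: eqP => // ->; rewrite Pij.
apply/orth_ip => g /UP gP; rewrite ip_pairing /toeplitz_form big1 // => k _.
rewrite big1 // => l _; have [Pkl|/gP ->] := boolP (P k l); last by rewrite conjC0 mul0r.
by rewrite fP ?leq_ord ?mulr0.
Qed.

Lemma orthov_sum U y : exists2 u, u \in U & y - u \in orth hT U.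
Proof.
have [||e [ /= oe eU se]] := orthonormal_extend ip_linear ip_conj ip_gt0 (U := U) (e := [::]) => //.
have eUU := orthonormal_basis ip_linear ip_conj oe eU se.
exists (\sum_(x <- e) ip hT y x *: x).
  by rewrite big_seq memv_suml // => x /eU xU; exact: memvZ.
apply/orth_ip => u; rewrite -eUU => ue.
rewrite (dotBl ip_linear) (dot_suml ip_linear) {1}(orthonormal_expansion ip_linear ip_conj oe ue).
rewrite (dot_sumr ip_linear ip_conj); apply/eqP; rewrite subr_eq0; apply/eqP.
apply: eq_bigr => x _.
by rewrite (dotZr ip_linear ip_conj) (dotZl ip_linear) [ip hT x u]ip_conj mulrC.
Qed.

Lemma orth_cap U u : u \in U -> u \in orth hT U -> u = 0.
Proof. by move=> uU /orth_ip /(_ u uU); exact: dot_eq0 ip_gt0 _. Qed.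

Lemma orth_proj_mem U y : orth_proj hT U y \in U.
Proof. exact: memv_pi. Qed.

Lemma orth_proj_orth U y : y - orth_proj hT U y \in orth hT U.
Proof.
have [u uU uy] := orthov_sum U y.
have dis : (U :&: orth hT U = 0)%VS.
  apply/eqP; rewrite -subv0; apply/subvP => x /memv_capP[xU xo].
  by rewrite (orth_cap xU xo) mem0v.
have yUO : y \in (U + orth hT U)%VS by rewrite -[y](subrKC u) memv_add.
have -> : y - orth_proj hT U y = daddv_pi (orth hT U) U y.
  by rewrite -{1}(daddv_pi_add dis yUO) /orth_proj addrAC subrr add0r.
exact: memv_pi.
Qed.

Lemma orth_proj_unique U y u : u \in U -> y - u \in orth hT U -> orth_proj hT U y = u.
Proof.
move=> uU yu; apply/eqP; rewrite -subr_eq0; apply/eqP.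
apply: (@orth_cap U); first by rewrite memvB // orth_proj_mem.
have -> : orth_proj hT U y - u = (y - u) - (y - orth_proj hT U y).
  by rewrite opprB [RHS]addrC addrA subrK.
by rewrite memvB // orth_proj_orth.
Qed.

Lemma vsval_compress U V (h : 'End(H)) x :
  vsval (compress hT U V h x) = orth_proj hT V (h (vsval x)).
Proof.
by rewrite /compress !comp_lfunE !lfunE /= vsprojK // orth_proj_mem.
Qed.

End HilbertSpace.

(** * Krylov spaces and invariant hulls *)

Section IterateSpan.
Variables (F : fieldType) (V W : vectType F) (S : 'End(V)) (A : 'Hom(V, W)).

Let krylov x k := <<mkseq (fun i => iter i S x) k>>%VS.

Lemma iter_comp_lfun j x : iter j (comp_lfun S) \1%VF x = iter j S x.
Proof. by elim: j => [|j IH] /=; rewrite ?id_lfunE // comp_lfunE IH. Qed.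

Lemma comp_iter_lfunE (V0 : vectType F) (B : 'Hom(V0, V)) j x :
  (A \o iter j (comp_lfun S) \1 \o B)%VF x = A (iter j S (B x)).
Proof. by rewrite !comp_lfunE iter_comp_lfun. Qed.

Let krylov_invariant x k : iter k S x \in krylov x k ->
  forall j, iter j S x \in krylov x k.
Proof.
move=> kx; case: k kx => [|k] kx.
  move: kx; rewrite /krylov span_nil memv0 => /eqP /= ->.
  by elim=> [|j IH] /=; rewrite ?mem0v //; move: IH; rewrite memv0 => /eqP ->; rewrite linear0 mem0v.
have SW : (S @: krylov x k.+1 <= krylov x k.+1)%VS.
  rewrite limg_span; apply/span_subvP => _ /mapP[_ /mapP[i ik ->] ->].
  rewrite -iterS; move: ik; rewrite mem_iota add0n => /andP[_]; rewrite ltnS leq_eqVlt.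
  case/orP => [/eqP -> //|ik]; apply/memv_span/mapP; exists i.+1 => //.
  by rewrite mem_iota.
elim=> [|j IH]; first by apply/memv_span/mapP; exists 0%N; rewrite ?mem_iota.
by rewrite iterS (subvP SW) // memv_img.
Qed.

(** For dimension reasons some [S^k x] with [k <= N] lies in the span of its predecessors; that span
    then contains all iterates and lies in the kernel of [A]. *)
Lemma iter_kernel N x : (\dim {:V} <= N)%N -> (forall j, (j < N)%N -> A (iter j S x) = 0) ->
  forall j, A (iter j S x) = 0.
Proof.
move=> dN AN.
have [k kN kx] : exists2 k, (k <= N)%N & iter k S x \in krylov x k.
  case: (boolP [exists k : 'I_N.+1, iter k S x \in krylov x k]) => [/existsP[k kx]|].
    by exists (val k); rewrite ?leq_ord.
  rewrite negb_exists => /forallP H.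
  have dim k : (k <= N.+1)%N -> \dim (krylov x k) = k.
    elim: k => [|k IH] kN; first by rewrite /krylov span_nil dimv0.
    have nk : iter k S x \notin krylov x k := H (Ordinal kN).
    have fr : free (mkseq (fun i => iter i S x) k).
      by rewrite /free size_mkseq IH // ltnW.
    have : free (rcons (mkseq (fun i => iter i S x) k) (iter k S x)).
      by rewrite -cats1 (perm_free (permEl (perm_catC _ _))) free_cons nk.
    by rewrite -mkseqS => /eqP; rewrite size_mkseq.
  by have := dimvS (subvf (krylov x N.+1)); rewrite dim // leqNgt ltnS dN.
move=> j; have := krylov_invariant kx j; rewrite /krylov => jx.
suff : (krylov x k <= lker A)%VS by move=> /subvP /(_ _ jx); rewrite memv_ker => /eqP.
apply/span_subvP => _ /mapP[i ik ->]; rewrite memv_ker AN //.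
by move: ik; rewrite mem_iota add0n => /andP[_ /leq_trans]; apply.
Qed.

(** For [N] at least the dimension of [V], this is the largest [S]-invariant subspace of
    [lker A]. *)
Definition iter_lker N : {vspace V} := (\bigcap_(j < N) lker (A \o iter j (comp_lfun S) \1)%VF)%VS.

Lemma mem_iter_lker N x : reflect (forall j, (j < N)%N -> A (iter j S x) = 0) (x \in iter_lker N).
Proof.
apply: (iffP idP) => [xN j jN|xN].
  have /subvP /(_ x xN) : (iter_lker N <= lker (A \o iter j (comp_lfun S) \1)%VF)%VS.
    exact: (bigcapv_inf (Ordinal jN)).
  by rewrite memv_ker comp_lfunE iter_comp_lfun => /eqP.
rewrite memvE; apply/subv_bigcapP => j _; rewrite -memvE memv_ker comp_lfunE iter_comp_lfun.
by rewrite xN.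
Qed.

Lemma iter_lker_invariant N : (\dim {:V} <= N)%N -> (S @: iter_lker N <= iter_lker N)%VS.
Proof.
move=> dN; apply/subvP => _ /memv_imgP[x /mem_iter_lker xN ->].
by apply/mem_iter_lker => j _; rewrite -iterSr; apply: (iter_kernel dN).
Qed.

Lemma invariant_hull_iter (U : {vspace V}) x j : x \in U -> invariant_hull S U (iter j S x).
Proof.
move=> xU Z UZ SZ; elim: j => [|j IH]; first exact: (subvP UZ).
by rewrite iterS (subvP SZ) // memv_img.
Qed.

Lemma invariant_hull_lkerP (U : {vspace V}) N : (\dim {:V} <= N)%N ->
  (forall x, invariant_hull S U x -> x \in lker A) <->
  (forall j, (j < N)%N -> forall x, x \in U -> A (iter j S x) = 0).
Proof.
move=> dN; split=> [H j _ x xU|H x hx].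
  by have := H _ (invariant_hull_iter j xU); rewrite memv_ker => /eqP.
(* [N.+1] rather than [N], so that the condition for [j = 0] is present even when [N = 0]. *)
have : x \in iter_lker N.+1.
  apply: hx; last by apply: iter_lker_invariant; exact: leqW.
  apply/subvP => y yU; apply/mem_iter_lker => j _.
  by apply: (iter_kernel dN) => i iN; exact: H.
by move/mem_iter_lker/(_ 0%N isT)/eqP; rewrite memv_ker.
Qed.

End IterateSpan.

Section Subspaces.
Variables (C : numClosedFieldType) (n m : nat).
Notation H := (bipoly C n m).
Implicit Types (f g : H).

Lemma supported_full : supported_on (polys C n m n m) (fun i j => true).
Proof. by apply: eq_supported (supported_polys n m) => i j ni mj /=; lia. Qed.

Lemma supported_zshort : supported_on (polys C n m (n%:Z - 1) m) (fun i j => (i < n)%N).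
Proof. by apply: eq_supported (supported_polys _ _) => i j ni mj /=; lia. Qed.

Lemma supported_wshort : supported_on (polys C n m n (m%:Z - 1)) (fun i j => (j < m)%N).
Proof. by apply: eq_supported (supported_polys _ _) => i j ni mj /=; lia. Qed.

Lemma supported_short :
  supported_on (polys C n m (n%:Z - 1) (m%:Z - 1)) (fun i j => (i < n)%N && (j < m)%N).
Proof. by apply: eq_supported (supported_polys _ _) => i j ni mj /=; lia. Qed.

Lemma zshortP f : f \in polys C n m (n%:Z - 1) m <-> forall j, co f n j = 0.
Proof.
split=> [/supported_zshort fP j|f0]; first by rewrite fP ?ltnn.
apply/supported_zshort => i j; rewrite -leqNgt leq_eqVlt => /orP[/eqP <- //|ni].
by rewrite co_out // negb_and -ltnNge ni.
Qed.

Lemma wshortP f : f \in polys C n m n (m%:Z - 1) <-> forall i, co f i m = 0.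
Proof.
split=> [/supported_wshort fP i|f0]; first by rewrite fP ?ltnn.
apply/supported_wshort => i j; rewrite -leqNgt leq_eqVlt => /orP[/eqP <- //|mj].
by rewrite co_out // negb_and -!ltnNge mj orbT.
Qed.

Lemma shortP f : f \in polys C n m (n%:Z - 1) (m%:Z - 1) <->
  (forall j, co f n j = 0) /\ (forall i, co f i m = 0).
Proof.
split=> [/supported_short fP|[/zshortP/supported_zshort fz /wshortP/supported_wshort fw]].
  by split=> ?; rewrite fP ?ltnn ?andbF.
by apply/supported_short => i j; rewrite negb_and => /orP[/fz|/fw].
Qed.

Lemma polys_full f : f \in polys C n m n m.
Proof. by apply/supported_full. Qed.

Lemma toeplitz_Mz tau f g : (forall j, co f n j = 0) -> (forall j, co g n j = 0) ->
  toeplitz_form tau (Mz C n m f) (Mz C n m g) = toeplitz_form tau f g.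
Proof.
move=> f0 g0; rewrite /toeplitz_form big_ord_recl /= big1 ?add0r; last first.
  by move=> l _; rewrite co_Mz conjC0 mul0r.
rewrite [RHS]big_ord_recr /= [X in _ = _ + X]big1 ?addr0; last first.
  by move=> l _; rewrite g0 conjC0 mul0r.
apply: eq_bigr => k _; apply: eq_bigr => l _.
rewrite co_Mz pairing_Mz //= ltn_ord; congr (_ * pairing _ _ _ _).
by rewrite /bump /=; lia.
Qed.

Lemma toeplitz_Mw tau f g : (forall i, co f i m = 0) -> (forall i, co g i m = 0) ->
  toeplitz_form tau (Mw C n m f) (Mw C n m g) = toeplitz_form tau f g.
Proof.
move=> f0 g0; apply: eq_bigr => k _; rewrite big_ord_recl /= co_Mw conjC0 mul0r add0r.
rewrite [RHS]big_ord_recr /= g0 conjC0 mul0r addr0; apply: eq_bigr => l _.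
rewrite co_Mw pairing_Mw //= ltn_ord; congr (_ * pairing _ _ _ _).
by rewrite /bump /=; lia.
Qed.

Lemma MwK f : (forall i, co f i m = 0) -> Mw C n m f = 0 -> f = 0.
Proof.
move=> f0 Mf; apply: co_inj => i j.
have -> : co (0 : H) i j = 0 by rewrite /co mxE if_same.
have [mj|mj] := ltnP j m; last by have /wshortP/supported_wshort := f0; apply; rewrite -leqNgt.
have := co_Mw f i j.+1; rewrite Mf /= mj => <-.
by rewrite /co mxE if_same.
Qed.

Lemma dim_zshort : \dim (polys C n m (n%:Z - 1) m) = (n * m.+1)%N.
Proof.
apply: dim_supported; rewrite ?leqnSn //.
by apply: eq_supported supported_zshort => i j ni mj; rewrite ltnS mj andbT.
Qed.

Lemma dim_wshort : \dim (polys C n m n (m%:Z - 1)) = (n.+1 * m)%N.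
Proof.
apply: dim_supported; rewrite ?leqnSn //.
by apply: eq_supported supported_wshort => i j ni mj; rewrite ltnS ni.
Qed.

Lemma dim_short : \dim (polys C n m (n%:Z - 1) (m%:Z - 1)) = (n * m)%N.
Proof. by apply: dim_supported; rewrite ?leqnSn //; exact: supported_short. Qed.

Lemma Mz_Mw_comm f : f \in polys C n m (n%:Z - 1) (m%:Z - 1) ->
  Mw C n m (Mz C n m f) = Mz C n m (Mw C n m f).
Proof.
move=> _; apply: co_inj => i j; rewrite co_Mw !co_Mz co_Mw.
by case: ifP; case: ifP.
Qed.

End Subspaces.

(** * The split-shift condition and the operators *)

Section SplitShift.
Variables (C : numClosedFieldType) (n m : nat).
Notation H := (bipoly C n m).
Variables (T : {scalar laurent C n m}) (hT : positive_form T).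
Implicit Types (f g : H).
Notation tau := (form_moment T).
Notation Mz := (Mz C n m).
Notation Mw := (Mw C n m).
Notation wX := (Mw @: polys C n m n (m%:Z - 1))%VS.
Notation wX' := (Mw @: polys C n m (n%:Z - 1) (m%:Z - 1))%VS.
Notation zX' := (Mz @: polys C n m (n%:Z - 1) (m%:Z - 1))%VS.
Notation P' := (polys C n m (n%:Z - 1) m).
Notation E1' := (E1 hT (n%:Z - 1) m).

Lemma memE1_short f : f \in E1' <-> f \in P' /\ f \in orth hT wX'.
Proof. by rewrite /E1 /ominus memv_cap; split=> [/andP|[-> ->]]. Qed.

Lemma memE1 f : f \in E1 hT n m <-> f \in orth hT wX.
Proof. by rewrite /E1 /ominus memv_cap polys_full. Qed.

Lemma memF2 f : f \in F2 hT n (m%:Z - 1) <->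
  f \in polys C n m n (m%:Z - 1) /\ f \in orth hT (polys C n m (n%:Z - 1) (m%:Z - 1)).
Proof. by rewrite /F2 /ominus memv_cap; split=> [/andP|[-> ->]]. Qed.

Lemma memE2 f : f \in E2 hT n (m%:Z - 1) <->
  f \in polys C n m n (m%:Z - 1) /\ f \in orth hT zX'.
Proof. by rewrite /E2 /ominus memv_cap; split=> [/andP|[-> ->]]. Qed.

Lemma ip_Mz f g : f \in P' -> g \in P' -> ip hT (Mz f) (Mz g) = ip hT f g.
Proof. by move=> /zshortP f0 /zshortP g0; rewrite !ip_pairing toeplitz_Mz. Qed.

Lemma ip_Mw f g : f \in polys C n m n (m%:Z - 1) -> g \in polys C n m n (m%:Z - 1) ->
  ip hT (Mw f) (Mw g) = ip hT f g.
Proof. by move=> /wshortP f0 /wshortP g0; rewrite !ip_pairing toeplitz_Mw. Qed.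

Lemma short_zshort f : f \in polys C n m (n%:Z - 1) (m%:Z - 1) -> f \in P'.
Proof. by move=> /shortP[/zshortP]. Qed.

Lemma short_wshort f : f \in polys C n m (n%:Z - 1) (m%:Z - 1) ->
  f \in polys C n m n (m%:Z - 1).
Proof. by move=> /shortP[_ /wshortP]. Qed.

Lemma Mw_zshort f : f \in P' -> Mw f \in P'.
Proof. by move=> /zshortP f0; apply/zshortP => j; rewrite co_Mw f0 if_same. Qed.

Lemma Mz_wshort f : f \in polys C n m n (m%:Z - 1) -> Mz f \in polys C n m n (m%:Z - 1).
Proof. by move=> /wshortP f0; apply/wshortP => i; rewrite co_Mz f0 if_same. Qed.

Lemma wX'_P' f : f \in wX' -> f \in P'.
Proof. by move=> /memv_imgP[u uX ->]; apply/Mw_zshort/short_zshort. Qed.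

Lemma zX'_X f : f \in zX' -> f \in polys C n m n (m%:Z - 1).
Proof. by move=> /memv_imgP[u uX ->]; apply/Mz_wshort/short_wshort. Qed.

(** Inside [P_{n-1,m}], of dimension [n (m + 1)], the space meets [w P_{n-1,m-1}], of dimension
    [n m], only in [0]. This bound is why the iterates [j < n] suffice in the matrix condition. *)
Lemma dim_domT : (\dim (domT hT) <= n)%N.
Proof.
have dwX : \dim wX' = (n * m)%N.
  rewrite limg_dim_eq ?dim_short //; apply/eqP; rewrite -subv0; apply/subvP => u.
  rewrite memv_cap memv_ker memv0 => /andP[/shortP[_ u0] /eqP Mu].
  by rewrite (MwK u0 Mu).
have dis : (domT hT :&: wX' = 0)%VS.
  apply/eqP; rewrite -subv0; apply/subvP => u; rewrite memv_cap memv0.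
  by case/andP => /memE1_short[_ uo] uw; rewrite (orth_cap uw uo).
have : (domT hT + wX' <= P')%VS.
  apply/subvP => u /memv_addP[a /memE1_short[aP _] [b bw ->]].
  by rewrite memvD // wX'_P'.
move/dimvS; rewrite dimv_disjoint_sum // dwX dim_zshort mulnS; lia.
Qed.

Lemma orth_zshort_split f : f \in orth hT E1' -> f \in orth hT wX' -> f \in orth hT P'.
Proof.
move=> /orth_ip fE /orth_ip fw; apply/orth_ip => g gP.
have [u uw gu] := orthov_sum hT wX' g.
have guE : g - u \in E1' by apply/memE1_short; rewrite memvB // wX'_P'.
by rewrite -[g](subrKC u) (dotDr (ip_linear hT) (ip_conj hT)) fw // fE // addr0.
Qed.

Let dim_subvs N : (n <= N)%N -> (\dim {:subvs_of (domT hT)} <= N)%N.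
Proof. by move=> nN; rewrite dimvf /dim /=; apply: leq_trans dim_domT nN. Qed.

Lemma hull_iterP :
  (forall x, invariant_hull (opT hT) (limg (opB hT)) x -> x \in lker (opA hT)) <->
  (forall j, (j < n)%N ->
     (opA hT \o iter j (comp_lfun (opT hT)) \1 \o opB hT = 0)%VF).
Proof.
apply: (iff_trans (invariant_hull_lkerP _ _ _ (dim_subvs (leqnn n)))).
split=> H j jn.
  apply/lfunP => x; rewrite comp_iter_lfunE zero_lfunE.
  by apply: H => //; rewrite memv_img ?memvf.
move=> _ /memv_imgP[x _ ->]; have /lfunP/(_ x) := H j jn.
by rewrite comp_iter_lfunE zero_lfunE.
Qed.

Lemma hull_split_shift :
  (forall x, invariant_hull (opT hT) (limg (opB hT)) x -> x \in lker (opA hT)) ->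
  split_shift_orthogonality hT.
Proof.
move=> /(invariant_hull_lkerP _ _ _ (dim_subvs (leqnSn n))) hAB.
pose W := iter_lker (opT hT) (opA hT) n.+1.
have BW x : opB hT x \in W.
  by apply/mem_iter_lker => j jn; apply: hAB; rewrite ?memv_img ?memvf.
have TW x : x \in W -> opT hT x \in W.
  move=> xW; have := iter_lker_invariant (opT hT) (opA hT) (dim_subvs (leqnSn n)).
  by move/subvP; apply; exact: memv_img.
have AW x : x \in W -> opA hT x = 0 by move/mem_iter_lker/(_ 0%N isT).
pose K2 := (linfun (@vsval _ _ (domT hT)) @: W)%VS.
have K2P g : g \in K2 <-> exists2 x, x \in W & g = vsval x.
  split=> [/memv_imgP[x xW ->]|[x xW ->]]; first by exists x; rewrite ?lfunE.
  by apply/memv_imgP; exists x; rewrite ?lfunE.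
have K2E g : g \in K2 -> g \in E1' by move=> /K2P[x _ ->]; exact: subvsP.
pose K1 := (E1' :&: orth hT K2)%VS.
have dotr := dotDr (ip_linear hT) (ip_conj hT).
(* A vector of [K1] sees only the projection of [y] to [E^1_{n-1,m}], so it is orthogonal to [y] as
   soon as that projection lies in [K2]. *)
have proj0 U k y : k \in E1' -> k \in orth hT K2 -> orth_proj hT E1' y \in K2 ->
    U = y -> ip hT k U = 0.
  move=> kE /orth_ip kK yK ->; rewrite -[y](subrKC (orth_proj hT E1' y)) dotr kK // add0r.
  by rewrite ip_conj; have /orth_ip -> := orth_proj_orth hT E1' y; rewrite ?conjC0.
exists K1, K2; split.
- split; first by apply/subvP => x /memv_capP[].
  apply/vspaceP => x; apply/idP/idP => [xE|/memv_addP[a /memv_capP[aE _] [b /K2E bE ->]]].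
    have [u uK xu] := orthov_sum hT K2 x.
    by rewrite -[x](subrK u) memv_add // memv_cap xu memvB // K2E.
  exact: memvD.
- apply/subvP => k /memv_capP[kE kK]; apply/orth_ip => _ /memv_imgP[_ /K2P[x xW ->] ->].
  apply: (proj0 _ _ _ kE kK _ (erefl _)); apply/K2P; exists (opT hT x); first exact: TW.
  by rewrite vsval_compress.
- apply/subvP => k /memv_capP[kE kK]; apply/memE1/orth_ip => _ /memv_imgP[u uX ->].
  (* [P_{n,m-1}] is split into [P_{n-1,m-1}] and [F^2_{n,m-1}]: after the factor [w], the first part
     is orthogonal to [E^1_{n-1,m}], and the second projects into the range of [B], hence into
     [K2]. *)
  have [v vX uv] := orthov_sum hT (polys C n m (n%:Z - 1) (m%:Z - 1)) u.
  rewrite -[u](subrKC v) linearD dotr.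
  have [_ /orth_ip kw] := (memE1_short k).1 kE; rewrite kw ?memv_img // add0r.
  have uF : Mw (u - v) \in domB hT.
    by apply/memv_img/memF2; rewrite uv memvB // short_wshort.
  apply: (proj0 _ _ _ kE kK _ (erefl _)); apply/K2P.
  exists (opB hT (vsproj _ (Mw (u - v)))); first exact: BW.
  by rewrite vsval_compress vsprojK // id_lfunE.
- apply/subvP => _ /memv_imgP[_ /K2P[x xW ->] ->].
  apply/memE1/orth_ip => _ /memv_imgP[u uX ->].
  have /memE1_short[xP /orth_ip xw] := subvsP x.
  (* Now the splitting is into [z P_{n-1,m-1}] and [E^2_{n,m-1}]: the second part is settled by
     [A = 0] on [W], and on the first the factor [z] cancels because it is isometric. *)
  have [v vX uv] := orthov_sum hT zX' u.
  rewrite -[u](subrKC v) linearD dotr.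
  have uE : Mw (u - v) \in codA hT.
    by apply/memv_img/memE2; rewrite uv memvB // zX'_X.
  have /(congr1 vsval) := AW x xW; rewrite vsval_compress linear0 => A0.
  have := orth_proj_orth hT (codA hT) (Mz (vsval x)); rewrite A0 subr0.
  move=> /orth_ip /(_ _ uE) ->; rewrite addr0.
  move: vX => /memv_imgP[v' v'X ->]; rewrite /= Mz_Mw_comm // ip_Mz ?xw ?memv_img //.
  exact/Mw_zshort/short_zshort.
Qed.

(* [c] extends the moments of [T] to all powers of [z]. *)
Section Extension.
Variable c : int -> int -> C.
Hypothesis c_tau : forall s t : int, `|s| <= n%:Z -> `|t| <= m%:Z -> tau s t = c s t.
Hypothesis vanish : forall L f, (L == m) || (L == m.+1) ->
  (forall a b, (L <= b)%N -> co f a b = 0) ->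
  (forall s t : nat, (s < n)%N -> (t < L)%N -> pairing c f s t = 0) ->
  forall (s : int) (t : nat), s < n%:Z -> (t < L)%N -> pairing c f s t = 0.

Lemma pairing_tau f (s t : nat) : (s <= n)%N -> (t <= m)%N ->
  pairing tau f s t = pairing c f s t.
Proof.
move=> sn tm; apply: eq_bigr => i _; apply: eq_bigr => j _; congr (_ * _).
by apply: c_tau; have := ltn_ord i; have := ltn_ord j; lia.
Qed.

(** Negative [s] are essential: multiplication by [z] lowers [s] by one in the pairing. *)
Let far f := forall (s : int) (t : nat), s < n%:Z -> (0 < t <= m)%N -> pairing c f s t = 0.

Let supw : supported_on wX' (fun i j => (i < n)%N && (0 < j)%N).
Proof.
apply: (eq_supported _ (supported_img_Mw (@supported_short C n m) _)) => /=; last first.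
  by move=> i j /andP[].
move=> i j ni mj.
by case: j mj => [|j] mj /=; rewrite ?andbF // mj andbT.
Qed.

Let supwX : supported_on wX (fun i j => (0 < j)%N).
Proof.
apply: (eq_supported _ (supported_img_Mw (@supported_wshort C n m) _)) => [i j ni mj|i j] //=.
by case: j mj => [|j] mj /=.
Qed.

Let far_orth f : far f -> f \in orth hT wX'.
Proof.
move=> ff; apply/(orth_supported hT _ supw) => i j ni mj /andP[i_n j0].
by rewrite pairing_tau // ff ?ltz_nat ?j0.
Qed.

(** Both [y] and its projection are orthogonal to [w P_{n-1,m-1}], so their difference is orthogonal
    to all of [P_{n-1,m}]; [vanish] with [L = m.+1] then makes the difference far. *)
Let far_proj y : far y -> far (orth_proj hT E1' y).
Proof.
move=> fy; set x := orth_proj hT E1' y.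
have /memE1_short[xP xw] : x \in E1' by exact: orth_proj_mem.
have yx : y - x \in orth hT P'.
  apply: orth_zshort_split; first exact: orth_proj_orth.
  by rewrite memvB // far_orth.
have van : forall (s : int) (t : nat), s < n%:Z -> (t < m.+1)%N -> pairing c (y - x) s t = 0.
  apply: vanish; first by rewrite eqxx orbT.
    by move=> a b mb; rewrite co_out // negb_and -!ltnNge mb orbT.
  move=> s t sn tm; rewrite -pairing_tau ?(ltnW sn) //.
  by move/(orth_supported hT _ (@supported_zshort C n m)): yx; apply; rewrite ?(ltnW sn).
move=> s t sn /andP[t0 tm]; have := van s t sn tm.
by rewrite pairingB fy ?t0 // sub0r => /eqP; rewrite oppr_eq0 => /eqP.
Qed.

Lemma extension_iter j : (j < n)%N ->
  (opA hT \o iter j (comp_lfun (opT hT)) \1 \o opB hT = 0)%VF.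
Proof.
move=> jn; apply/lfunP => b; rewrite comp_iter_lfunE zero_lfunE.
have farB : far (vsval (opB hT b)).
  rewrite vsval_compress id_lfunE; apply: far_proj.
  have /memv_imgP[f /memF2[fX fo] ->] := subvsP b.
  have /wshortP f0 := fX; move/(orth_supported hT _ (@supported_short C n m)): fo => fo.
  (* Here [L = m]; the factor [w] afterwards turns [t < m] into [1 <= t <= m]. *)
  have van : forall (s : int) (t : nat), s < n%:Z -> (t < m)%N -> pairing c f s t = 0.
    apply: vanish; first by rewrite eqxx.
      by move=> a' b' mb; move/supported_wshort: fX; apply; rewrite -leqNgt.
    by move=> s t sn tm; rewrite -pairing_tau ?(ltnW sn) ?(ltnW tm) // fo ?(ltnW sn) ?(ltnW tm) // sn.
  move=> s t sn /andP[t0 tm]; rewrite pairing_Mw //.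
  have -> : t%:Z - 1 = t.-1%:Z by lia.
  by apply: van => //; lia.
have farT x : far (vsval x) -> far (vsval (opT hT x)).
  rewrite vsval_compress => fx; apply: far_proj => s t sn tm.
  have /memE1_short[/zshortP x0 _] := subvsP x.
  by rewrite pairing_Mz // fx //; lia.
have {farB farT} : far (vsval (iter j (opT hT) (opB hT b))).
  by elim: j {jn} => //= j IH; exact: farT.
move: (iter j _ _) => x fx; apply: val_inj.
rewrite [LHS](_ : _ = orth_proj hT (codA hT) (Mz (vsval x))); last exact: vsval_compress.
rewrite [RHS]/=.
apply: orth_proj_unique; first exact: mem0v.
have /memE1_short[/zshortP x0 _] := subvsP x.
(* The factor [z] widens the range [s < n] to [s <= n], which covers every monomial of
   [w P_{n,m-1}]. *)
have : Mz (vsval x) \in orth hT wX.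
  apply/(orth_supported hT _ supwX) => i k ni mk k0.
  by rewrite pairing_tau // pairing_Mz // fx ?k0 //; lia.
rewrite subr0 => /orth_ip zx; apply/orth_ip => _ /memv_imgP[g /memE2[gX _] ->].
exact/zx/memv_img.
Qed.

End Extension.

End SplitShift.

(** * From Bernstein-Szego to the matrix condition *)

Section BandedInverse.
Variables (R : realType) (n : nat) (p : {poly {poly R[i]}}).
Hypothesis p_neq0 : forall z w : R[i], `|z| = 1 -> `|w| <= 1 -> p.[z, w] != 0.
Variables (L : nat) (Gh : 'M[{poly R[i]}]_L) (G : R[i] -> nat -> nat -> R[i]).
Hypothesis Gh_size : forall i j, (size (Gh i j) <= (n + n).+1)%N.
Hypothesis Gh_horner : forall z, `|z| = 1 -> forall i j, (Gh i j).[z] = z ^+ n * G z i j.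
Hypothesis G_inverse : forall z, `|z| = 1 -> forall i l : 'I_L,
  \sum_(j < L) G z i j * slice_moment p z (l%:Z - j%:Z) = (i == l)%:R.

Lemma banded_inverse_moment (i l : 'I_L) (s : int) : \sum_j \sum_(k < (n + n).+1)
  (Gh i j)`_k * torus_moment p (k%:Z - n%:Z - s) (l%:Z - j%:Z) = ((s == 0) && (i == l))%:R.
Proof.
rewrite pair_big /=.
rewrite (torus_moment_sum p_neq0 (b := (i == l)%:R) (u := - s)) => [|z z1].
  by rewrite oppr_eq0 -natrM mulnb andbC.
have z0 : z != 0 by rewrite -normr_eq0 z1 oner_eq0.
transitivity (\sum_j \sum_(k < (n + n).+1)
    (Gh i j)`_k * z ^ (k%:Z - n%:Z - s) * slice_moment p z (l%:Z - j%:Z)).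
  by rewrite pair_big.
rewrite -(G_inverse z1) mulr_suml; apply: eq_bigr => j _.
transitivity (z ^ (- n%:Z - s) * (Gh i j).[z] * slice_moment p z (l%:Z - j%:Z)).
  rewrite (horner_coef_wide _ (Gh_size i j)) mulr_sumr mulr_suml; apply: eq_bigr => k _.
  rewrite -addrA (expfzDr k%:Z) // -exprnP.
  by move: (z ^ (- n%:Z - s)) (z ^+ k) => e1 e2; ring.
move: (slice_moment _ _ _) => S; rewrite Gh_horner // mulrA (exprnP z n) -expfzDr //.
rewrite addrAC addNr add0r.
by move: (z ^ (- s)) => e; ring.
Qed.

(** On the circle [Gh(z)] times the Toeplitz matrix of the slice is [z^n] times the identity. *)
Lemma banded_det_neq0 (z : R[i]) : `|z| = 1 -> (\det Gh).[z] != 0.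
Proof.
move=> z1; have z0 : z != 0 by rewrite -normr_eq0 z1 oner_eq0.
rewrite -horner_evalE -det_map_mx.
pose S : 'M[R[i]]_L := \matrix_(j, l) slice_moment p z (l%:Z - j%:Z).
have E : map_mx (horner_eval z) Gh *m S = (z ^+ n)%:M.
  apply/matrixP => i l; rewrite !mxE -mulr_natr -(G_inverse z1) mulr_sumr.
  by apply: eq_bigr => j _; rewrite !mxE /horner_eval Gh_horner // mulrA.
have /(congr1 determinant) := E; rewrite det_mulmx det_scalar => Ed.
apply: contra_neq z0 => d0; move: Ed; rewrite d0 mul0r => /esym/eqP.
by rewrite !expf_eq0 => /andP[_ /andP[_ /eqP]].
Qed.

End BandedInverse.

Section BernsteinSzegoToMatrix.
Variables (R : realType) (n m : nat).
Variables (T : {scalar laurent R[i] n m}) (hT : positive_form T).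

Lemma pairing_nondegenerate c L (g : bipoly R[i] n m) :
  (forall s t : int, `|s| <= n%:Z -> `|t| <= m%:Z -> form_moment T s t = c s t) ->
  (forall i j, ~~ ((i < n)%N && (j < L)%N) -> co g i j = 0) ->
  (forall s t : nat, (s < n)%N -> (t < L)%N -> pairing c g s t = 0) -> g = 0.
Proof.
move=> c_tau gs g0; apply: (dot_eq0 (ip_gt0 hT)); rewrite ip_pairing /toeplitz_form.
rewrite big1 // => k _; rewrite big1 // => l _.
have [/andP[kn lL]|/gs ->] := boolP ((k < n)%N && (l < L)%N); last by rewrite conjC0 mul0r.
by rewrite (pairing_tau c_tau) ?leq_ord // g0 ?mulr0.
Qed.

Section Coefficients.
Variable p : {poly {poly R[i]}}.
Hypothesis p_size : (size p <= n.+1)%N.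

Let P t : {poly R[i]} := \poly_(i < n.+1) p`_i`_t.
(** Conjugation is not polynomial in [z], but on the circle [z^n * conj(P t)] is, and this is that
    polynomial. It makes the Gohberg-Semencul entries polynomials of degree at most [2n]. *)
Let Q t : {poly R[i]} := \poly_(i < n.+1) (p`_(n - i)`_t)^*.

Lemma coef_evalC (z : R[i]) t : (p.[z%:P])`_t = (P t).[z].
Proof.
rewrite (horner_coef_wide _ p_size) coef_sum horner_poly; apply: eq_bigr => i _.
by rewrite -polyC_exp coefMC.
Qed.

Lemma horner_reverse (z : R[i]) t : `|z| = 1 -> (Q t).[z] = z ^+ n * ((P t).[z])^*.
Proof.
move=> z1; rewrite !horner_poly rmorph_sum mulr_sumr (reindex_inj rev_ord_inj) /=.
apply: eq_bigr => i _; rewrite subSS subKn ?leq_ord // (rmorphM Num.conj) mulrCA; congr (_ * _).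
rewrite (rmorphXn Num.conj) /=; have -> : z ^+ n = z ^+ (n - i) * z ^+ i.
  by rewrite -exprD subnK ?leq_ord.
have -> : z^* = z^-1 by rewrite invC_norm z1 expr1n invr1 mul1r.
by rewrite exprVn -mulrA mulfV ?mulr1 // expf_neq0 // -normr_eq0 z1 oner_eq0.
Qed.

Lemma gs_size i j : (size (gs_inner m P Q i j) <= (n + n).+1)%N /\
  (size (gs_outer m P Q i j) <= (n + n).+1)%N.
Proof.
have PQ a b : (size (P a * Q b)%R <= (n + n).+1)%N.
  apply: leq_trans (size_polyMleq _ _) _.
  have sP : (size (P a) <= n.+1)%N := size_poly _ _.
  have sQ : (size (Q b) <= n.+1)%N := size_poly _ _.
  by move: sP sQ; lia.
have inner a b : (size (gs_inner m P Q a b) <= (n + n).+1)%N.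
  apply: leq_trans (size_sum _ _ _) _; apply/bigmax_leqP => l _.
  by rewrite (leq_trans (size_polyD _ _)) // geq_max size_polyN [Q _ * _]mulrC !PQ.
split=> //; apply: leq_trans (size_polyD _ _) _; rewrite geq_max PQ andbT.
by case: ifP; rewrite ?size_poly0.
Qed.

Let Pz (z : R[i]) t := (P t).[z].
Let Pzc (z : R[i]) t := ((P t).[z])^*.

Lemma horner_gs_inner (z : R[i]) i j : `|z| = 1 ->
  (gs_inner m P Q i j).[z] = z ^+ n * gs_inner m (Pz z) (Pzc z) i j.
Proof.
move=> z1; rewrite horner_sum mulr_sumr; apply: eq_bigr => l _.
by rewrite hornerD hornerN !hornerM !horner_reverse // /Pz /Pzc; ring.
Qed.

Lemma horner_gs_outer (z : R[i]) i j : `|z| = 1 ->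
  (gs_outer m P Q i j).[z] = z ^+ n * gs_outer m (Pz z) (Pzc z) i j.
Proof.
move=> z1; rewrite hornerD hornerM horner_reverse // mulrDr mulrCA; congr (_ + _).
by case: ifP => _; rewrite ?horner_gs_inner // horner0 mulr0.
Qed.

Hypothesis p_sizeY : (sizeY p <= m.+1)%N.
Hypothesis p_neq0 : forall z w : R[i], `|z| = 1 -> `|w| <= 1 -> p.[z, w] != 0.

Lemma gs_slice_inverse (z : R[i]) : `|z| = 1 ->
  (forall i l, (i <= m)%N -> (l <= m)%N ->
     \sum_(j < m.+1) gs_outer m (Pz z) (Pzc z) i j * slice_moment p z (l%:Z - j%:Z) = (i == l)%:R) /\
  (forall i l, (i < m)%N -> (l < m)%N ->
     \sum_(j < m) gs_inner m (Pz z) (Pzc z) i j * slice_moment p z (l%:Z - j%:Z) = (i == l)%:R).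
Proof.
move=> z1; have sz : (size p.[z%:P]%R <= m.+1)%N := leq_trans (max_size_evalC _ _) p_sizeY.
apply: (gohberg_semencul_inverse (p := Pz z)).
- rewrite /Pz -coef_evalC -horner_coef0; apply: p_neq0 => //; by rewrite normr0.
- move=> l _; rewrite /Pz -coef_evalC -(slice_moment_orth p_neq0 _ z1 sz).
  by apply: eq_bigr => j _; rewrite -coef_evalC.
- move=> l _; rewrite /Pz -coef_evalC -(slice_moment_orth_conj p_neq0 _ z1 sz).
  by apply: eq_bigr => j _; rewrite -coef_evalC.
- by [].
- by move=> i j im jm; rewrite gs_outer_upper // /Pzc.
Qed.

(** The banded inverse is [gs_inner] for [L = m] and [gs_outer] for [L = m.+1]. The first size
    serves the range of [B], the second the projections to [E^1_{n-1,m}]. *)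
Lemma bernstein_szego_vanish L (f : bipoly R[i] n m) : (L == m) || (L == m.+1) ->
  (forall s t : int, `|s| <= n%:Z -> `|t| <= m%:Z -> form_moment T s t = torus_moment p s t) ->
  (forall a b, (L <= b)%N -> co f a b = 0) ->
  (forall s t : nat, (s < n)%N -> (t < L)%N -> pairing (torus_moment p) f s t = 0) ->
  forall (s : int) (t : nat), s < n%:Z -> (t < L)%N -> pairing (torus_moment p) f s t = 0.
Proof.
move=> Lm c_tau; have [K cK] := torus_moment_bounded p_neq0.
have bdd : exists K : R[i], forall s t, `|torus_moment p s t| <= K by exists K.
have nd L' g := @pairing_nondegenerate _ L' g c_tau.
case/orP: Lm => /eqP ->.
  pose Gh : 'M[{poly R[i]}]_m := \matrix_(i, j) gs_inner m P Q i j.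
  have Ghs i j : (size (Gh i j) <= (n + n).+1)%N by rewrite mxE; have [] := gs_size i j.
  have Ghz z : `|z| = 1 -> forall i j, (Gh i j).[z] = z ^+ n * gs_inner m (Pz z) (Pzc z) i j.
    by move=> z1 i j; rewrite mxE horner_gs_inner.
  have Yinv z : `|z| = 1 -> forall i l : 'I_m, \sum_(j < m) gs_inner m (Pz z) (Pzc z) i j *
      slice_moment p z (l%:Z - j%:Z) = (i == l)%:R.
    by move=> z1 i l; rewrite (gs_slice_inverse z1).2.
  pose G z := gs_inner m (Pz z) (Pzc z).
  exact: (pairing_vanish (leqnSn m) bdd Ghs
    (banded_inverse_moment (G := G) p_neq0 Ghs Ghz Yinv)
    (banded_det_neq0 (G := G) Ghz Yinv) (nd m)).
pose Gh : 'M[{poly R[i]}]_m.+1 := \matrix_(i, j) gs_outer m P Q i j.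
have Ghs i j : (size (Gh i j) <= (n + n).+1)%N by rewrite mxE; have [] := gs_size i j.
have Ghz z : `|z| = 1 -> forall i j, (Gh i j).[z] = z ^+ n * gs_outer m (Pz z) (Pzc z) i j.
  by move=> z1 i j; rewrite mxE horner_gs_outer.
have Yinv z : `|z| = 1 -> forall i l : 'I_m.+1, \sum_(j < m.+1) gs_outer m (Pz z) (Pzc z) i j *
    slice_moment p z (l%:Z - j%:Z) = (i == l)%:R.
  by move=> z1 i l; rewrite (gs_slice_inverse z1).1 ?leq_ord.
pose G z := gs_outer m (Pz z) (Pzc z).
exact: (pairing_vanish (leqnn m.+1) bdd Ghs
  (banded_inverse_moment (G := G) p_neq0 Ghs Ghz Yinv)
  (banded_det_neq0 (G := G) Ghz Yinv) (nd m.+1)).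
Qed.

End Coefficients.

Lemma bernstein_szego_matrix : bernstein_szego T -> forall j, (j < n)%N ->
  (opA hT \o iter j (comp_lfun (opT hT)) \1 \o opB hT = 0)%VF.
Proof.
move=> [p [[p_size p_sizeY] p_neq0 pT]] j jn.
apply: (@extension_iter _ _ _ _ hT (torus_moment p)) => //.
by move=> L f Lm; apply: bernstein_szego_vanish.
Qed.

End BernsteinSzegoToMatrix.

(** * Reversal and kernels *)

Section Reversal.
Variables (C : numClosedFieldType) (n m : nat).
Notation H := (bipoly C n m).
Implicit Types (f g : H) (z : C).

(** This is [z^n w^m \bar f(1/z, 1/w)], an antilinear map that swaps the arguments of any Toeplitz
    form. *)
Definition reversal f : H := \matrix_(i, j) (f (rev_ord i) (rev_ord j))^*.

Lemma co_reversal f i j : (i <= n)%N -> (j <= m)%N ->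
  co (reversal f) i j = (co f (n - i) (m - j))^*.
Proof.
move=> ni mj; rewrite /co ni mj !leq_subr mxE; congr (_^*).
by congr (f _ _); apply/val_inj; rewrite /= !inordK ?ltnS ?leq_subr // subSS.
Qed.

Lemma reversalK f : reversal (reversal f) = f.
Proof. by apply/matrixP => i j; rewrite !mxE !rev_ordK conjCK. Qed.

Lemma toeplitz_reversal tau f g :
  toeplitz_form tau (reversal f) (reversal g) = toeplitz_form tau g f.
Proof.
have E : toeplitz_form tau (reversal f) (reversal g) =
    \sum_(k < n.+1) \sum_(l < m.+1) \sum_(i < n.+1) \sum_(j < m.+1)
      co g k l * (co f i j)^* * tau (k%:Z - i%:Z) (l%:Z - j%:Z).
  rewrite /toeplitz_form (reindex_inj rev_ord_inj); apply: eq_bigr => k _.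
  rewrite (reindex_inj rev_ord_inj); apply: eq_bigr => l _.
  rewrite mulr_sumr (reindex_inj rev_ord_inj); apply: eq_bigr => i _.
  rewrite mulr_sumr (reindex_inj rev_ord_inj); apply: eq_bigr => j _.
  rewrite /= !subSS !co_reversal ?leq_subr // !subKn ?leq_ord // conjCK mulrA.
  congr (_ * tau _ _).
    by have := leq_ord k; have := leq_ord i; lia.
  by have := leq_ord l; have := leq_ord j; lia.
rewrite E /toeplitz_form.
under [RHS]eq_bigr => i _.
  under eq_bigr => j _.
    rewrite mulr_sumr; under eq_bigr => k _ do rewrite mulr_sumr.
    over.
  rewrite exchange_big /=; under eq_bigr => k _ do rewrite exchange_big /=.
  over.
rewrite [RHS]exchange_big; apply: eq_bigr => k _ /=.
rewrite [RHS]exchange_big; apply: eq_bigr => l _ /=.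
apply: eq_bigr => i _; apply: eq_bigr => j _.
by rewrite mulrA [(co f i j)^* * _]mulrC.
Qed.

Definition wcoef f z (t : nat) : C := \sum_(i < n.+1) co f i t * z ^+ i.

Lemma wcoef_linear z t a f g :
  wcoef (a *: f + g) z t = a * wcoef f z t + wcoef g z t.
Proof.
rewrite mulr_sumr -big_split; apply: eq_bigr => i _ /=.
by rewrite coD coZ mulrDl mulrA.
Qed.

Lemma wcoef_Mz f z t : (forall j, co f n j = 0) -> wcoef (Mz C n m f) z t = z * wcoef f z t.
Proof.
move=> f0; rewrite /wcoef big_ord_recl co_Mz /= mul0r add0r.
rewrite [in RHS]big_ord_recr /= f0 mul0r addr0 mulr_sumr; apply: eq_bigr => i _.
by rewrite co_Mz /= ltn_ord exprS mulrCA.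
Qed.

Lemma wcoef_Mw f z t : (t <= m)%N ->
  wcoef (Mw C n m f) z t = if (0 < t)%N then wcoef f z t.-1 else 0.
Proof.
move=> tm; rewrite /wcoef; case: ifP => t0.
  by apply: eq_bigr => i _; rewrite co_Mw t0 tm.
by rewrite big1 // => i _; rewrite co_Mw t0 mul0r.
Qed.

Lemma wcoef_reversal f z t : `|z| = 1 -> (t <= m)%N ->
  wcoef (reversal f) z t = z ^+ n * (wcoef f z (m - t))^*.
Proof.
move=> z1 tm; have z0 : z != 0 by rewrite -normr_eq0 z1 oner_eq0.
rewrite /wcoef rmorph_sum mulr_sumr (reindex_inj rev_ord_inj); apply: eq_bigr => i _ /=.
rewrite subSS co_reversal ?leq_subr // subKn ?leq_ord // (rmorphM Num.conj) mulrCA.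
congr (_ * _); rewrite (rmorphXn Num.conj) /=.
have -> : z ^+ n = z ^+ (n - i) * z ^+ i by rewrite -exprD subnK ?leq_ord.
have -> : z^* = z^-1 by rewrite invC_norm z1 expr1n invr1 mul1r.
by rewrite exprVn -mulrA mulfV ?mulr1 // expf_neq0.
Qed.

Definition wkernel (e : seq H) z (t t' : nat) : C :=
  \sum_(f <- e) wcoef f z t * (wcoef f z t')^*.

Lemma wkernel_cat e1 e2 z t t' :
  wkernel (e1 ++ e2) z t t' = wkernel e1 z t t' + wkernel e2 z t t'.
Proof. exact: big_cat. Qed.

(** The reason for restricting kernels to equal [z] on the circle: there the two factors multiply to
    [z * conj z = 1]. *)
Lemma wkernel_Mz e z t t' : `|z| = 1 -> {in e, forall f j, co f n j = 0} ->
  wkernel (map (Mz C n m) e) z t t' = wkernel e z t t'.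
Proof.
move=> z1 e0; rewrite /wkernel big_map big_seq [RHS]big_seq; apply: eq_bigr => f fe.
have f0 := e0 f fe.
by rewrite !(wcoef_Mz _ _ f0) (rmorphM Num.conj) /= mulrACA -normCK z1 expr1n mul1r.
Qed.

Lemma wkernel_Mw e z t t' : (t <= m)%N -> (t' <= m)%N ->
  wkernel (map (Mw C n m) e) z t t' =
  if (0 < t)%N && (0 < t')%N then wkernel e z t.-1 t'.-1 else 0.
Proof.
move=> tm t'm; rewrite /wkernel big_map; case: ifP => [/andP[t0 t'0]|/negbT].
  by apply: eq_bigr => f _; rewrite !wcoef_Mw // t0 t'0.
rewrite negb_and => /orP[/negbTE h|/negbTE h]; rewrite big1 // => f _.
  by rewrite wcoef_Mw // h mul0r.
by rewrite [X in _ * X^*]wcoef_Mw // h conjC0 mulr0.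
Qed.

Lemma wkernel_reversal e z t t' : `|z| = 1 -> (t <= m)%N -> (t' <= m)%N ->
  wkernel (map reversal e) z t t' = (wkernel e z (m - t) (m - t'))^*.
Proof.
move=> z1 tm t'm; rewrite /wkernel big_map rmorph_sum; apply: eq_bigr => f _ /=.
rewrite !wcoef_reversal // !(rmorphM Num.conj) /= mulrACA -normCK normrX z1 !expr1n mul1r.
by rewrite conjCK.
Qed.

End Reversal.

Section SplitShiftBases.
Variables (C : numClosedFieldType) (n m : nat).
Notation H := (bipoly C n m).
Variables (T : {scalar laurent C n m}) (hT : positive_form T).
Implicit Types (f g : H).
Notation Mz := (Mz C n m).
Notation Mw := (Mw C n m).
Notation X := (polys C n m n (m%:Z - 1)).
Notation X' := (polys C n m (n%:Z - 1) (m%:Z - 1)).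
Notation P' := (polys C n m (n%:Z - 1) m).
Notation dot := (ip hT).
Notation ortho := (orthonormal (ip hT)).
Let lin := ip_linear hT.
Let cnj := ip_conj hT.
Let pos := ip_gt0 hT.

Lemma orthonormal_map_conj (h : H -> H) e :
  {in e &, forall x y, dot (h x) (h y) = dot y x} -> ortho e -> ortho (map h e).
Proof.
elim: e => //= x e IH hE [xx xs oe]; split.
- by rewrite hE ?mem_head.
- by move=> _ /mapP[y ye ->]; rewrite hE ?mem_head ?inE ?ye ?orbT // cnj xs // conjC0.
- by apply: IH => // y z ye ze; apply: hE; rewrite inE ?ye ?ze orbT.
Qed.

Lemma ip_reversal f g : dot (reversal f) (reversal g) = dot g f.
Proof. by rewrite !ip_pairing toeplitz_reversal. Qed.

Lemma orth_span (e : seq H) f : (forall x, x \in e -> dot f x = 0) -> f \in orth hT <<e>>%VS.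
Proof.
move=> fe; apply/orth_ip => g /(coord_span (X := in_tuple e)) ->.
rewrite (dot_sumr lin cnj) big1 // => i _.
by rewrite (dotZr lin cnj) fe ?mulr0 // mem_nth.
Qed.

Lemma reversal_short f : f \in P' -> reversal (Mz f) \in P'.
Proof.
move=> _; apply/zshortP => j; have [mj|jm] := leqP j m; last first.
  by rewrite co_out // negb_and -!ltnNge jm orbT.
by rewrite co_reversal // subnn co_Mz conjC0.
Qed.

(** [z f] has [z]-exponents in [1..n] and [w]-exponents in [0..m-1]; reversal turns these ranges
    into [0..n-1] and [1..m]. *)
Lemma reversal_Mz_short f : f \in X' -> reversal (Mz f) \in (Mw @: X')%VS.
Proof.
move=> /shortP[_ f0]; apply/(supported_img_Mw (@supported_short C n m)) => [i j|i j].
  by case/andP.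
have [/andP[ni mj]|] := boolP ((i <= n)%N && (j <= m)%N); last by move/co_out.
rewrite co_reversal // co_Mz => h; case: ifP => [/andP[i_n _]|]; last by rewrite conjC0.
have j0 : j = 0%N by case: j mj h => // j mj; rewrite subn_gt0 in i_n; rewrite i_n /= mj.
by rewrite j0 subn0 f0 conjC0.
Qed.

Lemma orth_Mz_reversal f g : g \in orth hT P' -> f \in P' -> dot (reversal g) (Mz f) = 0.
Proof.
move=> /orth_ip gP fP; rewrite -[Mz f]reversalK ip_reversal cnj gP ?conjC0 //.
exact: reversal_short.
Qed.

Lemma extend_full e : ortho e -> exists e', ortho (e ++ e') /\ (size (e ++ e') = n.+1 * m.+1)%N.
Proof.
move=> oe; have [|e' [oee _ se]] := orthonormal_extend lin cnj pos oe (U := fullv).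
  by move=> x _; exact: memvf.
by exists e'; rewrite se dimvf.
Qed.

Lemma full_expansion e u : ortho e -> (size e = n.+1 * m.+1)%N ->
  u = \sum_(x <- e) dot u x *: x.
Proof.
move=> oe se; apply: (orthonormal_expansion lin cnj oe).
rewrite (orthonormal_basis lin cnj (U := fullv) oe) ?memvf // ?se ?dimvf //.
by move=> x _; exact: memvf.
Qed.

Lemma wkernel_full e1 e2 z t t' : ortho e1 -> (size e1 = n.+1 * m.+1)%N ->
  ortho e2 -> (size e2 = n.+1 * m.+1)%N -> wkernel e1 z t t' = wkernel e2 z t t'.
Proof.
move=> oe1 se1 oe2 se2.
apply: (orthonormal_kernel (dot := dot) (U := fullv) lin cnj) => //.
- by move=> a x y; exact: wcoef_linear.
- by move=> a x y; exact: wcoef_linear.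
- by move=> x _; exact: memvf.
- by rewrite se1 dimvf.
- by move=> x _; exact: memvf.
- by rewrite se2 dimvf.
Qed.

(* [z P' (+) R F = P_{n,m} = P' (+) F], where [F] spans the orthocomplement of
   [P'] and [R] is the reversal. *)
Lemma orthonormal_reversed_basis e F : ortho (e ++ F) -> {subset e <= P'} ->
  {subset F <= orth hT P'} -> ortho (map Mz e ++ map (@reversal C n m) F).
Proof.
move=> oeF eP FP; have [oe oF eF] := (orthonormal_cat _ _ _).1 oeF.
apply/orthonormal_cat; split.
- by apply: orthonormal_map => // x y xe ye; rewrite ip_Mz ?eP.
- by apply: orthonormal_map_conj => // x y _ _; exact: ip_reversal.
- move=> _ _ /mapP[x xe ->] /mapP[f fF ->].
  by rewrite cnj orth_Mz_reversal ?conjC0 ?eP ?FP.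
Qed.

(* On the circle the kernels of [z P'] and [P'] cancel. *)
Lemma wkernel_persymmetric e F z t t' : ortho (e ++ F) -> {subset e <= P'} ->
  (size (e ++ F) = n.+1 * m.+1)%N -> {subset F <= orth hT P'} ->
  `|z| = 1 -> (t <= m)%N -> (t' <= m)%N ->
  wkernel F z t t' = (wkernel F z (m - t) (m - t'))^*.
Proof.
move=> oeF eP se FP z1 tm t'm; have oe2 := orthonormal_reversed_basis oeF eP FP.
have := wkernel_full z t t' oeF se oe2; rewrite !wkernel_cat size_cat !size_map -size_cat.
move=> /(_ se); rewrite wkernel_Mz //; last by move=> f /eP/zshortP.
by rewrite wkernel_reversal // => /addrI.
Qed.

(** The argument of [wkernel_persymmetric] in degree [(n, m - 1)]. The reversal of that degree is
    [reversal] after [Mw], and [(m - t).-1] is the reversed index. *)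
Lemma wkernel_persymmetric_short e F z t t' : ortho (e ++ F) -> {subset e <= X'} ->
  {subset F <= X} -> size (e ++ F) = \dim X -> {subset F <= orth hT X'} ->
  `|z| = 1 -> (t < m)%N -> (t' < m)%N ->
  wkernel F z t t' = (wkernel F z (m - t).-1 (m - t').-1)^*.
Proof.
move=> oeF eX FX se FoX z1 tm t'm; have [oe oF eF] := (orthonormal_cat _ _ _).1 oeF.
pose h f := reversal (Mw f).
have oe2 : ortho (map Mz e ++ map h F).
  apply/orthonormal_cat; split.
  - by apply: orthonormal_map => // x y xe ye; rewrite ip_Mz ?short_zshort ?eX.
  - apply: orthonormal_map_conj => // x y xF yF.
    by rewrite ip_reversal ip_Mw ?FX.
  - move=> _ _ /mapP[x xe ->] /mapP[f fF ->]; rewrite -[Mz x]reversalK ip_reversal.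
    have /memv_imgP[b bX ->] := reversal_Mz_short (eX x xe).
    have /orth_ip fo : f \in orth hT X' := FoX f fF.
    by rewrite ip_Mw; [exact: fo|exact: FX|exact: short_wshort].
have e2X : {subset map Mz e ++ map h F <= X}.
  move=> x; rewrite mem_cat => /orP[/mapP[u ue ->]|/mapP[u uF ->]].
    by apply/Mz_wshort/short_wshort/eX.
  apply/wshortP => i; have [ni|i_n] := leqP i n; last by rewrite co_out // negb_and -ltnNge i_n.
  by rewrite co_reversal // subnn co_Mw conjC0.
have eFX : {subset e ++ F <= X}.
  by move=> x; rewrite mem_cat => /orP[/eX/short_wshort|/FX].
have := orthonormal_kernel (dot := dot) lin cnj (wcoef_linear z t) (wcoef_linear z t')
  oeF eFX se oe2 e2X.
rewrite size_cat !size_map -size_cat => /(_ se); rewrite -!/(wkernel _ z t t') !wkernel_cat.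
rewrite wkernel_Mz //; last by move=> f /eX/shortP[].
rewrite (map_comp (@reversal C n m) Mw) wkernel_reversal ?(ltnW tm) ?(ltnW t'm) //.
rewrite wkernel_Mw ?leq_subr // !subn_gt0 tm t'm => /addrI //.
Qed.

End SplitShiftBases.

Section SplitShiftKernels.
Variables (C : numClosedFieldType) (n m : nat).
Notation H := (bipoly C n m).
Variables (T : {scalar laurent C n m}) (hT : positive_form T).
Implicit Types (f g : H).
Notation Mz := (Mz C n m).
Notation Mw := (Mw C n m).
Notation X := (polys C n m n (m%:Z - 1)).
Notation X' := (polys C n m (n%:Z - 1) (m%:Z - 1)).
Notation P' := (polys C n m (n%:Z - 1) m).
Notation dot := (ip hT).
Notation ortho := (orthonormal (ip hT)).
Let lin := ip_linear hT.
Let cnj := ip_conj hT.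
Let pos := ip_gt0 hT.

Lemma split_shift_kernels : split_shift_orthogonality hT ->
  exists (e F F' : seq H) (p : H),
  [/\ ortho (e ++ F), {subset e <= P'}, size e = (n * m.+1)%N, size F = m.+1 &
    forall z : C, `|z| = 1 -> forall t t', (t <= m)%N -> (t' <= m)%N ->
      wkernel F z t t' = (if (0 < t)%N && (0 < t')%N then wkernel F' z t.-1 t'.-1 else 0)
        + wcoef p z t * (wcoef p z t')^* /\
      wkernel F z t t' = (if (t < m)%N && (t' < m)%N then wkernel F' z t t' else 0)
        + (wcoef p z (m - t))^* * wcoef p z (m - t')].
Proof.
move=> [K1 [K2 [[K12 EK] K1zK2 K1E zK2E]]].
have basis (U : {vspace H}) : exists e, [/\ ortho e, {subset e <= U} & size e = \dim U].
  by have [||e [? ? ?]] := orthonormal_extend lin cnj pos (U := U) (e := [::]) => //; exists e.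
have [eX' [oX' eX'X sX']] := basis X'.
have [k1 [ok1 k1K sk1]] := basis K1.
have [k2 [ok2 k2K sk2]] := basis K2.
have eX'wX x : x \in eX' -> x \in X by move=> /eX'X/short_wshort.
have [F' [oXF' F'X sXF']] := orthonormal_extend lin cnj pos oX' eX'wX.
have [_ oF' XF'] := (orthonormal_cat _ _ _).1 oXF'.
have spX' := orthonormal_basis lin cnj oX' eX'X sX'.
have F'o : {subset F' <= orth hT X'}.
  move=> f fF; rewrite -spX'; apply: orth_span => x xe.
  by rewrite cnj XF' ?conjC0.
have K1E' x : x \in K1 -> x \in E1 hT (n%:Z - 1) m.
  by move=> xK; rewrite EK -[x]addr0 memv_add ?mem0v.
have K2E' x : x \in K2 -> x \in E1 hT (n%:Z - 1) m.
  by move=> xK; rewrite EK -[x]add0r memv_add ?mem0v.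
have ow : ortho (map Mw eX').
  by apply: orthonormal_map oX' => x y xe ye; rewrite ip_Mw ?eX'wX.
have dw x f : x \in map Mw eX' -> f \in orth hT (Mw @: X')%VS -> dot x f = 0.
  by move=> /mapP[u ue ->] /orth_ip fo; rewrite cnj fo ?conjC0 // memv_img ?eX'X.
have ok12 : ortho (k1 ++ k2).
  apply/orthonormal_cat; split=> // x y xk yk.
  by move/subvP: K12 => /(_ x (k1K x xk))/orth_ip; apply; exact: k2K.
pose e := map Mw eX' ++ (k1 ++ k2).
have kE x : x \in k1 ++ k2 -> x \in E1 hT (n%:Z - 1) m.
  by rewrite mem_cat => /orP[/k1K/K1E'|/k2K/K2E'].
have oe : ortho e.
  apply/orthonormal_cat; split=> // x y xe yk; apply: dw => //.
  by have /memE1_short[] := kE y yk.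
have eP : {subset e <= P'}.
  move=> x; rewrite mem_cat => /orP[/mapP[u ue ->]|/kE/memE1_short[] //].
  exact/Mw_zshort/short_zshort/eX'X.
(* [k1 ++ k2] spans [E^1_{n-1,m}], so another unit vector of [P_{n-1,m}] orthogonal to [e] would lie
   in that span and be orthogonal to it. *)
have se : size e = (n * m.+1)%N.
  have [e2 [oe2 e2P se2]] := orthonormal_extend lin cnj pos oe eP.
  case: e2 oe2 e2P se2 => [|x e2] oe2 e2P se2; first by rewrite -(dim_zshort C n m) -se2 cats0.
  have [_ /= [xx _ _] ex] := (orthonormal_cat _ _ _).1 oe2.
  have dx y : y \in e -> dot x y = 0.
    by move=> ye; rewrite cnj ex ?conjC0 ?mem_head.
  have xE : x \in E1 hT (n%:Z - 1) m.
    apply/memE1_short; split; first by rewrite e2P ?mem_head.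
    apply/orth_ip => _ /memv_imgP[u uX ->]; rewrite -spX' in uX.
    have : Mw u \in <<map Mw eX'>>%VS by rewrite -limg_span memv_img.
    have : x \in orth hT <<map Mw eX'>>%VS.
      by apply: orth_span => y ye; apply: dx; rewrite mem_cat ye.
    by move=> /orth_ip; apply.
  have sk k (K : {vspace H}) : ortho k -> {subset k <= K} -> size k = \dim K -> <<k>>%VS = K.
    exact: orthonormal_basis.
  have xK : x \in <<k1 ++ k2>>%VS.
    by rewrite span_cat (sk k1 K1) // (sk k2 K2) // -EK.
  have : x \in orth hT <<k1 ++ k2>>%VS.
    by apply: orth_span => y yk; apply: dx; rewrite mem_cat yk orbT.
  by move=> /(orth_cap xK) x0; move: xx; rewrite x0 (dot0l lin) => /eqP; rewrite eq_sym oner_eq0.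
have sF' : size F' = m.
  have : (size eX' + size F' = n.+1 * m)%N by rewrite -size_cat sXF' dim_wshort.
  by rewrite sX' dim_short mulSn; lia.
have [F [oeF seF]] := extend_full oe.
have sF : size F = m.+1 by move: seF; rewrite size_cat se mulSn; lia.
(* Compared with [e], the block [K2] is moved to [z K2] and [w F'] is added. The three split-shift
   conditions are what makes these pieces orthogonal. *)
pose l := map Mw eX' ++ (k1 ++ (map Mw F' ++ map Mz k2)).
have zk2 x : x \in map Mz k2 -> x \in orth hT (Mw @: X)%VS.
  by move=> /mapP[u uk ->]; apply/memE1/(subvP zK2E)/memv_img/k2K.
have k1w x : x \in k1 -> x \in orth hT (Mw @: X)%VS.
  by move=> /k1K xk; apply/memE1/(subvP K1E).
have wF' x : x \in map Mw F' -> x \in (Mw @: X)%VS.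
  by move=> /mapP[u uF ->]; apply/memv_img/F'X.
have wwX x : x \in map Mw eX' -> x \in (Mw @: X)%VS.
  by move=> /mapP[u uF ->]; apply/memv_img/eX'wX.
have swap x y (U : {vspace H}) : x \in U -> y \in orth hT U -> dot x y = 0.
  by move=> xU /orth_ip yU; rewrite cnj yU ?conjC0.
have ol : ortho l.
  apply/orthonormal_cat; split=> //; last first.
    move=> x y xe; rewrite !mem_cat => /or3P[yk|/mapP[f fF ->]|/zk2 yz].
    - by apply: swap (wwX _ xe) (k1w _ yk).
    - by move/mapP: xe => [u ue ->]; rewrite ip_Mw; [exact: XF'|exact: eX'wX|exact: F'X].
    - by apply: swap (wwX _ xe) yz.
  apply/orthonormal_cat; split=> //; last first.
    move=> x y xk; rewrite mem_cat => /orP[/wF' yw|/mapP[u uk ->]].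
      by move/orth_ip: (k1w x xk); apply.
    by move/subvP: K1zK2 => /(_ x (k1K x xk))/orth_ip; apply; rewrite memv_img ?k2K.
  apply/orthonormal_cat; split.
  - by apply: orthonormal_map oF' => x y xe ye; rewrite ip_Mw ?F'X.
  - apply: orthonormal_map ok2 => x y xe ye; rewrite ip_Mz //.
      by have /memE1_short[] := K2E' x (k2K x xe).
    by have /memE1_short[] := K2E' y (k2K y ye).
  - by move=> x y /wF' xw /zk2 yz; exact: swap xw yz.
have [q [olq slq]] := extend_full ol.
have {slq olq}[p [olq slq]] : exists p, ortho (l ++ [:: p]) /\ (size (l ++ [:: p]) = n.+1 * m.+1)%N.
  (* [l] has [n (m + 1) + m] members, one less than the dimension of [P_{n,m}]. *)
  have sq : size q = 1%N.
    have sl : size l = (size e + size F')%N.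
      rewrite /l /e !size_cat !size_map -!addnA; congr (_ + (_ + _))%N.
      by rewrite addnC.
    by move: slq; rewrite size_cat sl se sF' mulSn; lia.
  by case: q sq olq slq => [|p []] // _ ? ?; exists p.
exists e, F, F', p; split=> // z z1.
(* In [e ++ F] and [l ++ [:: p]] the blocks [w P_{n-1,m-1}] and [K1] are common, and [K2] and [z K2]
   have equal kernels on the circle. *)
have low t t' : (t <= m)%N -> (t' <= m)%N ->
    wkernel F z t t' = (if (0 < t)%N && (0 < t')%N then wkernel F' z t.-1 t'.-1 else 0)
        + wcoef p z t * (wcoef p z t')^*.
  move=> tm t'm; have := wkernel_full z t t' oeF seF olq slq.
  rewrite /e /l !wkernel_cat -!addrA => /addrI/addrI.
  rewrite wkernel_Mz //; last by move=> f /k2K/K2E'/memE1_short[/zshortP].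
  rewrite wkernel_Mw // addrCA => /addrI ->; congr (_ + _).
  by rewrite /wkernel big_seq1.
move=> t t' tm t'm; split; first exact: low.
have FP : {subset F <= orth hT P'}.
  have [_ _ eF] := (orthonormal_cat _ _ _).1 oeF.
  have -> : P' = <<e>>%VS.
    by apply/esym/(orthonormal_basis lin cnj oe eP); rewrite dim_zshort.
  by move=> f fF; apply: orth_span => x xe; rewrite cnj eF ?conjC0.
rewrite (wkernel_persymmetric oeF eP seF FP z1 tm t'm).
rewrite low ?leq_subr // (rmorphD Num.conj) (rmorphM Num.conj) /= conjCK; congr (_ + _).
rewrite !subn_gt0; case: ifP => [/andP[t_m t'_m]|]; last by rewrite conjC0.
by rewrite -(wkernel_persymmetric_short oXF' eX'X F'X _ F'o z1 t_m t'_m).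
Qed.

End SplitShiftKernels.

(** * From the split-shift condition to Bernstein-Szego *)

Section LastOrthogonalBlock.
Variables (C : numClosedFieldType) (n m : nat).
Notation H := (bipoly C n m).
Variables (T : {scalar laurent C n m}) (hT : positive_form T).
Notation Mz := (Mz C n m).
Notation P' := (polys C n m (n%:Z - 1) m).
Notation dot := (ip hT).
Notation ortho := (orthonormal (ip hT)).
Variables e F : seq H.
Hypotheses (oeF : ortho (e ++ F)) (eP : {subset e <= P'}).
Hypotheses (se : size e = (n * m.+1)%N) (sF : size F = m.+1).
Let lin := ip_linear hT.
Let cnj := ip_conj hT.
Let pos := ip_gt0 hT.

Let seF : size (e ++ F) = (n.+1 * m.+1)%N.
Proof. by rewrite size_cat se sF mulSn addnC. Qed.

Lemma span_short : <<e>>%VS = P'.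
Proof.
have [oe _ _] := (orthonormal_cat _ _ _).1 oeF.
by apply: (orthonormal_basis lin cnj oe eP); rewrite dim_zshort.
Qed.

Lemma last_block_orth f u : f \in F -> u \in P' -> dot u f = 0.
Proof.
have [_ _ eF] := (orthonormal_cat _ _ _).1 oeF.
move=> fF; rewrite -span_short => ue; rewrite cnj.
have /orth_ip -> // : f \in orth hT <<e>>%VS; last by rewrite conjC0.
by apply: orth_span => x xe; rewrite cnj eF ?conjC0.
Qed.

(* The evaluation functional [u |-> sum_t v_t (z^n u(1/z))_t at z = b] killing
   [F] is represented by some [k] in [P'], and
   [|k - b z k|^2 = (|b|^2 - 1) |k|^2 <= 0] forces [k = b z k], so [k = 0]. *)
Lemma reverse_eval_inj b (v : nat -> C) : `|b| <= 1 ->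
  {in F, forall f, \sum_(t < m.+1) v t * (\sum_(k < n.+1) co f (n - k) t * b ^+ k) = 0} ->
  forall t, (t <= m)%N -> v t = 0.
Proof.
move=> b1 vF; pose la (u : H) := \sum_(t < m.+1) v t * (\sum_(k < n.+1) co u (n - k) t * b ^+ k).
have la_lin a x y : la (a *: x + y) = a * la x + la y.
  rewrite mulr_sumr -big_split; apply: eq_bigr => t _ /=.
  rewrite mulrCA -mulrDr; congr (_ * _); rewrite mulr_sumr -big_split.
  apply: eq_bigr => k _ /=.
  by rewrite coD coZ mulrDl mulrA.
have la0 : la 0 = 0 by have := la_lin (-1) 0 0; rewrite scaler0 addr0 mulN1r addNr.
have la_sum (r : seq H) (a : H -> C) : la (\sum_(x <- r) a x *: x) = \sum_(x <- r) a x * la x.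
  by elim: r => [|x r IH]; rewrite ?big_nil // !big_cons la_lin IH.
pose k := \sum_(x <- e) (la x)^* *: x.
have kP : k \in P' by rewrite /k big_seq memv_suml // => x /eP xP; exact: memvZ.
have laE u : la u = dot u k.
  rewrite {1}(full_expansion u oeF seF) la_sum big_cat /= [X in _ + X]big_seq.
  rewrite [X in _ + X]big1 ?addr0 => [|f /vF la_f]; last by rewrite [la f]la_f mulr0.
  rewrite /k (dot_sumr lin cnj); apply: eq_bigr => x _.
  by rewrite (dotZr lin cnj) conjCK mulrC.
(* Replacing [u] by [z u] divides [z^n u(1/z)] by [z]. *)
have la_shift u : u \in P' -> la u = b * la (Mz u).
  move=> /zshortP u0; rewrite /la mulr_sumr; apply: eq_bigr => t _.
  rewrite mulrCA; congr (_ * _); rewrite big_ord_recl subn0 u0 mul0r add0r.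
  rewrite [in RHS]big_ord_recr /= subnn co_Mz mul0r addr0 mulr_sumr.
  apply: eq_bigr => i _; rewrite co_Mz /= subn_gt0 ltn_ord leq_subr /= exprS mulrCA.
  by congr (_ * (co u _ _ * _)); rewrite /bump /=; have := ltn_ord i; lia.
have kk : dot k k = b * dot (Mz k) k by rewrite -!laE la_shift.
have kkc : dot k k = b^* * dot k (Mz k).
  by rewrite cnj kk (rmorphM Num.conj) /= -cnj.
have kbz : k = b *: Mz k.
  have dkk : 0 <= dot k k by have [->|/pos/ltW //] := eqVneq k 0; rewrite (dot0l lin).
  apply/eqP; rewrite -subr_eq0; apply/negPn/negP => /pos; apply/negP.
  have -> : dot (k - b *: Mz k) (k - b *: Mz k) = (`|b| ^+ 2 - 1) * dot k k.
    rewrite (dotBl lin) !(dotBr lin cnj) !(dotZl lin) !(dotZr lin cnj) ip_Mz // -kk -kkc.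
    by rewrite normCK; ring.
  rewrite le_gtF // mulr_le0_ge0 // subr_le0 expr_le1 //.
have k0 : k = 0.
  apply: co_inj => i t; have -> : co (0 : H) i t = 0 by rewrite /co mxE if_same.
  elim: i => [|i IH]; rewrite kbz coZ co_Mz /= ?mulr0 //.
  by case: ifP => _; rewrite ?mulr0 // IH mulr0.
(* For [u = z^n w^t] the reversed polynomial is the constant [w^t], so [la u] is [v t]. *)
move=> t tm; pose u : H := delta_mx ord_max (Ordinal (tm : t < m.+1)%N).
have := laE u; rewrite k0 (dot0r lin cnj) /la (bigD1 (Ordinal (tm : t < m.+1)%N)) //=.
rewrite big_ord_recl subn0 co_delta /= !eqxx mulr1 [X in 1 + X]big1 ?addr0 => [|i _]; last first.
  by rewrite co_delta /= /bump /= ltn_eqF ?mul0r //; have := ltn_ord i; lia.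
rewrite mulr1 big1 ?addr0 // => s st; rewrite big1 ?mulr0 // => i _.
by rewrite co_delta /= -[_ == t]/(val s == val (Ordinal (tm : t < m.+1)%N)) val_eqE (negbTE st) andbF mul0r.
Qed.

(** On the circle [conj z = 1/z], so [z^(-n) f(z)] is the reversed polynomial at [b = conj z]. *)
Lemma wcoef_inj z (v : nat -> C) : `|z| = 1 ->
  {in F, forall f, \sum_(t < m.+1) v t * wcoef f z t = 0} ->
  forall t, (t <= m)%N -> v t = 0.
Proof.
move=> z1 vF; have zc1 : `|z^*| <= 1 by rewrite norm_conjC z1.
apply: (reverse_eval_inj zc1) => f fF.
have z0 : z != 0 by rewrite -normr_eq0 z1 oner_eq0.
transitivity (z ^- n * \sum_(t < m.+1) v t * wcoef f z t); last by rewrite vF ?mulr0.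
rewrite mulr_sumr; apply: eq_bigr => t _; rewrite mulrCA; congr (_ * _).
rewrite /wcoef mulr_sumr (reindex_inj rev_ord_inj); apply: eq_bigr => k _ /=.
rewrite subSS subKn ?leq_ord // mulrCA; congr (_ * _).
have -> : z ^+ n = z ^+ (n - k) * z ^+ k by rewrite -exprD subnK ?leq_ord.
have -> : z^* = z^-1 by rewrite invC_norm z1 expr1n invr1 mul1r.
rewrite exprVn; have := expf_neq0 (n - k) z0; have := expf_neq0 k z0.
by move: (z ^+ k) (z ^+ (n - k)) => a b a0 b0; field; rewrite a0.
Qed.

Section ZeroFree.
Variables (F' : seq H) (p : H) (z : C).
Hypothesis z1 : `|z| = 1.
Hypothesis kernels : forall t t', (t <= m)%N -> (t' <= m)%N ->
  wkernel F z t t' = (if (0 < t)%N && (0 < t')%N then wkernel F' z t.-1 t'.-1 else 0)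
    + wcoef p z t * (wcoef p z t')^* /\
  wkernel F z t t' = (if (t < m)%N && (t' < m)%N then wkernel F' z t t' else 0)
    + (wcoef p z (m - t))^* * wcoef p z (m - t').

(** A Christoffel-Darboux argument. Let [S] and [S'] be the quadratic forms of the two kernels at
    the vector [(w^t)]. If [p(z, w) = 0], the first formula gives [S = |w|^2 S'] and the second
    [S = S' + |q|^2], which forces [q = 0]. The two formulas for [r] then give [y 0 = 0] and
    [y (t + 1) = w * y t], so [S = 0], against [wcoef_inj]. *)
Lemma wcoef_zero_free w : `|w| <= 1 -> \sum_(t < m.+1) wcoef p z t * w ^+ t != 0.
Proof.
move=> w1; apply/eqP => pw.
pose r t' := \sum_(t < m.+1) w ^+ t * wkernel F z t t'.
pose y t' := \sum_(t < m) w ^+ t * wkernel F' z t t'.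
pose q := \sum_(t < m.+1) w ^+ t * (wcoef p z (m - t))^*.
have r_lower t' : (t' <= m)%N -> r t' = if (0 < t')%N then w * y t'.-1 else 0.
  move=> t'm; rewrite /r.
  under eq_bigr => t _ do rewrite (kernels (leq_ord t) t'm).1 mulrDr mulrA.
  rewrite big_split /= -mulr_suml [X in _ + X * _](_ : _ = 0); last first.
    by rewrite -[RHS]pw; apply: eq_bigr => t _; rewrite mulrC.
  rewrite mul0r addr0 big_ord_recl /= mulr0 add0r; case: ifP => t'0.
    by rewrite mulr_sumr; apply: eq_bigr => t _ /=; rewrite ?t'0 exprS mulrA.
  by rewrite big1 // => t _; rewrite ?t'0 mulr0.
have r_upper t' : (t' <= m)%N -> r t' = (if (t' < m)%N then y t' else 0) + q * wcoef p z (m - t').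
  move=> t'm; rewrite /r.
  under eq_bigr => t _ do rewrite (kernels (leq_ord t) t'm).2 mulrDr mulrA.
  rewrite big_split /= -mulr_suml; congr (_ + _).
  rewrite big_ord_recr /= ltnn mulr0 addr0; case: ifP => t'_m.
    by apply: eq_bigr => t _; rewrite ltn_ord.
  by rewrite big1 // => t _; rewrite andbF mulr0.
pose S := \sum_(t < m.+1) (w ^+ t)^* * r t.
pose S' := \sum_(t < m) (w ^+ t)^* * y t.
have S_lower : S = `|w| ^+ 2 * S'.
  rewrite /S big_ord_recl r_lower //= mulr0 add0r mulr_sumr; apply: eq_bigr => t _.
  rewrite r_lower ?ltn_ord //= -[bump 0 t]/(t.+1) exprS (rmorphM Num.conj) normCK /= add0n.
  by move: (w^*) ((w ^+ t)^*) => a b; ring.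
have S_upper : S = S' + `|q| ^+ 2.
  rewrite /S; under eq_bigr => t _ do rewrite r_upper ?leq_ord // mulrDr.
  rewrite big_split /=; congr (_ + _).
    rewrite big_ord_recr /= ltnn mulr0 addr0; apply: eq_bigr => t _.
    by rewrite ltn_ord.
  rewrite normCK /q rmorph_sum mulr_sumr; apply: eq_bigr => t _.
  by rewrite (rmorphM Num.conj) /= conjCK mulrCA.
have sq (Fs : seq H) N : \sum_(t' < N) (w ^+ t')^* * (\sum_(t < N) w ^+ t * wkernel Fs z t t') =
    \sum_(f <- Fs) `|\sum_(t < N) w ^+ t * wcoef f z t| ^+ 2.
  under [RHS]eq_bigr => f _ do rewrite normCK rmorph_sum mulr_sumr.
  rewrite [RHS]exchange_big; apply: eq_bigr => t' _ /=.
  under eq_bigr => t _ do rewrite mulr_sumr.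
  rewrite exchange_big mulr_sumr; apply: eq_bigr => f _ /=.
  rewrite (rmorphM Num.conj) mulr_suml mulr_sumr; apply: eq_bigr => t _ /=; ring.
have S'_ge0 : 0 <= S' by rewrite /S' sq sumr_ge0 // => f _; rewrite exprn_ge0.
have S_gt0 : 0 < S.
  rewrite lt_neqAle /S sq sumr_ge0 ?andbT => [|f _]; last by rewrite exprn_ge0.
  apply/negP => /eqP/esym/eqP; rewrite psumr_eq0 => [/allP h|f _]; last by rewrite exprn_ge0.
  have /(wcoef_inj z1) : {in F, forall f, \sum_(t < m.+1) w ^+ t * wcoef f z t = 0}.
    by move=> f /h /=; rewrite expf_eq0 /= normr_eq0 => /eqP.
  by move=> /(_ 0%N isT) /eqP; rewrite expr0 oner_eq0.
have w2 : `|w| ^+ 2 <= 1 by rewrite expr_le1.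
have qq : `|q| ^+ 2 = 0.
  apply/eqP; rewrite eq_le exprn_ge0 // andbT.
  have -> : `|q| ^+ 2 = (`|w| ^+ 2 - 1) * S'.
    by have := S_upper; rewrite S_lower => h; rewrite mulrBl mul1r h addrC addKr.
  by rewrite mulr_le0_ge0 // subr_le0.
have q0 : q = 0 by apply/eqP; rewrite -normr_eq0 -sqrf_eq0 qq.
have y0 t : (t < m)%N -> y t = 0.
  elim: t => [|t IH] tm.
    by have := r_upper 0%N isT; rewrite r_lower //= tm q0 mul0r addr0 => <-.
  have := r_upper t.+1 (ltnW tm); rewrite (r_lower t.+1 (ltnW tm)) /= tm q0 mul0r addr0 => <-.
  by rewrite IH ?mulr0 // ltnW.
by move: S_gt0; rewrite S_lower /S' big1 ?mulr0 ?ltxx // => t _; rewrite y0 ?mulr0.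
Qed.

End ZeroFree.

End LastOrthogonalBlock.

Section Reconstruction.
Variables (R : realType) (n m : nat).
Notation C := R[i].
Notation H := (bipoly C n m).
Variables (T : {scalar laurent C n m}) (hT : positive_form T).
Notation Mz := (Mz C n m).
Notation P' := (polys C n m (n%:Z - 1) m).
Notation dot := (ip hT).
Notation ortho := (orthonormal (ip hT)).
Notation tau := (form_moment T).
Variables e F F' : seq H.
Variable p : H.
Hypotheses (oeF : ortho (e ++ F)) (eP : {subset e <= P'}).
Hypotheses (se : size e = (n * m.+1)%N) (sF : size F = m.+1).
Hypothesis kernels : forall z : C, `|z| = 1 -> forall t t', (t <= m)%N -> (t' <= m)%N ->
  wkernel F z t t' = (if (0 < t)%N && (0 < t')%N then wkernel F' z t.-1 t'.-1 else 0)
    + wcoef p z t * (wcoef p z t')^* /\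
  wkernel F z t t' = (if (t < m)%N && (t' < m)%N then wkernel F' z t t' else 0)
    + (wcoef p z (m - t))^* * wcoef p z (m - t').
Let lin := ip_linear hT.
Let cnj := ip_conj hT.
Let pos := ip_gt0 hT.

Definition bs_poly : {poly {poly C}} := \poly_(i < n.+1) \poly_(j < m.+1) co p i j.
Notation c := (torus_moment bs_poly).
Notation Fi i := (nth (0 : H) F (nat_of_ord i)).

Lemma coef_bs_poly (z : C) t : (t <= m)%N -> (bs_poly.[z%:P])`_t = wcoef p z t.
Proof.
move=> tm; rewrite horner_poly coef_sum; apply: eq_bigr => i _.
by rewrite -polyC_exp coefMC coef_poly ltnS tm.
Qed.

Lemma size_bs_poly : (size bs_poly <= n.+1)%N /\ (sizeY bs_poly <= m.+1)%N.
Proof.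
split; first exact: size_poly.
apply/bigmax_leqP => i _; rewrite coef_poly; case: ifP => _; last by rewrite size_poly0.
exact: size_poly.
Qed.

Let size_evalC (z : C) : (size (bs_poly.[z%:P])%R <= m.+1)%N.
Proof. exact: leq_trans (max_size_evalC _ _) size_bs_poly.2. Qed.

Lemma bs_poly_neq0 (z w : C) : `|z| = 1 -> `|w| <= 1 -> bs_poly.[z, w] != 0.
Proof.
move=> z1 w1; rewrite (horner_coef_wide _ (size_evalC z)).
under eq_bigr => t _ do rewrite coef_bs_poly ?leq_ord //.
exact: (wcoef_zero_free oeF eP se sF z1 (kernels z1) w1).
Qed.

(** The kernel of [F] is [Phi Phi^*], with [Phi] square because [F] has [m + 1] members. A right
    inverse is then a left inverse, and [Phi (Phi^* S) = 1] becomes [Phi^* S Phi = 1]. *)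
Lemma last_block_slice (z : C) (i j : 'I_m.+1) : `|z| = 1 ->
  \sum_(t < m.+1) \sum_(t' < m.+1) (wcoef (Fi j) z t')^* * wcoef (Fi i) z t *
    slice_moment bs_poly z (t%:Z - t'%:Z) = (i == j)%:R.
Proof.
move=> z1.
have [inv _] := gohberg_semencul_inverse (m := m) (p := wcoef p z)
  (c := slice_moment bs_poly z) (G := wkernel F z) (G' := wkernel F' z)
  ltac:(by rewrite -coef_bs_poly // -horner_coef0; apply: bs_poly_neq0; rewrite ?normr0)
  ltac:(by move=> l _; rewrite -coef_bs_poly // -(slice_moment_orth bs_poly_neq0 _ z1 (size_evalC z));
    apply: eq_bigr => k _; rewrite coef_bs_poly ?leq_ord)
  ltac:(by move=> l _; rewrite -coef_bs_poly // -(slice_moment_orth_conj bs_poly_neq0 _ z1 (size_evalC z));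
    apply: eq_bigr => k _; rewrite coef_bs_poly ?leq_ord)
  (fun t t' tm t'm => (kernels z1 tm t'm).1) (fun t t' tm t'm => (kernels z1 tm t'm).2).
pose Phi : 'M[C]_m.+1 := \matrix_(t, i) wcoef (Fi i) z t.
pose PhiC : 'M[C]_m.+1 := \matrix_(i, t) (wcoef (Fi i) z t)^*.
pose S : 'M[C]_m.+1 := \matrix_(t', t) slice_moment bs_poly z (t%:Z - t'%:Z).
have E : Phi *m (PhiC *m S) = 1%:M.
  rewrite mulmxA; apply/matrixP => a b; rewrite !mxE -inv ?leq_ord //.
  apply: eq_bigr => t _; rewrite !mxE; congr (_ * _).
  rewrite /wkernel [RHS](big_nth (0 : H)) big_mkord sF; apply: eq_bigr => k _.
  by rewrite !mxE.
have /matrixP/(_ j i) := mulmx1C E; rewrite !mxE eq_sym => <-.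
apply: eq_bigr => t _; rewrite !mxE mulr_suml; apply: eq_bigr => t' _.
by rewrite !mxE; ring.
Qed.

(** The left side is the product of [Fi i] and [z^s * Fi j] in the form of [1 / |p|^2]. It is
    obtained by integrating [last_block_slice] against [z^(-s)]. *)
Lemma last_block_torus (i j : 'I_m.+1) (s : int) :
  \sum_(k < n.+1) \sum_(t < m.+1) (co (Fi j) k t)^* * pairing c (Fi i) (s + k%:Z) t =
  ((s == 0) && (i == j))%:R.
Proof.
have quad (G : 'I_n.+1 -> 'I_m.+1 -> 'I_n.+1 -> 'I_m.+1 -> C) :
    \sum_k \sum_t \sum_b \sum_d G k t b d =
    \sum_(x : 'I_n.+1 * 'I_m.+1 * ('I_n.+1 * 'I_m.+1)) G x.1.1 x.1.2 x.2.1 x.2.2.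
  rewrite pair_bigA /=; under eq_bigr => x _ do rewrite pair_bigA /=.
  by rewrite pair_bigA.
transitivity (\sum_(k < n.+1) \sum_(t < m.+1) \sum_(b < n.+1) \sum_(d < m.+1)
    (co (Fi j) k t)^* * co (Fi i) b d * c (b%:Z - (s + k%:Z)) (d%:Z - t%:Z)).
  apply: eq_bigr => k _; apply: eq_bigr => t _; rewrite mulr_sumr; apply: eq_bigr => b _.
  by rewrite mulr_sumr; apply: eq_bigr => d _; rewrite mulrA.
rewrite quad (torus_moment_sum bs_poly_neq0 (b := (i == j)%:R) (u := - s)) => [|z z1].
  by rewrite oppr_eq0 -natrM mulnb andbC.
have z0 : z != 0 by rewrite -normr_eq0 z1 oner_eq0.
rewrite -(quad (fun k t b d => (co (Fi j) k t)^* * co (Fi i) b d * z ^ (b%:Z - (s + k%:Z)) *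
  slice_moment bs_poly z (d%:Z - t%:Z))).
rewrite -(last_block_slice i j z1) mulr_suml.
under eq_bigr => k _ do rewrite exchange_big /=.
rewrite exchange_big.
under eq_bigr => b _.
  under eq_bigr => k _ do rewrite exchange_big /=.
  rewrite exchange_big /=.
  over.
rewrite exchange_big; apply: eq_bigr => d _ /=.
rewrite mulr_suml.
under eq_bigr => b _ do rewrite exchange_big /=.
rewrite exchange_big; apply: eq_bigr => t _ /=.
move: (slice_moment _ _ _) => S; rewrite exchange_big /= /wcoef rmorph_sum !mulr_suml.
apply: eq_bigr => k _ /=; rewrite mulr_sumr !mulr_suml; apply: eq_bigr => b _.
rewrite (rmorphM Num.conj) (rmorphXn Num.conj) /=.
have -> : z ^ (b%:Z - (s + k%:Z)) = z ^+ b * z ^ (- s) * z^* ^+ k.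
  have -> : z^* = z^-1 by rewrite invC_norm z1 expr1n invr1 mul1r.
  by rewrite opprD addrA !expfzDr // -!exprnP exprVn -exprnN.
by ring.
Qed.

(** At negative shifts [last_block_torus] is a homogeneous recurrence with matrix [Psi] for the
    pairings, read downwards from index [n - 1]. By [reverse_eval_inj] the determinant of [Psi] has
    no root in the closed disk, so the bounded one-sided solution is [0]. *)
Lemma last_block_pairing (i : 'I_m.+1) (s t : nat) : (s < n)%N -> (t <= m)%N ->
  pairing c (Fi i) s t = 0.
Proof.
move=> sn tm.
pose Psi : 'M[{poly C}]_m.+1 := \matrix_(j, t) \poly_(k < n.+1) (co (Fi j) (n - k) t)^*.
have Psi_size j l : (size (Psi j l) <= n.+1)%N by rewrite mxE size_poly.
have Psi_det a : `|a| <= 1 -> (\det Psi).[a] != 0.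
  move=> a1; rewrite -horner_evalE -det_map_mx -det_tr; apply/negP => /det0P[v v0 vP].
  have ac1 : `|a^*| <= 1 by rewrite norm_conjC.
  have := reverse_eval_inj oeF eP se sF (v := fun t => (v 0 (inord t))^*) ac1.
  move=> H0; move/eqP: v0; apply; apply/rowP => l; rewrite mxE -[l]inord_val -[RHS]conjCK.
  rewrite -[LHS]conjCK H0 ?conjC0 ?leq_ord // => _ /(nthP (0 : H))[k kF <-].
  have km : (k < m.+1)%N by rewrite -sF.
  have /rowP/(_ (Ordinal km)) := vP; rewrite !mxE => /(congr1 Num.conj).
  rewrite conjC0 => E; apply: etrans E; rewrite rmorph_sum; apply: eq_bigr => d _ /=.
  rewrite !mxE (rmorphM Num.conj) inord_val /horner_eval; congr (_ * _).
  rewrite horner_poly rmorph_sum; apply: eq_bigr => b _ /=.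
  by rewrite (rmorphM Num.conj) (rmorphXn Num.conj) /= conjCK.
pose y (l : 'I_m.+1) (r : nat) := pairing c (Fi i) (n%:Z - 1 - r%:Z) l.
have y0 : forall l r, y l r = 0.
  apply: (poly_act_matrix_inj (M := Psi) (sg := succn)).
  - by apply: contraNneq (Psi_det 0 _) => [->|]; rewrite ?horner0 ?normr0.
  - move=> a ra; apply: regular_root_succ; rewrite real_ltNge ?real1 ?normr_real //.
    by apply: contraL ra => a1; exact: Psi_det.
  - move=> l; have [K bK] := pairing_bounded (torus_moment_bounded bs_poly_neq0) (Fi i) l.
    by exists K => r; exact: bK.
  move=> j r; have := last_block_torus i j (- 1 - r%:Z).
  have -> : (- 1 - r%:Z == 0) = false by lia.
  rewrite andFb => E; rewrite -[RHS]E [RHS](reindex_inj rev_ord_inj) /= [RHS]exchange_big /=.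
  apply: eq_bigr => l _; rewrite (poly_act_wide _ _ _ (Psi_size j l)); apply: eq_bigr => k _.
  have kE : iter k succn r = (r + k)%N.
    by elim: (k : nat) => [|q IH] /=; rewrite ?addn0 // IH addnS.
  rewrite mxE coef_poly ltn_ord subSS /y kE.
  by have -> : n%:Z - 1 - (r + k)%N%:Z = - 1 - r%:Z + (n - k)%N%:Z by have := leq_ord k; lia.
have := y0 (Ordinal (tm : (t < m.+1)%N)) (n - s.+1)%N; rewrite /y.
by have -> : n%:Z - 1 - (n - s.+1)%N%:Z = s by lia.
Qed.

End Reconstruction.

Section Agreement.
Variables (R : realType) (n m : nat).
Notation C := R[i].
Notation H := (bipoly C n m).
Variables (T : {scalar laurent C n m}) (hT : positive_form T).
Notation Mz := (Mz C n m).
Notation P' := (polys C n m (n%:Z - 1) m).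
Notation dot := (ip hT).
Notation ortho := (orthonormal (ip hT)).
Notation tau := (form_moment T).
Variables e F F' : seq H.
Variable p : H.
Hypotheses (oeF : ortho (e ++ F)) (eP : {subset e <= P'}).
Hypotheses (se : size e = (n * m.+1)%N) (sF : size F = m.+1).
Hypothesis kernels : forall z : C, `|z| = 1 -> forall t t', (t <= m)%N -> (t' <= m)%N ->
  wkernel F z t t' = (if (0 < t)%N && (0 < t')%N then wkernel F' z t.-1 t'.-1 else 0)
    + wcoef p z t * (wcoef p z t')^* /\
  wkernel F z t t' = (if (t < m)%N && (t' < m)%N then wkernel F' z t t' else 0)
    + (wcoef p z (m - t))^* * wcoef p z (m - t').
Let lin := ip_linear hT.
Let cnj := ip_conj hT.
Notation c := (torus_moment (bs_poly p)).

Lemma orthonormal_nth (r : seq H) i j : ortho r -> (i < size r)%N -> (j < size r)%N ->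
  dot r`_i r`_j = (i == j)%:R.
Proof.
elim: r i j => // x r IH [|i] [|j] //= [xx xr oR] ir jr.
- exact: xx.
- by rewrite xr ?mem_nth.
- by rewrite cnj xr ?mem_nth // conjC0.
- exact: IH.
Qed.

Let seF : size (e ++ F) = (n.+1 * m.+1)%N.
Proof. by rewrite size_cat se sF mulSn addnC. Qed.

Let FP : {subset F <= orth hT P'}.
Proof. by move=> f fF; apply/orth_ip => u uP; rewrite cnj (last_block_orth oeF eP se fF uP) conjC0. Qed.

(** The defect between the given form and that of [1 / |p|^2], to be shown zero. *)
Let d (u v : H) : C := dot u v - toeplitz_form c u v.

Let d_lin a x y z : d (a *: x + y) z = a * d x z + d y z.
Proof. by rewrite /d lin toeplitz_linear; ring. Qed.

Let d_conj x y : d x y = (d y x)^*.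
Proof.
rewrite /d (rmorphB Num.conj) /= -cnj; congr (_ - _); apply: toeplitz_conj.
exact: (torus_moment_conj (bs_poly_neq0 oeF eP se sF kernels)).
Qed.

(** For both forms [F] is orthonormal and orthogonal to [P_{n-1,m}], so the defect vanishes against
    the basis [e ++ F]. *)
Let d_last_block f v : f \in F -> d f v = 0.
Proof.
move=> /(nthP (0 : H))[i iF <-].
have im : (i < m.+1)%N by rewrite -sF.
have dx x : x \in e ++ F -> d F`_i x = 0.
  rewrite mem_cat => /orP[xe|/(nthP (0 : H))[j jF <-]].
    have xP := eP xe; rewrite /d cnj (last_block_orth oeF eP se _ xP) ?mem_nth // conjC0 sub0r.
    apply/eqP; rewrite oppr_eq0; apply/eqP; rewrite /toeplitz_form.
    rewrite big1 // => k _; rewrite big1 // => l _.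
    have [kn|nk] := ltnP k n.
      by rewrite (last_block_pairing oeF eP se sF kernels (Ordinal im)) ?mulr0 ?leq_ord.
    have -> : (k : nat) = n by apply/eqP; rewrite eqn_leq nk leq_ord.
    by move/zshortP: xP => ->; rewrite conjC0 mul0r.
  have jm : (j < m.+1)%N by rewrite -sF.
  have [_ oF _] := (orthonormal_cat _ _ _).1 oeF.
  rewrite /d orthonormal_nth //; apply/eqP; rewrite subr_eq0; apply/eqP.
  have := last_block_torus oeF eP se sF kernels (Ordinal im) (Ordinal jm) 0.
  rewrite eqxx /= => <-; apply: eq_bigr => k _; apply: eq_bigr => l _.
  by rewrite add0r.
rewrite (full_expansion v oeF seF) (dot_sumr d_lin d_conj) big_seq big1 // => x xE.
by rewrite (dotZr d_lin d_conj) dx ?mulr0.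
Qed.

Let d_reversal f v : f \in F -> d (reversal f) v = 0.
Proof.
move=> fF; rewrite -[v]reversalK /d ip_reversal toeplitz_reversal -/(d _ _).
by rewrite d_conj d_last_block ?conjC0.
Qed.

Let delta (u : H) : H := \sum_(x <- e ++ F) d u x *: x.

Let dot_delta u v : dot (delta u) v = d u v.
Proof.
rewrite [in RHS](full_expansion v oeF seF) (dot_sumr d_lin d_conj) (dot_suml lin).
by apply: eq_bigr => x _; rewrite (dotZl lin) (dotZr d_lin d_conj) -cnj mulrC.
Qed.

Let delta_mem u : delta u \in P'.
Proof.
rewrite /delta big_cat /= [X in _ + X]big_seq [X in _ + X]big1 ?addr0 => [|f fF].
  by rewrite big_seq memv_suml // => x /eP xP; exact: memvZ.
by rewrite d_conj d_last_block // conjC0 scale0r.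
Qed.

Let delta_eq0 u : (forall v, d u v = 0) -> delta u = 0.
Proof. by move=> u0; rewrite /delta big1 // => x _; rewrite u0 scale0r. Qed.

Let deltaD u v : delta (u + v) = delta u + delta v.
Proof. by rewrite -big_split; apply: eq_bigr => x _; rewrite (dotDl d_lin) scalerDl. Qed.

Let oe2 := orthonormal_reversed_basis oeF eP FP.

Let se2 : (size (map Mz e ++ map (@reversal C n m) F) = n.+1 * m.+1)%N.
Proof. by rewrite size_cat !size_map -size_cat. Qed.

(** Tested on the basis formed by [z e] and the reversals of [F]: against [z e] both forms are
    Toeplitz; a reversal of [F] has no defect and is orthogonal to [z P_{n-1,m}], which contains
    [z * delta u]. *)
Let delta_Mz u : u \in P' -> delta (Mz u) = Mz (delta u).
Proof.
move=> uP; apply/eqP; rewrite -subr_eq0; apply/eqP.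
rewrite [LHS](full_expansion _ oe2 se2) big_seq big1 // => x.
rewrite mem_cat => /orP[/mapP[y ye ->]|/mapP[f fF ->]].
  have yP := eP ye; rewrite (dotBl lin) dot_delta ip_Mz // dot_delta /d ip_Mz //.
  move/zshortP: uP => u0; move/zshortP: yP => y0.
  by rewrite toeplitz_Mz // subrr scale0r.
rewrite (dotBl lin) dot_delta d_conj d_reversal // conjC0 sub0r cnj.
by rewrite orth_Mz_reversal ?FP ?delta_mem // conjC0 oppr0 scale0r.
Qed.

(** With [u = z u'] plus a combination of reversals of [F], which [delta] kills,
    [delta u = z * delta u']; every round gains one power of [z]. *)
Let delta_row k u i j : (i < k)%N -> co (delta u) i j = 0.
Proof.
elim: k u i => // k IH u i ik.
pose u' := \sum_(x <- e) dot u (Mz x) *: x.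
have u'P : u' \in P' by rewrite /u' big_seq memv_suml // => x /eP xP; exact: memvZ.
have uE : u = Mz u' + \sum_(f <- F) dot u (reversal f) *: reversal f.
  rewrite {1}(full_expansion u oe2 se2) big_cat !big_map /=; congr (_ + _).
  by rewrite linear_sum; apply: eq_bigr => x _; rewrite linearZ.
rewrite uE deltaD [X in _ + X]delta_eq0 ?addr0 => [|v]; last first.
  rewrite (dot_suml d_lin) big_seq big1 // => f fF.
  by rewrite (dotZl d_lin) d_reversal ?mulr0.
rewrite delta_Mz // co_Mz; case: ifP => // /andP[i0 _].
by apply: IH; case: i i0 ik => // i _; rewrite ltnS.
Qed.

Lemma form_moment_torus (s t : int) : `|s| <= n%:Z -> `|t| <= m%:Z -> tau s t = c s t.
Proof.
move=> sn tm.
have d0 u v : d u v = 0.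
  rewrite -dot_delta (_ : delta u = 0) ?(dot0l lin) //; apply: co_inj => i j.
  by rewrite (delta_row u j (ltnSn i)) /co mxE if_same.
(* [(s, t)] is written as a difference of two exponents of the box, so that the moment is the form
   at two monomials. *)
pose a : nat := if 0 <= s then `|s|%N else 0%N; pose k : nat := if 0 <= s then 0%N else `|s|%N.
pose b : nat := if 0 <= t then `|t|%N else 0%N; pose l : nat := if 0 <= t then 0%N else `|t|%N.
have ak : [/\ (a < n.+1)%N, (k < n.+1)%N & a%:Z - k%:Z = s].
  by rewrite /a /k; case: ifP => s0; split; lia.
have bl : [/\ (b < m.+1)%N, (l < m.+1)%N & b%:Z - l%:Z = t].
  by rewrite /b /l; case: ifP => t0; split; lia.
have [an kn akE] := ak; have [bm lm blE] := bl.
have := d0 (delta_mx (Ordinal an) (Ordinal bm)) (delta_mx (Ordinal kn) (Ordinal lm)).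
rewrite /d ip_pairing !toeplitz_delta !pairing_delta /= akE blE => /eqP.
by rewrite subr_eq0 => /eqP.
Qed.

End Agreement.

Lemma split_shift_bernstein_szego (R : realType) (n m : nat)
    (T : {scalar laurent R[i] n m}) (hT : positive_form T) :
  split_shift_orthogonality hT -> bernstein_szego T.
Proof.
move=> /split_shift_kernels[e [F [F' [p [oeF eP se sF kernels]]]]].
exists (bs_poly p); split; first exact: size_bs_poly.
- exact: bs_poly_neq0 oeF eP se sF kernels.
- exact: form_moment_torus oeF eP se sF kernels.
Qed.

Theorem theorem2p2 (R : realType) (n m : nat) (T : {scalar laurent R[i] n m})
    (hT : positive_form T) :
  [/\ bernstein_szego T <-> split_shift_orthogonality hT,
      split_shift_orthogonality hT <->
        (forall f, invariant_hull (opT hT) (limg (opB hT)) f ->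
           f \in lker (opA hT)) &
      (forall f, invariant_hull (opT hT) (limg (opB hT)) f ->
         f \in lker (opA hT)) <->
        (forall j, (j < n)%N ->
           (opA hT \o iter j (comp_lfun (opT hT)) \1 \o opB hT = 0)%VF)].
Proof.
have hullP := hull_iterP hT.
split; last exact: hullP.
- split; last exact: split_shift_bernstein_szego.
  by move=> bs; apply/hull_split_shift/hullP/bernstein_szego_matrix.
- split; last exact: hull_split_shift.
  by move=> ss; apply/hullP/bernstein_szego_matrix/split_shift_bernstein_szego/ss.
Qed.
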